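(* Let $k$ be a field with $\operatorname{char}(k)=2$. Then $\operatorname{ed}(\operatorname{Alg}_{8,2})\leq 9$; that is, for every field $F$ containing $k$ and every central simple $F$-algebra $A$ of degree $8$ and exponent dividing $2$, there exist a field $E$ with $k\subseteq E\subseteq F$ of transcendence degree at most $9$ over $k$ and a central simple $E$-algebra $A_0$ of degree $8$ and exponent dividing $2$ such that $A_0\otimes_E F\cong A$.
   Context: For a base field $k$, $\operatorname{Alg}_{d,e}$ denotes the functor sending a field $F\supseteq k$ to the set of isomorphism classes of central simple $F$-algebras of degree $d$ and exponent dividing $e$. The essential dimension of an algebra $A\in\operatorname{Alg}_{d,e}(F)$ is the minimal transcendence degree over $k$ of a field $E$ with $k\subseteq E\subseteq F$ such that $A\cong A_0\otimes_E F$ for some $A_0\in\operatorname{Alg}_{d,e}(E)$; $\operatorname{ed}(\operatorname{Alg}_{d,e})$ is the supremum of these essential dimensions over all fields $F\supseteq k$ and all $A\in\operatorname{Alg}_{d,e}(F)$. *)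

(* Defs.v *)
From HB Require Import structures.
From mathcomp Require Import all_boot all_order all_algebra.
From mathcomp Require Import mpoly.
Set Implicit Arguments. Unset Strict Implicit. Unset Printing Implicit Defensive.
Import Order.TTheory GRing.Theory Num.Theory.
Local Open Scope ring_scope.

(* A finite-dimensional algebra over a field F with basis indexed by a finite
   type I is given by its structure constants c i j l = coefficient of e_l in
   e_i * e_j.  Elements are coordinate vectors {ffun I -> F}. *)
Section FDAlg.
Variables (F : fieldType) (I : finType).

Definition amul (c : I -> I -> I -> F) (x y : {ffun I -> F}) : {ffun I -> F} :=
  [ffun l => \sum_i \sum_j x i * y j * c i j l].

Definition ascale (a : F) (x : {ffun I -> F}) : {ffun I -> F} :=
  [ffun l => a * x l].

Definition alg_assoc (c : I -> I -> I -> F) : Prop :=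
  forall x y z, amul c (amul c x y) z = amul c x (amul c y z).

Definition alg_unit (c : I -> I -> I -> F) (u : {ffun I -> F}) : Prop :=
  forall x, amul c u x = x /\ amul c x u = x.

Definition alg_ideal (c : I -> I -> I -> F) (P : {ffun I -> F} -> Prop) : Prop :=
  [/\ P 0, (forall x y, P x -> P y -> P (x + y)),
      (forall (a : F) x, P x -> P (ascale a x)) &
      (forall x y, P y -> P (amul c x y) /\ P (amul c y x))].

Definition is_csa (d : nat) (c : I -> I -> I -> F) : Prop :=
  [/\ #|I| = (d ^ 2)%N, alg_assoc c &
      exists u, [/\ alg_unit c u,
        (forall z, (forall x, amul c z x = amul c x z) -> exists a : F, z = ascale a u) &
        (forall P, alg_ideal c P -> (forall x, P x -> x = 0) \/ (forall x, P x))]].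
End FDAlg.

Definition alg_iso (F : fieldType) (I J : finType)
  (c : I -> I -> I -> F) (c' : J -> J -> J -> F) : Prop :=
  exists f : {ffun I -> F} -> {ffun J -> F},
    [/\ (forall (a : F) x y, f (ascale a x + y) = ascale a (f x) + f y),
        bijective f &
        (forall x y, f (amul c x y) = amul c' (f x) (f y))].

(* e-th tensor power A^{(x) e}, basis indexed by e-tuples of basis indices *)
Definition tpow (F : fieldType) (I : finType) (e : nat) (c : I -> I -> I -> F)
  : {ffun 'I_e -> I} -> {ffun 'I_e -> I} -> {ffun 'I_e -> I} -> F :=
  fun p q r => \prod_(t < e) c (p t) (q t) (r t).

(* the matrix algebra M_N(F), basis the matrix units E_(a,b) *)
Definition matc (F : fieldType) (N : nat) :
  'I_N * 'I_N -> 'I_N * 'I_N -> 'I_N * 'I_N -> F :=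
  fun p q r => if [&& p.2 == q.1, r.1 == p.1 & r.2 == q.2] then 1 else 0.

(* exponent of the CSA A (degree d) divides e: e[A] = 0 in Br(F), i.e.
   A^{(x) e} (of degree d^e) is split: A^{(x) e} ~= M_{d^e}(F). *)
Definition exp_dvd (F : fieldType) (I : finType) (d e : nat)
  (c : I -> I -> I -> F) : Prop :=
  alg_iso (@tpow F I e c) (@matc F (d ^ e)%N).

Definition trdeg_le (k E : fieldType) (j : {rmorphism k -> E}) (n : nat) : Prop :=
  forall t : 'I_n.+1 -> E,
    exists p : {mpoly k[n.+1]}, p != 0 /\ mmap j t p = 0.

(* Main.v *)
(* By Wedderburn's theorem A is a matrix algebra over a division algebra D, and since the
   tensor square of A is split, D carries an anti-automorphism and hence an involution.
   Suppose that D has degree 8. Using symplectic involutions one finds commuting elements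
   u, v, w, each satisfying t^2 + t in F, that generate a maximal subfield, and elements
   x, y, z such that conjugation by x adds 1 to u and fixes v and w, and similarly for y
   with v and for z with w; they can be chosen with yz = zy and such that some
   anti-automorphism s fixes all six. Then y^2 and z^2 lie in F + Fu, (xy)^2 in F + Fw,
   (xz)^2 in F + Fv and (xyz)^2 in F + F(v + w), and the coefficients of these squares and
   of the equations of u, v, w determine the multiplication table of the monomial basis.
   A norm relation between the coefficients, together with translations of u, v, w by
   scalars, leaves nine of them; smaller degrees need fewer parameters. Let E be generated
   over k by the nine parameters and let A0 be the E-span of the basis. It is stable
   under the extension of s, so that a (x) b acts on A0 by d |-> a d s(b); this splits the
   tensor square of A0. *)
Require Import Defs.
From HB Require Import structures.
From mathcomp Require Import all_boot all_order all_algebra all_field.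
From mathcomp Require Import mpoly zify ring boolp.
Set Implicit Arguments. Unset Strict Implicit. Unset Printing Implicit Defensive.
Import GRing.Theory.
Local Open Scope ring_scope.

(** * Ring identities in characteristic two *)

(** Scalars are never extended. The reduced trace is replaced by a trace form [tr], unique up to a
    scalar, and by the constant [kp] with [tr (x * x) = kp * tr x ^+ 2]. Degrees are controlled by
    [Sym_bound]: a subalgebra of dimension [m] fixed pointwise by an involution satisfies
    [m ^ 2 <= \dim D], strictly if it consists of alternating elements. So in degree 8 the
    alternating elements of a symplectic involution have degree at most 4 over [F]. The obstacle is
    separability: such an element may be purely inseparable, or its quartic minimal polynomial may
    have odd terms and give no quadratic subfield. Making a Pfaffian trace vanish at [y] and [y^-1]
    removes the odd terms. For the later elements, if every candidate has a scalar fourth power,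
    polarising this condition produces a centraliser that contradicts the bound. The count: there
    are thirteen coefficients, three Artin-Schreier constants and five pairs. Translating [v] and
    [w] removes one each. Two more go: either [e0] and [a], by translating [u] and by the norm
    relation, or [e1] and [f1], which both vanish. *)

Inductive ncscal := ScV of nat | Sc0 | Sc1 | ScA of ncscal & ncscal | ScM of ncscal & ncscal.

Inductive ncexp :=
  | NcV of nat | Nc0 | Nc1 | NcN of ncexp | NcA of ncexp & ncexp | NcM of ncexp & ncexp
  | NcZ of ncscal & ncexp.

(* A monomial is a commutative scalar part followed by a word in the algebra variables. *)
Definition ncmono := (seq nat * seq nat)%type.

Fixpoint nc_snorm (e : ncscal) : seq (seq nat) :=
  match e with
  | ScV i => [:: [:: i]]
  | Sc0 => [::]
  | Sc1 => [:: [::]]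
  | ScA a b => nc_snorm a ++ nc_snorm b
  | ScM a b => [seq m ++ n | m <- nc_snorm a, n <- nc_snorm b]
  end.

Fixpoint nc_norm (e : ncexp) : seq ncmono :=
  match e with
  | NcV i => [:: ([::], [:: i])]
  | Nc0 => [::]
  | Nc1 => [:: ([::], [::])]
  | NcN a => nc_norm a
  | NcA a b => nc_norm a ++ nc_norm b
  | NcM a b => [seq (sort leq (m.1 ++ n.1), m.2 ++ n.2) | m <- nc_norm a, n <- nc_norm b]
  | NcZ a b => [seq (sort leq (m ++ n.1), n.2) | m <- nc_snorm a, n <- nc_norm b]
  end.

(* Equal monomials cancel in pairs: the characteristic is two. *)
Definition nc_cancel (p : seq ncmono) : seq ncmono :=
  foldr (fun m acc => if m \in acc then rem m acc else m :: acc) [::] p.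

Definition ncrule := (seq nat * seq ncmono)%type.

(** [pre] holds, in reverse order, the letters already scanned. *)
Fixpoint nc_find (r : ncrule) (pre m : seq nat) : option (seq ncmono) :=
  if prefix r.1 m then
    Some [seq (n.1, rev pre ++ n.2 ++ drop (size r.1) m) | n <- r.2]
  else if m is i :: m' then nc_find r (i :: pre) m' else None.

Fixpoint nc_step (rs : seq ncrule) (m : ncmono) : seq ncmono :=
  if rs is r :: rs' then
    if nc_find r [::] m.2 is Some p then [seq (sort leq (m.1 ++ n.1), n.2) | n <- p]
    else nc_step rs' m
  else [:: m].

Fixpoint nc_red (fuel : nat) (rs : seq ncrule) (p : seq ncmono) : seq ncmono :=
  if fuel is fuel'.+1 then nc_red fuel' rs (nc_cancel (flatten (map (nc_step rs) p))) else p.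

Section Nc.
Variables (F : fieldType) (D : algType F) (h2 : forall x : D, x + x = 0).
Variables (es : seq F) (ev : seq D).

Fixpoint nc_seval (e : ncscal) : F :=
  match e with
  | ScV i => es`_i
  | Sc0 => 0
  | Sc1 => 1
  | ScA a b => nc_seval a + nc_seval b
  | ScM a b => nc_seval a * nc_seval b
  end.

Fixpoint nc_eval (e : ncexp) : D :=
  match e with
  | NcV i => ev`_i
  | Nc0 => 0
  | Nc1 => 1
  | NcN a => - nc_eval a
  | NcA a b => nc_eval a + nc_eval b
  | NcM a b => nc_eval a * nc_eval b
  | NcZ a b => nc_seval a *: nc_eval b
  end.

Definition nc_word (m : seq nat) : D := \prod_(i <- m) ev`_i.
Definition nc_scal (s : seq nat) : F := \prod_(i <- s) es`_i.
Definition nc_mono (m : ncmono) : D := nc_scal m.1 *: nc_word m.2.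
Definition nc_poly (p : seq ncmono) : D := \sum_(m <- p) nc_mono m.

Lemma nc_scal_sort s : nc_scal (sort leq s) = nc_scal s.
Proof. by apply: perm_big; apply/permPl; exact: perm_sort. Qed.

Lemma nc_snormP e : nc_seval e = \sum_(s <- nc_snorm e) nc_scal s.
Proof.
elim: e => //=.
- by move=> i; rewrite big_seq1 /nc_scal big_seq1.
- by rewrite big_nil.
- by rewrite big_seq1 /nc_scal big_nil.
- by move=> a -> b ->; rewrite big_cat.
move=> a -> b ->; rewrite big_allpairs_dep /= mulr_suml; apply: eq_bigr => m _.
by rewrite mulr_sumr; apply: eq_bigr => n _; rewrite /nc_scal big_cat.
Qed.

Lemma char2_opp (x : D) : - x = x.
Proof. by apply/eqP; rewrite eq_sym -addr_eq0 h2. Qed.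

Lemma nc_normP e : nc_eval e = nc_poly (nc_norm e).
Proof.
rewrite /nc_poly; elim: e => //=.
- by move=> i; rewrite big_seq1 /nc_mono /nc_scal /nc_word big_nil big_seq1 scale1r.
- by rewrite big_nil.
- by rewrite big_seq1 /nc_mono /nc_scal /nc_word !big_nil scale1r.
- by move=> a <-; rewrite char2_opp.
- by move=> a -> b ->; rewrite big_cat.
- move=> a -> b ->; rewrite big_allpairs_dep /= mulr_suml; apply: eq_bigr => m _.
  rewrite mulr_sumr; apply: eq_bigr => n _.
  by rewrite /nc_mono /= nc_scal_sort /nc_scal /nc_word !big_cat /= -scalerAl -scalerAr scalerA.
move=> a b ->; rewrite nc_snormP big_allpairs_dep /= scaler_suml; apply: eq_bigr => m _.
rewrite scaler_sumr; apply: eq_bigr => n _.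
by rewrite /nc_mono /= nc_scal_sort scalerA /nc_scal big_cat.
Qed.

Lemma nc_cancelP p : nc_poly (nc_cancel p) = nc_poly p.
Proof.
rewrite /nc_poly; elim: p => //= m p IH; rewrite big_cons -IH.
case: ifP => [mp|_]; last by rewrite big_cons.
by rewrite [in RHS](perm_big _ (perm_to_rem mp)) /= big_cons addrA h2 add0r.
Qed.

Definition nc_valid (r : ncrule) := nc_word r.1 = nc_poly r.2.

Lemma nc_findP r pre m p : nc_valid r -> nc_find r pre m = Some p ->
  nc_word (rev pre ++ m) = nc_poly p.
Proof.
have core pre' q : nc_valid r -> nc_word (rev pre' ++ r.1 ++ q) =
    nc_poly [seq (n.1, rev pre' ++ n.2 ++ q) | n <- r.2].
  rewrite /nc_poly big_map /nc_word big_cat /= big_cat /= /nc_valid /nc_word => ->.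
  rewrite mulr_suml mulr_sumr; apply: eq_bigr => n _ /=.
  by rewrite /nc_mono /nc_word /= !big_cat /= -scalerAl -scalerAr.
move=> vr; elim: m pre => [|i m IH] pre.
  rewrite /=; case E: r.1 => [|//] [<-] /=; have := core pre [::] vr; rewrite E !cats0 => ->.
  by congr nc_poly; apply: eq_map => n; rewrite cats0.
have -> : nc_find r pre (i :: m) = if prefix r.1 (i :: m) then
    Some [seq (n.1, rev pre ++ n.2 ++ drop (size r.1) (i :: m)) | n <- r.2]
  else nc_find r (i :: pre) m by [].
case: ifP => [/prefixP[s E] [<-]|_ /IH <-]; last by rewrite rev_cons -cats1 -catA.
by rewrite E core // drop_size_cat.
Qed.

Fixpoint nc_all (rs : seq ncrule) : Prop := if rs is r :: rs' then nc_valid r /\ nc_all rs' else True.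

Lemma nc_stepP rs m : nc_all rs -> nc_poly (nc_step rs m) = nc_mono m.
Proof.
elim: rs => [|r rs IH] /=; first by rewrite /nc_poly big_seq1.
case=> vr /IH {}IH; case E: nc_find => [p|//].
have {E} := nc_findP vr E; rewrite /= => E.
rewrite /nc_poly big_map /nc_mono E /nc_poly scaler_sumr; apply: eq_bigr => n _ /=.
by rewrite nc_scal_sort /nc_mono scalerA /nc_scal big_cat.
Qed.

Lemma nc_redP fuel rs p : nc_all rs -> nc_poly (nc_red fuel rs p) = nc_poly p.
Proof.
move=> vrs; elim: fuel p => //= fuel IH p; rewrite IH nc_cancelP.
rewrite /nc_poly big_flatten big_map; apply: eq_bigr => m _.
exact: nc_stepP.
Qed.

Fixpoint nc_hyps (hs : seq (ncexp * ncexp)) : Prop :=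
  if hs is h :: hs' then nc_eval h.1 = nc_eval h.2 /\ nc_hyps hs' else True.

Definition nc_rule (h : ncexp * ncexp) : option ncrule :=
  if nc_norm h.1 is [:: ([::], w)] then Some (w, nc_norm h.2) else None.

(** Only soundness is at stake: every rewriting step preserves the value, so an empty normal form of
    [l + r] proves [l = r] whatever the fuel and the confluence of the rules. A hypothesis whose
    left-hand side is not a single word with coefficient 1 yields no rule. *)
Lemma nc_decide fuel hs l r : nc_hyps hs ->
  nc_red fuel (pmap nc_rule hs) (nc_cancel (nc_norm (NcA l r))) = [::] ->
  nc_eval l = nc_eval r.
Proof.
move=> vh E; suff: nc_eval (NcA l r) = 0.
  by move=> /= /(congr1 (+%R^~ (nc_eval r))); rewrite add0r -addrA h2 addr0.
rewrite nc_normP -nc_cancelP -(@nc_redP fuel (pmap nc_rule hs)).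
  by rewrite E /nc_poly big_nil.
elim: hs vh {E} => //= h hs IH [E /IH {}IH].
rewrite /nc_rule; case En: (nc_norm h.1) => [|[[|//] w] [|//]] //=; split=> //.
rewrite /nc_valid -nc_normP -E nc_normP En /nc_poly big_seq1 /nc_mono /= /nc_scal big_nil.
by rewrite scale1r.
Qed.
End Nc.

Ltac nc_add x l :=
  let rec app m := lazymatch m with
    | tt => constr:([:: x])
    | [:: x] => m
    | x :: _ => m
    | [:: ?h] => constr:([:: h; x])
    | ?h :: ?t => let t' := app t in constr:(h :: t') end in
  app l.
Ltac nc_idx x l := lazymatch l with
  | x :: _ => constr:(O)
  | _ :: ?t => let n := nc_idx x t in constr:(S n) end.
Ltac nc_satoms t l := lazymatch t with
  | 0%R => l | 1%R => l
  | (?a + ?b)%R => let l1 := nc_satoms a l in nc_satoms b l1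
  | (?a * ?b)%R => let l1 := nc_satoms a l in nc_satoms b l1
  | (?a ^+ 2)%R => nc_satoms a l
  | _ => nc_add t l end.
Ltac nc_atoms t lp := lazymatch t with
  | 0%R => lp | 1%R => lp
  | (?a + ?b)%R => let l1 := nc_atoms a lp in nc_atoms b l1
  | (?a * ?b)%R => let l1 := nc_atoms a lp in nc_atoms b l1
  | (- ?a)%R => nc_atoms a lp
  | (?a ^+ 2)%R => nc_atoms a lp
  | (?k *: ?b)%R => lazymatch nc_atoms b lp with (?s, ?v) => let s' := nc_satoms k s in constr:((s', v)) end
  | _ => lazymatch lp with (?s, ?v) => let v' := nc_add t v in constr:((s, v')) end end.
Ltac nc_sreify t l := lazymatch t with
  | 0%R => constr:(Sc0) | 1%R => constr:(Sc1)
  | (?a + ?b)%R => let x := nc_sreify a l in let y := nc_sreify b l in constr:(ScA x y)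
  | (?a * ?b)%R => let x := nc_sreify a l in let y := nc_sreify b l in constr:(ScM x y)
  | (?a ^+ 2)%R => let x := nc_sreify a l in constr:(ScM x x)
  | _ => let n := nc_idx t l in constr:(ScV n) end.
Ltac nc_reify t lp := lazymatch t with
  | 0%R => constr:(Nc0) | 1%R => constr:(Nc1)
  | (?a + ?b)%R => let x := nc_reify a lp in let y := nc_reify b lp in constr:(NcA x y)
  | (?a * ?b)%R => let x := nc_reify a lp in let y := nc_reify b lp in constr:(NcM x y)
  | (- ?a)%R => let x := nc_reify a lp in constr:(NcN x)
  | (?a ^+ 2)%R => let x := nc_reify a lp in constr:(NcM x x)
  | (?k *: ?b)%R => lazymatch lp with (?s, _) =>
      let x := nc_sreify k s in let y := nc_reify b lp in constr:(NcZ x y) end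
  | _ => lazymatch lp with (_, ?v) => let n := nc_idx t v in constr:(NcV n) end end.
Ltac nc_hatoms hs lp := lazymatch hs with
  | (?h, ?h') => let l1 := nc_hatoms h lp in nc_hatoms h' l1
  | tt => lp
  | _ => lazymatch type of hs with (?a = ?b) =>
     let l1 := nc_atoms a lp in nc_atoms b l1 end end.
Ltac nc_hreify hs lp acc := lazymatch hs with
  | (?h, ?h') => let r := nc_hreify h' lp acc in nc_hreify h lp r
  | tt => acc
  | _ => lazymatch type of hs with (?a = ?b) =>
     let x := nc_reify a lp in let y := nc_reify b lp in constr:((x, y) :: acc) end end.
Ltac nc_split hs := lazymatch hs with
  | (?h, ?h') => nc_split h; nc_split h'
  | tt => idtac
  | _ => split; [exact: hs|] end.
(* The equations [hs], whose left-hand sides must be monomials, are used as rewrite rules from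
   left to right; the goal is closed when both sides have the same normal form. *)
Ltac nc h2 hs :=
  lazymatch goal with |- ?l = ?r =>
  let lp := nc_atoms l (tt, tt) in let lp := nc_atoms r lp in let lp := nc_hatoms hs lp in
  let L := nc_reify l lp in let R := nc_reify r lp in
  let H := nc_hreify hs lp (@nil (ncexp * ncexp)) in
  lazymatch lp with
  | (tt, tt) => apply: (@nc_decide _ _ h2 [::] [::] 40 H L R)
  | (?s, tt) => apply: (@nc_decide _ _ h2 s [::] 40 H L R)
  | (tt, ?v) => apply: (@nc_decide _ _ h2 [::] v 40 H L R)
  | (?s, ?v) => apply: (@nc_decide _ _ h2 s v 40 H L R)
  end; [nc_split hs; exact: I | vm_compute; reflexivity] end.

(** * Division algebras, trace forms and involutions *)

Section Simple.
Variables (F : fieldType) (A : falgType F).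

Definition central_alg := forall z : A, (forall x, x * z = z * x) -> exists a : F, z = a%:A.

Definition full_ideals := forall x : A, x != 0 ->
  exists s : seq (A * A), \sum_(p <- s) p.1 * x * p.2 = 1.

(** If [b 0 != 0], multiplying by elements of the ideal it generates leads to a relation with
    [b' 0 = 1]. Commutators with any [e] give a shorter relation, so all [b' i] are central scalars,
    and [d = 1] contradicts the independence of the [a i]. *)
Lemma artin_whaples n (a b : 'I_n -> A) : central_alg -> full_ideals ->
  (forall k : 'I_n -> F, \sum_i k i *: a i = 0 -> forall i, k i = 0) ->
  (forall d, \sum_i a i * d * b i = 0) -> forall i, b i = 0.
Proof.
move=> cen full; elim: n a b => [|n IH] a b fa h i; first by case: i.
have fa' (k : 'I_n -> F) : \sum_i k i *: a (lift ord0 i) = 0 -> forall i, k i = 0.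
  move=> hk j; have := fa (fun i => oapp k 0 (unlift ord0 i)).
  rewrite big_ord_recl unlift_none scale0r add0r.
  under eq_bigr do rewrite liftK /=.
  by move/(_ hk (lift ord0 j)); rewrite liftK.
have b00 : b ord0 = 0.
  apply/eqP; apply: contraT => /full [s hs].
  pose b' i := \sum_(p <- s) p.1 * b i * p.2.
  have h' d : \sum_i a i * d * b' i = 0.
    under eq_bigr do rewrite mulr_sumr.
    rewrite exchange_big big1_seq //= => p _.
    transitivity ((\sum_i a i * (d * p.1) * b i) * p.2); last by rewrite h mul0r.
    by rewrite mulr_suml; apply: eq_bigr => j _; rewrite !mulrA.
  have b0 : b' ord0 = 1 := hs.
  have c j e : e * b' (lift ord0 j) = b' (lift ord0 j) * e.
    apply/eqP; rewrite -subr_eq0; apply/eqP; move: j.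
    apply: (IH (fun i => a (lift ord0 i))
      (fun i => e * b' (lift ord0 i) - b' (lift ord0 i) * e)) => // d.
    transitivity (\sum_j a j * (d * e) * b' j - (\sum_j a j * d * b' j) * e);
      last by rewrite !h' mul0r subr0.
    rewrite !big_ord_recl !b0 mulrDl !mulr1 !mulrA opprD addrACA subrr add0r.
    rewrite mulr_suml -sumrB; apply: eq_bigr => j _.
    by rewrite mulrBr !mulrA.
  have /fin_all_exists[be hbe] j : exists c : F, b' j = c%:A.
    case: (unliftP ord0 j) => [l ->|->].
      by apply: cen => x; rewrite c.
    by exists 1; rewrite b0 scale1r.
  have /fa/(_ ord0) be0 : \sum_i be i *: a i = 0.
    rewrite -[RHS](h' 1); apply: eq_bigr => j _.
    by rewrite hbe mulr1 mulr_algr.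
  by have := oner_neq0 A; rewrite -b0 hbe be0 scale0r eqxx.
case: (unliftP ord0 i) => [l ->|-> //]; move: l.
apply: (IH (fun i => a (lift ord0 i)) (fun i => b (lift ord0 i))) => // d.
by rewrite -[RHS](h d) [in RHS]big_ord_recl b00 mulr0 add0r.
Qed.
End Simple.

Record csdiv (F : fieldType) (D : falgType F) : Prop := CsDiv {
  cs2 : forall x : D, x + x = 0;
  csU : forall x : D, x != 0 -> x \is a GRing.unit;
  csC : central_alg D }.

Lemma ex_linfun (F : fieldType) (U V : vectType F) (g : U -> V) :
  linear g -> exists f : 'Hom(U, V), forall x, f x = g x.
Proof.
move=> lg; pose G : {linear U -> V} := HB.pack g (GRing.isLinear.Build F U V *:%R g lg).
by exists (linfun G) => x; rewrite lfunE.
Qed.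

Lemma linear_sumZ (F : fieldType) (U V : lmodType F) (g : U -> V) :
  linear g -> forall I (r : seq I) (P : pred I) (k : I -> F) (u : I -> U),
  g (\sum_(i <- r | P i) k i *: u i) = \sum_(i <- r | P i) k i *: g (u i).
Proof.
move=> lg I r P k u; pose G : {linear U -> V} := HB.pack g (GRing.isLinear.Build F U V *:%R g lg).
by rewrite -[g]/(G : U -> V) linear_sum; apply: eq_bigr => i _; rewrite linearZ.
Qed.

Section DivBasics.
Variables (F : fieldType) (D : falgType F) (hD : csdiv D).
Let h2 := cs2 hD.

Lemma csF2 (a : F) : a + a = 0.
Proof.
have := h2 (a%:A); rewrite -scalerDl => /eqP.
by rewrite scaler_eq0 oner_eq0 orbF => /eqP.
Qed.

Lemma cs_full : full_ideals D.
Proof.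
by move=> x x0; exists [:: (x^-1, 1)]; rewrite big_seq1 /= mulr1 mulVr ?(csU hD).
Qed.

Lemma cs_mul0 (x y : D) : x * y = 0 -> x = 0 \/ y = 0.
Proof.
move=> xy0; have [->|x0] := eqVneq x 0; [by left|right].
by rewrite -[y](mulKr (csU hD x0)) xy0 mulr0.
Qed.

Lemma cs_mulI (x y z : D) : x != 0 -> x * y = x * z -> y = z.
Proof. by move=> /(csU hD) /mulrI; apply. Qed.

Lemma cs_mulIr (x y z : D) : x != 0 -> y * x = z * x -> y = z.
Proof. by move=> /(csU hD) /mulIr; apply. Qed.

Lemma cs_mul_neq0 (x y : D) : x != 0 -> y != 0 -> x * y != 0.
Proof. by move=> x0; apply: contraNneq => /cs_mul0[xz|->//]; rewrite xz eqxx in x0. Qed.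

Lemma add2_eq (x y : D) : x + y = 0 -> x = y.
Proof. by move=> /(congr1 (+%R^~ y)); rewrite -addrA h2 addr0 add0r. Qed.
End DivBasics.

Section DualBasis.
Variables (F : fieldType) (D : falgType F) (hD : csdiv D).
Definition funl (f : D -> F) := (forall x y, f (x + y) = f x + f y) /\ (forall k x, f (k *: x) = k * f x).

Lemma funl_sum f : funl f -> forall I (r : seq I) (P : pred I) (u : I -> D),
  f (\sum_(i <- r | P i) u i) = \sum_(i <- r | P i) f (u i).
Proof.
case=> fD fZ I r P u; apply: (big_morph f) => //.
by rewrite -(scale0r (0 : D)) fZ mul0r.
Qed.

Lemma ex_funl (v : D) : v != 0 -> exists2 f, funl f & f v != 0.
Proof.
move=> v0; have [i vi|] := pickP (fun i => coord (vbasis {:D}) i v != 0).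
  exists (coord (vbasis {:D}) i) => //.
  by split=> [x y|k x]; [rewrite linearD | rewrite linearZ].
move=> h; case/eqP: v0; rewrite (coord_vbasis (memvf v)) big1 // => i _.
by have /negbFE/eqP -> := h i; rewrite scale0r.
Qed.

Notation N := (\dim {:D}).
Notation e := (fun i : 'I_N => (vbasis {:D})`_i).

Lemma vb_free (k : 'I_N -> F) : \sum_i k i *: e i = 0 -> forall i, k i = 0.
Proof. by move: k; apply/freeP; apply: basis_free (vbasisP _). Qed.

Variables (f : D -> F) (ff : funl f) (x0 : D) (fx0 : f x0 != 0).

Lemma form_nondeg x : (forall y, f (x * y) = 0) -> x = 0.
Proof.
move=> h; apply/eqP; apply: contraT => xn.
by case/eqP: fx0; rewrite -[x0](mulVKr (csU hD xn)) h.
Qed.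

(** The operator [T] writes the functional [f (y * _)] in coordinates. Nondegeneracy makes it
    injective, and the inverse images of the basis vectors form the dual basis. *)
Lemma ex_dual : exists es : 'I_N -> D, forall i j, f (es i * e j) = (i == j)%:R.
Proof.
have [T hT] : exists T : 'End(D), forall y, T y = \sum_j f (y * e j) *: e j.
  apply: ex_linfun => k x y; rewrite scaler_sumr -big_split; apply: eq_bigr => j _ /=.
  by rewrite mulrDl -scalerAl ff.1 ff.2 scalerDl scalerA.
have kT : lker T == 0%VS.
  rewrite -subv0; apply/subvP => y; rewrite memv_ker memv0 hT => /eqP /vb_free fy.
  apply/eqP; apply: form_nondeg => z; rewrite (coord_vbasis (memvf z)) mulr_sumr (funl_sum ff).
  by rewrite big1 // => i _; rewrite -scalerAr ff.2 fy mulr0.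
exists (fun i => (T^-1)%VF (e i)) => i; have := hT ((T^-1)%VF (e i)).
rewrite lker0_lfunVK // => /esym E j.
apply/eqP; rewrite -subr_eq0; apply/eqP; move: j.
refine (@vb_free (fun j => f ((T^-1)%VF (e i) * e j) - (i == j)%:R) _).
under eq_bigr do rewrite scalerBl; rewrite sumrB E (bigD1 i) //= eqxx scale1r.
by rewrite big1 ?addr0 ?subrr // => j; rewrite eq_sym => /negbTE ->; rewrite scale0r.
Qed.

Variables (es : 'I_N -> D) (hes : forall i j, f (es i * e j) = (i == j)%:R).

Lemma dual_l x : x = \sum_i f (es i * x) *: e i.
Proof.
rewrite {1}(coord_vbasis (memvf x)); apply: eq_bigr => i _; congr (_ *: _).
rewrite {2}(coord_vbasis (memvf x)) mulr_sumr (funl_sum ff) (bigD1 i) //= -scalerAr ff.2 hes eqxx mulr1.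
rewrite big1 ?addr0 // => j ji; rewrite -scalerAr ff.2 hes eq_sym.
by rewrite (negbTE ji) mulr0.
Qed.

Lemma dual_r x : x = \sum_i f (x * e i) *: es i.
Proof.
apply/eqP; rewrite -subr_eq0; apply/eqP; apply: form_nondeg => y.
rewrite (dual_l y) mulr_sumr (funl_sum ff) big1 // => j _; rewrite -scalerAr ff.2.
rewrite mulrDl ff.1 mulNr -scaleN1r ff.2 mulr_suml (funl_sum ff) (bigD1 j) //= -scalerAl ff.2 hes eqxx mulr1.
rewrite big1 ?addr0 => [|i ij]; first by rewrite mulN1r subrr mulr0.
by rewrite -scalerAl ff.2 hes (negbTE ij) mulr0.
Qed.

Lemma dual_free (k : 'I_N -> F) : \sum_i k i *: es i = 0 -> forall i, k i = 0.
Proof.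
move=> h j; have : f ((\sum_i k i *: es i) * e j) = 0 by rewrite h mul0r -(scale0r 0) ff.2 mul0r.
rewrite mulr_suml (funl_sum ff) (bigD1 j) //= -scalerAl ff.2 hes eqxx mulr1 big1 ?addr0 // => i ij.
by rewrite -scalerAl ff.2 hes (negbTE ij) mulr0.
Qed.

(** The Casimir identity in the tensor square, a bilinear [Phi] standing for the tensor product:
    both sides are expanded with the same matrix, [b e_i] in the basis and [es_i b] in the dual
    basis. *)
Lemma casimir (V : lmodType F) (Phi : D -> D -> V) :
  (forall y, linear (Phi^~ y)) -> (forall x, linear (Phi x)) -> forall b,
  \sum_i Phi (b * e i) (es i) = \sum_i Phi (e i) (es i * b).
Proof.
move=> Pl Pr b; under eq_bigr => i _ do rewrite (dual_l (b * e i)) (linear_sumZ (Pl (es i))).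
under [RHS]eq_bigr => i _ do rewrite (dual_r (es i * b)) (linear_sumZ (Pr (e i))).
by rewrite exchange_big; apply: eq_bigr => i _; apply: eq_bigr => j _; rewrite mulrA.
Qed.

Hypothesis fC : forall x y, f (x * y) = f (y * x).

Lemma casimir' (V : lmodType F) (Phi : D -> D -> V) :
  (forall y, linear (Phi^~ y)) -> (forall x, linear (Phi x)) -> forall b,
  \sum_i Phi (e i * b) (es i) = \sum_i Phi (e i) (b * es i).
Proof.
move=> Pl Pr b; under eq_bigr => i _ do rewrite (dual_l (e i * b)) (linear_sumZ (Pl (es i))).
under [RHS]eq_bigr => i _ do rewrite (dual_r (b * es i)) (linear_sumZ (Pr (e i))).
rewrite exchange_big; apply: eq_bigr => i _; apply: eq_bigr => j _.
by rewrite mulrA fC mulrA.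
Qed.
End DualBasis.

Definition trace_form (F : fieldType) (D : falgType F) (tr : D -> F) :=
  [/\ funl tr, (forall x y, tr (x * y) = tr (y * x)) & exists x, tr x != 0].

Section Trace.
Variables (F : fieldType) (D : falgType F) (hD : csdiv D).
Notation N := (\dim {:D}).
Notation e := (fun i : 'I_N => (vbasis {:D})`_i).

(** For the dual basis of any non-zero functional, [d |-> \sum es_i d e_i] takes equal values at
    [x y] and [y x] by the Casimir identity, and it is non-zero by Artin-Whaples. Composing it with
    a functional gives the trace. *)
Lemma ex_trace_form : exists tr : D -> F, trace_form tr.
Proof.
have [f ff f1] := ex_funl (oner_neq0 D).
have [es hes] := ex_dual hD ff f1.
have [d hd] : exists d, \sum_i es i * d * e i != 0.
  have j : 'I_N by exists 0%N; rewrite dimvf FalgType_proper.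
  have [n|h] := EM (exists d, \sum_i es i * d * e i != 0).
    exact: n.
  suff E : e j = 0 by move: (hes j j); rewrite E mulr0 eqxx -(scale0r 0) ff.2 mul0r => /eqP; rewrite eq_sym oner_eq0.
  refine (artin_whaples (csC hD) (cs_full hD) (dual_free ff hes) (b := e) _ j) => d.
  by apply/eqP; apply: contra_notT h => h; exists d.
have [xi fxi xid] := ex_funl hd.
exists (fun d => xi (\sum_i es i * d * e i)); split; last by exists d.
  split=> [x y|k x].
    by rewrite -fxi.1; congr xi; rewrite -big_split; apply: eq_bigr => i _; rewrite mulrDr mulrDl.
  by rewrite -fxi.2; congr xi; rewrite scaler_sumr; apply: eq_bigr => i _; rewrite -scalerAr -scalerAl.
move=> x y; congr xi.
transitivity (\sum_i es i * x * (y * e i)); first by apply: eq_bigr => i _; rewrite !mulrA.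
rewrite (casimir hD ff f1 hes (Phi := fun u v => v * x * u)) => [|v k u u'|u k v v'].
- by apply: eq_bigr => i _; rewrite !mulrA.
- by rewrite mulrDr scalerAr.
by rewrite !mulrDl !scalerAl.
Qed.
End Trace.

Definition antim (F : fieldType) (D : falgType F) (s : 'End(D)) :=
  (forall x y, s (x * y) = s y * s x) /\ s 1 = 1.

Definition invol (F : fieldType) (D : falgType F) (s : 'End(D)) :=
  antim s /\ forall x, s (s x) = x.

Section TraceTheory.
Variables (F : fieldType) (D : falgType F) (hD : csdiv D).
Let h2 := cs2 hD.
Notation N := (\dim {:D}).
Notation e := (fun i : 'I_N => (vbasis {:D})`_i).
Variables (tr : D -> F) (htr : trace_form tr).
Let ftr : funl tr. Proof. by case: htr. Qed.
Let trC x y : tr (x * y) = tr (y * x). Proof. by case: htr. Qed.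

Lemma tr_nondeg x : (forall y, tr (x * y) = 0) -> x = 0.
Proof. by case: htr => _ _ [x0 hx0]; apply: form_nondeg hx0 _. Qed.

Lemma ex_tr_dual : exists es : 'I_N -> D, forall i j, tr (es i * e j) = (i == j)%:R.
Proof. by case: htr => _ _ [x0 hx0]; apply: ex_dual hx0. Qed.

(** Nondegeneracy gives [t = tr (z * _)], and the symmetry of both functionals makes [z] central. *)
Lemma tr_uniq t : funl t -> (forall x y, t (x * y) = t (y * x)) -> exists c, forall x, t x = c * tr x.
Proof.
move=> ft tC; have [es hes] := ex_tr_dual.
case: (htr) => _ _ [x0 hx0].
pose z := \sum_i t (e i) *: es i.
have tz x : t x = tr (z * x).
  rewrite mulr_suml (funl_sum ftr) {1}(dual_l ftr hes x) (funl_sum ft).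
  by apply: eq_bigr => i _; rewrite ft.2 -scalerAl ftr.2 mulrC.
have [x|c zc] := csC hD (z := z).
  apply/eqP; rewrite -subr_eq0; apply/eqP; apply: tr_nondeg => y.
  have -> : (x * z - z * x) * y = x * (z * y) + z * (x * y) by nc h2 tt.
  by rewrite ftr.1 trC -mulrA -!tz tC (csF2 hD).
by exists c => x; rewrite tz zc -scalerAl mul1r ftr.2.
Qed.

(** A functional that kills all commutators is a multiple of [tr], so none can separate [x] from
    their span. *)
Lemma ker_tr_comm x : tr x = 0 ->
  x \in span [seq a * b + b * a | a <- vbasis {:D}, b <- vbasis {:D}].
Proof.
set W := span _ => tx; apply/negPn/negP => xW.
have v0 : x - projv W x != 0.
  by rewrite subr_eq0; apply: contraNneq xW => ->; exact: memv_proj.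
have [g fg gv] := ex_funl v0.
have WC a b : a * b + b * a \in W.
  rewrite (coord_vbasis (memvf a)) mulr_suml mulr_sumr -big_split /=.
  apply: rpred_sum => i _; rewrite (coord_vbasis (memvf b)) mulr_sumr mulr_suml -big_split /=.
  apply: rpred_sum => j _; set k := coord _ i a; set l := coord _ j b.
  set p := _`_i; set q := _`_j; have -> : k *: p * (l *: q) + l *: q * (k *: p) = (k * l) *: (p * q + q * p) by nc h2 tt.
  apply: memvZ; apply: memv_span; rewrite /p /q.
  by apply/allpairsP; exists ((vbasis {:D})`_i, (vbasis {:D})`_j); split => //=;
    rewrite mem_nth // size_tuple.
have [|a b|c hc] := @tr_uniq (fun y => g (y - projv W y)).
- split=> [y z|k y]; first by rewrite -fg.1 linearD /= opprD addrACA.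
  by rewrite linearZ /= -scalerBr fg.2.
- have := projv_id (WC a b); rewrite linearD /= => E.
  congr g; set u := projv W (a * b) in E *; set v := projv W (b * a) in E *.
  have -> : v = u + (a * b + b * a) by rewrite -E; nc h2 tt.
  by nc h2 tt.
by have := hc x; rewrite tx mulr0 => E; rewrite E eqxx in gv.
Qed.

Lemma tr_sqD x y : tr ((x + y) * (x + y)) = tr (x * x) + tr (y * y).
Proof.
rewrite mulrDl !mulrDr !ftr.1 (trC y x) -addrA; congr (_ + _).
by rewrite addrA (csF2 hD) add0r.
Qed.

(** Squaring is additive modulo commutators, and the square of [a b + b a] has trace twice that of
    [(a b) ^+ 2], so squares of trace-zero elements have trace zero. *)
Lemma ex_tr_sq : exists kp, forall x, tr (x * x) = kp * tr x ^+ 2.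
Proof.
have s0 x : tr x = 0 -> tr (x * x) = 0.
  move/ker_tr_comm; set X := flatten _ => xX.
  have : forall w, w \in X -> tr (w * w) = 0.
    move=> w /allpairsP[[a b] [_ _ ->]] /=; rewrite tr_sqD.
    have -> : tr (b * a * (b * a)) = tr (a * b * (a * b)) by rewrite -mulrA trC !mulrA.
    exact: (csF2 hD).
  move=> hX; rewrite (coord_span (X := in_tuple X) xX).
  elim/big_rec: _ => [|i y _ hy]; first by rewrite mulr0 -(scale0r 0) ftr.2 mul0r.
  by rewrite tr_sqD hy -scalerAl -scalerAr !ftr.2 hX ?mulr0 ?addr0 // mem_nth.
case: htr => _ _ [x0 hx0]; exists (tr (x0 * x0) / tr x0 ^+ 2) => x.
pose k := tr x / tr x0.
have E : tr (x + k *: x0) = 0 by rewrite ftr.1 ftr.2 mulfVK // (csF2 hD).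
have {E} := s0 _ E; rewrite tr_sqD -scalerAl -scalerAr !ftr.2 => /eqP.
rewrite addr_eq0 => /eqP ->; apply/eqP; rewrite -subr_eq0 -opprD oppr_eq0.
suff -> : tr (x0 * x0) / tr x0 ^+ 2 * tr x ^+ 2 = k * (k * tr (x0 * x0)) by rewrite (csF2 hD).
rewrite /k; field; exact: hx0.
Qed.

Lemma sum_sym_char2 n (S : 'I_n -> 'I_n -> F) : (forall i j, S i j = S j i) ->
  \sum_i \sum_j S i j = \sum_i S i i.
Proof.
elim: n S => [|n IH] S sS; first by rewrite !big_ord0.
rewrite big_ord_recl big_ord_recl [in RHS]big_ord_recl.
under [X in _ + X]eq_bigr do rewrite big_ord_recl.
rewrite big_split /= (IH (fun i j => S (lift ord0 i) (lift ord0 j))) //.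
under [X in _ + X + _]eq_bigr do rewrite sS.
by rewrite -!addrA; congr (_ + _); rewrite addrA (csF2 hD) add0r.
Qed.

Variables (es : 'I_N -> D) (hes : forall i j, tr (es i * e j) = (i == j)%:R).
Variables (kp : F) (hkp : forall x, tr (x * x) = kp * tr x ^+ 2).

(* [tr] is only determined up to a scalar, and [kp] measures the deviation from the
   reduced trace, for which both sides would be multiplied by 1. *)
Lemma dual_sum_tr d : \sum_i es i * d * e i = (kp ^+ 2 * tr d)%:A.
Proof.
case: (htr) => _ _ [x0 hx0].
have /choice[g hg] u : exists c : F, \sum_i es i * u * e i = c%:A.
  apply: (csC hD) => y.
  have := casimir' hD ftr hx0 hes trC (Phi := fun a b => b * u * a) _ _ y.
  rewrite mulr_sumr mulr_suml => E; transitivity (\sum_i y * es i * u * e i).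
    by apply: eq_bigr => i _; rewrite !mulrA.
  rewrite -E => [|v k a a'|a k v v'].
  - by apply: eq_bigr => i _; rewrite !mulrA.
  - by rewrite mulrDr scalerAr.
  by rewrite !mulrDl !scalerAl.
have A_inj (a b : F) : a%:A = b%:A :> D -> a = b.
  by move/eqP; rewrite -subr_eq0 -scalerBl scaler_eq0 oner_eq0 orbF subr_eq0 => /eqP.
have fg : funl g.
  split=> [x y|k x]; apply: A_inj.
    by rewrite scalerDl -!hg -big_split; apply: eq_bigr => i _; rewrite mulrDr mulrDl.
  rewrite -scalerA -!hg scaler_sumr; apply: eq_bigr => i _.
  by rewrite -scalerAr -scalerAl.
have gC x y : g (x * y) = g (y * x).
  apply: A_inj; rewrite -!hg.
  transitivity (\sum_i es i * x * (y * e i)); first by apply: eq_bigr => i _; rewrite !mulrA.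
  rewrite (casimir hD ftr hx0 hes (Phi := fun u v => v * x * u)) => [|v k u u'|u k v v'].
  - by apply: eq_bigr => i _; rewrite !mulrA.
  - by rewrite mulrDr scalerAr.
  by rewrite !mulrDl !scalerAl.
have [c hc] := tr_uniq fg gC.
rewrite hg hc; congr (_ * _)%:A => {d}.
pose a := (tr x0)^-1 *: x0; have ta : tr a = 1 by rewrite ftr.2 mulVf.
have -> : c = tr ((\sum_i es i * a * e i) * a).
  by rewrite hg hc ta mulr1 -scalerAl mul1r ftr.2 ta mulr1.
rewrite mulr_suml (funl_sum ftr).
have esE i : es i = \sum_j tr (es j * es i) *: e j by rewrite -(dual_l ftr hes).
transitivity (\sum_i \sum_j tr (es j * es i) * tr (e j * a * e i * a)).
  apply: eq_bigr => i _; rewrite {1}esE !mulr_suml (funl_sum ftr).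
  by apply: eq_bigr => j _; rewrite -!scalerAl ftr.2.
rewrite sum_sym_char2 => [|i j]; last first.
  rewrite [tr (es j * _)]trC; congr (_ * _).
  by rewrite -mulrA trC !mulrA.
transitivity (kp ^+ 2 * \sum_i (tr (es i) * tr (e i * a)) ^+ 2).
  rewrite mulr_sumr; apply: eq_bigr => i _; rewrite -[_ * e i * a]mulrA !hkp; ring.
have sq I (r : seq I) (f : I -> F) : \sum_(i <- r) f i ^+ 2 = (\sum_(i <- r) f i) ^+ 2.
  elim: r => [|i r IH]; first by rewrite !big_nil expr0n.
  by rewrite !big_cons IH sqrrD mulr2n (csF2 hD) addr0.
rewrite sq; suff -> : \sum_i tr (es i) * tr (e i * a) = 1 by rewrite expr1n mulr1.
rewrite -[RHS]ta -[in RHS](mul1r a) [in RHS](dual_l ftr hes 1) mulr_suml (funl_sum ftr).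
by apply: eq_bigr => i _; rewrite mulr1 -scalerAl ftr.2.
Qed.

Lemma kp_neq0 : kp != 0.
Proof.
apply/eqP => kp0; have j : 'I_N by exists 0%N; rewrite dimvf FalgType_proper.
have : e j = 0.
  refine (artin_whaples (csC hD) (cs_full hD) (dual_free ftr hes) (b := e) _ j) => d.
  by rewrite dual_sum_tr kp0 expr0n mul0r scale0r.
by move=> E; move: (hes j j); rewrite E mulr0 eqxx -(scale0r 0) ftr.2 mul0r => /eqP; rewrite eq_sym oner_eq0.
Qed.

(* [x] is, up to normalisation, the image of the Casimir (Goldman) element: it makes
   [v |-> x * theta v] an involutive operator, whose eigenvectors [w] turn
   [w * theta _ * w^-1] into an involution. *)
Lemma anti_invol (t : 'End(D)) : antim t -> exists s : 'End(D), invol s.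
Proof.
move=> [tM t1]; case: (htr) => _ _ [x0 hx0].
pose x := \sum_i e i * t (es i).
have xt2 d : x * t (t d) = d * x.
  rewrite /x mulr_suml mulr_sumr.
  transitivity (\sum_i e i * t (t d * es i)); first by apply: eq_bigr => i _; rewrite tM mulrA.
  rewrite -(casimir' hD ftr hx0 hes trC (Phi := fun u v => u * t v)) => [|v k u u'|u k v v'].
  - under eq_bigr do rewrite -mulrA -tM.
    rewrite -(casimir hD ftr hx0 hes (Phi := fun u v => u * t v)) => [|v k u u'|u k v v'].
    + by apply: eq_bigr => i _; rewrite mulrA.
    + by rewrite mulrDl scalerAl.
    by rewrite linearP mulrDr scalerAr.
  - by rewrite mulrDl scalerAl.
  by rewrite linearP mulrDr scalerAr.
have xtx : x * t x = (kp ^+ 2)%:A.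
  have -> : x * t x = \sum_i x * t (e i * t (es i)) by rewrite [in t _]/x linear_sum mulr_sumr.
  transitivity (\sum_i es i * x * t (e i)).
    by apply: eq_bigr => i _; rewrite tM mulrA xt2.
  transitivity (\sum_j (\sum_i es i * e j * e i) * t (es j)).
    under [RHS]eq_bigr do rewrite mulr_suml.
    rewrite exchange_big; apply: eq_bigr => i _ /=.
    rewrite -mulrA /x mulr_suml.
    transitivity (es i * \sum_j e j * t (e i * es j)).
      by congr (_ * _); apply: eq_bigr => j _; rewrite tM mulrA.
    rewrite -(casimir' hD ftr hx0 hes trC (Phi := fun u v => u * t v)) => [|v k u u'|u k v v'].
    - by rewrite mulr_sumr; apply: eq_bigr => j _; rewrite !mulrA.
    - by rewrite mulrDl scalerAl.
    by rewrite linearP mulrDr scalerAr.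
  transitivity (kp ^+ 2 *: t (\sum_i tr (1 * e i) *: es i)).
    rewrite linear_sum scaler_sumr; apply: eq_bigr => i _.
    by rewrite dual_sum_tr -scalerAl mul1r linearZ scalerA mul1r.
  by rewrite -(dual_r hD ftr hx0 hes) t1.
have kp0 := kp_neq0.
have xn0 : x != 0.
  apply: contraNneq kp0 => x00; move: xtx; rewrite x00 mul0r => /esym/eqP.
  by rewrite scaler_eq0 oner_eq0 orbF sqrf_eq0.
(* The operator [v |-> x * t v] squares to [kp ^+ 2], so each [x * t v + kp *: v] is an eigenvector
   for [kp]. If all of them vanish, [v = 1] gives [x = kp], and then [t] is the identity. *)
have [[v hv]|nov] := EM (exists v, x * t v + kp *: v != 0); last first.
  have xv v : x * t v = kp *: v.
    by apply: add2_eq => //; apply/eqP; apply: contra_notT nov => h; exists v.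
  exists t; split=> // v; apply: (cs_mulI hD xn0).
  have x1 : x = kp%:A by rewrite -[x]mulr1 -{1}t1 xv.
  by rewrite xv -[t v in LHS]mul1r scalerAl -x1 xv [in RHS]x1 -scalerAl mul1r.
set w := x * t v + kp *: v in hv.
have wU := csU hD hv.
have xU := csU hD xn0.
have tw : t w * x = kp *: (x^-1 * w * x).
  have -> : t w = kp *: (x^-1 * w); last by rewrite -scalerAl.
  apply: (mulrI xU); rewrite -scalerAr mulVKr // /w linearD linearZ /= tM mulrDr mulrA xt2.
  by rewrite -mulrA xtx -!scalerAr mulr1 scalerDr scalerA addrC expr2.
have [s hs] : exists s : 'End(D), forall d, s d = w * t d * w^-1.
  by apply: ex_linfun => k a b; rewrite linearP mulrDr mulrDl -scalerAr -scalerAl.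
have E : t w = kp *: (x^-1 * w).
  by apply: (mulIr xU); rewrite tw -scalerAl.
have kA : (kp *: (x^-1 * w)) * w^-1 = kp *: x^-1 by rewrite -scalerAl mulrK.
exists s; split.
  split=> [a b|]; rewrite !hs ?t1 ?mulr1 ?mulrV // tM.
  by rewrite !mulrA mulrVK.
move=> d; rewrite !hs !tM.
have tVw : t w^-1 * (t w) = 1 by rewrite -tM mulrV.
have -> : t w^-1 = kp^-1 *: (w^-1 * x).
  apply: (mulIr (x := t w)); first by apply/unitrP; exists (t w^-1); rewrite -!tM mulVr // mulrV // t1.
  rewrite tVw E -scalerAl -scalerAr scalerA mulVf // scale1r.
  by rewrite -mulrA mulVKr // mulVr.
rewrite E -!scalerAl -!scalerAr -!scalerAl -?scalerAr scalerA mulVf // scale1r !mulrA.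
by rewrite mulrV // mul1r xt2 mulrK // mulrK.
Qed.
End TraceTheory.

(** * Involutions and the dimension bound for fixed subalgebras *)

Section Involutions.
Variables (F : fieldType) (D : falgType F) (hD : csdiv D).
Let h2 := cs2 hD.

Definition Sym (s : 'End(D)) : {vspace D} := lker (s + \1%VF).
Definition Alt (s : 'End(D)) : {vspace D} := limg (s + \1%VF).

Lemma asp1 (K : {aspace D}) : 1 \in K.
Proof. by rewrite -(skew_field_algid1 (csU hD) K) memv_algid. Qed.

Lemma SymP (s : 'End(D)) x : reflect (s x = x) (x \in Sym s).
Proof.
rewrite memv_ker add_lfunE id_lfunE; apply: (iffP eqP) => [/(add2_eq hD) //|->].
exact: h2.
Qed.

Lemma AltP (s : 'End(D)) x : reflect (exists d, x = d + s d) (x \in Alt s).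
Proof.
apply: (iffP memv_imgP) => [[d _ ->]|[d ->]]; exists d; rewrite ?memvf //;
  by rewrite add_lfunE id_lfunE addrC.
Qed.

Lemma dim_SymAlt (s : 'End(D)) : (\dim (Sym s) + \dim (Alt s) = \dim {:D})%N.
Proof. by rewrite -(limg_ker_dim (s + \1%VF) {:D}) capfv. Qed.

Lemma anti_unit (s : 'End(D)) x : antim s -> x != 0 -> s x != 0.
Proof.
move=> [sM s1] x0; apply/eqP => sx; have := oner_neq0 D.
by rewrite -s1 -(mulrV (csU hD x0)) sM sx mulr0 eqxx.
Qed.

Lemma anti_inv (s : 'End(D)) x : antim s -> x != 0 -> s x^-1 = (s x)^-1.
Proof.
move=> sa x0; apply: (mulrI (csU hD (anti_unit sa x0))).
rewrite mulrV ?(csU hD) ?anti_unit //; case: sa => sM s1.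
by rewrite -sM mulVr ?s1 // (csU hD).
Qed.

Lemma Alt_Sym s : invol s -> (Alt s <= Sym s)%VS.
Proof. by case=> _ ss; apply/subvP => x /AltP[d ->]; apply/SymP; rewrite linearD /= ss addrC. Qed.

Lemma Alt_conj s x a : invol s -> a \in Alt s -> x * a * s x \in Alt s.
Proof.
case=> [[sM _] ss] /AltP[d ->]; apply/AltP; exists (x * d * s x).
by rewrite !sM ss mulrDr mulrDl !mulrA.
Qed.

Variables (tr : D -> F) (htr : trace_form tr).
Let ftr : funl tr. Proof. by case: htr. Qed.
Let trC x y : tr (x * y) = tr (y * x). Proof. by case: htr. Qed.

(** The composite of [tr] and [s] is again a trace, hence [c * tr]; as [s] has order two,
    [c ^+ 2 = 1] and so [c = 1]. *)
Lemma tr_anti s x : invol s -> tr (s x) = tr x.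
Proof.
case=> [[sM s1] ss]; case: (htr) => _ _ [x0 hx0].
have [|y z|c hc] := @tr_uniq _ _ hD _ htr (fun x => tr (s x)).
- by split=> [y z|k y]; [rewrite linearD ftr.1 | rewrite linearZ ftr.2].
- by rewrite !sM trC.
have : (c + 1) ^+ 2 = 0.
  have := hc (s x0); rewrite ss hc mulrA -{1}[tr x0]mul1r => /(mulIf hx0) c1.
  by rewrite sqrrD mulr1 mulr2n (csF2 hD) addr0 expr2 -c1 expr1n (csF2 hD).
move/eqP; rewrite sqrf_eq0 addr_eq0 => /eqP c1; rewrite hc c1 -[RHS]mul1r; congr (_ * _).
by apply/eqP; rewrite eq_sym -addr_eq0 (csF2 hD).
Qed.

Lemma free_seq n (d : n.-tuple D) : free d ->
  forall k : 'I_n -> F, \sum_i k i *: d`_i = 0 -> forall i, k i = 0.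
Proof. by move/freeP. Qed.

Lemma leq_dim_inj (U V : vectType F) (g : U -> V) :
  linear g -> injective g -> (\dim {:U} <= \dim {:V})%N.
Proof.
move=> /ex_linfun[f hf] gi; rewrite -(@limg_dim_eq _ _ _ f {:U}) ?dimvS ?subvf //.
apply/eqP; rewrite -subv0; apply/subvP => x; rewrite memv_cap memvf memv_ker memv0 hf.
move/eqP => gx; apply/eqP; apply: gi; rewrite gx -[RHS]hf linear0 //.
Qed.

Section Forms.
Variables (s : 'End(D)) (hs : invol s) (K : {aspace D}).
Hypothesis sK : forall k, k \in K -> s k = k.

Lemma fixed_comm k l : k \in K -> l \in K -> k * l = l * k.
Proof. by move=> kK lK; rewrite -(sK (memvM kK lK)) (proj1 hs.1) !sK. Qed.

Let N : nat := \dim {:D}.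
Let m : nat := \dim K.

(* [K (x) <d_i>] embeds into [K]-valued hermitian forms on the left [K]-space [D]; the
   dual of [K] replaces [K] as target, so that only the trace is needed. *)
Lemma count_forms (r : nat) (x : 'I_r -> D) (P : pred ('I_r * 'I_r)) n (d : n.-tuple D) :
  (forall y, exists c : 'I_r -> D, (forall a, c a \in K) /\ y = \sum_a c a * x a) ->
  free d ->
  (forall c : 'I_n -> D, (forall i, c i \in K) ->
    (forall k a b, k \in K -> P (a, b) -> tr (k * \sum_i c i * x a * d`_i * s (x b)) = 0) ->
    forall k a b, k \in K -> tr (k * \sum_i c i * x a * d`_i * s (x b)) = 0) ->
  (n * m <= #|P| * m)%N.
Proof.
move=> gen fd hP; case: hs => [[sM s1] ss].
pose U := {ffun 'I_n -> subvs_of K}.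
pose Q := ({p : 'I_r * 'I_r | P p} * 'I_m)%type.
pose V := {ffun Q -> F^o}.
pose B := vbasis K.
pose g (c : U) : V := [ffun q : Q => tr (B`_q.2 *
   \sum_i vsval (c i) * x (val q.1).1 * d`_i * s (x (val q.1).2))].
have gl : linear g.
  move=> k u v; apply/ffunP => q; rewrite !ffunE -[X in _ = X + _]/(k * tr _) -ftr.2 -ftr.1; congr tr.
  rewrite scalerAr -mulrDr scaler_sumr -big_split; congr (_ * _); apply: eq_bigr => i _.
  by rewrite /= !ffunE linearP /= !mulrDl -!scalerAl.
suff gi : injective g.
  have := leq_dim_inj gl gi; rewrite !dimvf /dim /= !card_ord card_prod card_ord card_sig.
  by rewrite -[X in (_ <= _ * X)%N]/1%N muln1.
have g0 u : g u = 0 -> u = 0.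
  move=> gu; pose c i := vsval (u i).
  have cK i : c i \in K by exact: subvsP.
  have lin_k (T : D -> D) (k : D) : k \in K ->
    (forall l : 'I_m, tr (B`_l * T 0) = 0) -> tr (k * T 0) = 0.
    move=> kK h; rewrite (coord_vbasis kK) mulr_suml (funl_sum ftr) big1 // => l _.
    by rewrite -scalerAl ftr.2 h mulr0.
  have h1 k a b : k \in K -> tr (k * \sum_i c i * x a * d`_i * s (x b)) = 0.
    apply: hP => // {}k {}a {}b kK Pab.
    apply: (lin_k (fun=> \sum_i c i * x a * d`_i * s (x b))) => // l.
    move/ffunP: gu => /(_ (exist _ (a, b) Pab, l)); by rewrite !ffunE.
  have h2' y z : tr (\sum_i c i * y * d`_i * z) = 0.
    have [cy [cyK ->]] := gen y; have [cz [czK Ez]] := gen (s z).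
    have -> : z = \sum_b s (x b) * cz b.
      rewrite -[z]ss Ez linear_sum; apply: eq_bigr => b _ /=. by rewrite sM (sK (czK b)).
    rewrite (eq_bigr (fun i => \sum_a \sum_b c i * cy a * x a * d`_i * s (x b) * cz b)); last first.
      move=> i _; rewrite mulr_sumr 2!mulr_suml; apply: eq_bigr => a _.
      by rewrite mulr_sumr; apply: eq_bigr => b _; rewrite !mulrA.
    rewrite exchange_big (funl_sum ftr) big1 // => a _.
    rewrite exchange_big (funl_sum ftr) big1 // => b _ /=.
    rewrite -mulr_suml trC -[RHS](h1 (cz b * cy a) a b); last exact: memvM.
    congr tr; rewrite -[in RHS]mulrA; congr (_ * _); rewrite mulr_sumr; apply: eq_bigr => i _.
    by rewrite !mulrA (fixed_comm (cK i)).
  have h3 y : \sum_i c i * y * d`_i = 0.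
    by apply: (tr_nondeg hD htr) => z; rewrite mulr_suml; exact: h2'.
  apply/ffunP => i; rewrite ffunE; apply: val_inj => /=; move: i.
  refine (artin_whaples (csC hD) (cs_full hD) (a := fun i => s d`_i) (b := c) _ _) => [k|y].
    under eq_bigr do rewrite -linearZ.
    rewrite -linear_sum => /(congr1 s); rewrite ss linear0; exact: free_seq.
  transitivity (s (\sum_i c i * s y * d`_i)); last by rewrite h3 linear0.
  rewrite linear_sum; apply: eq_bigr => i _ /=.
  by rewrite !sM ss (sK (cK i)) mulrA.
move=> u v E; apply/eqP; rewrite -subr_eq0; apply/eqP; apply: g0.
have := gl (-1) v u; rewrite !scaleN1r [- v + u]addrC => ->.
by rewrite E addNr.
Qed.

Lemma ex_left_basis : exists r (x : 'I_r -> D),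
  (r * m = N)%N /\ forall y, exists c : 'I_r -> D, (forall a, c a \in K) /\ y = \sum_a c a * x a.
Proof.
have KD : (K * {:D} <= {:D})%VS by exact: subvf.
have [X [sX dX nX]] := skew_field_module_semisimple (csU hD) KD.
exists (size X), (fun a => X`_a); split.
  rewrite /N -sX; move/directvP: dX => /= ->.
  rewrite (eq_big_seq (fun=> m)) => [|x xX]; first by rewrite big_const_seq count_predT iter_addn_0 mulnC.
  by rewrite dim_cosetv_unit // (csU hD) //; apply: contraNneq nX => <-.
move=> y; have := memvf y; rewrite -sX.
elim: X {sX dX nX} y => [|x X IH] y.
  by rewrite big_nil memv0 => /eqP ->; exists (fun=> 0); split=> [[]|] //; rewrite big_ord0.
rewrite big_cons => /memv_addP[_ /memv_cosetP[k kK ->] [z /IH [c [cK ->]] ->]].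
exists (fun a => oapp c k (unlift ord0 a)); split.
  by move=> a; case: unliftP => [b|] _ /=.
by rewrite big_ord_recl unlift_none; congr (_ + _); apply: eq_bigr => a _; rewrite liftK.
Qed.

Lemma tr_Alt_Sym a b : a \in Alt s -> b \in Sym s -> tr (a * b) = 0.
Proof.
move=> /AltP[d ->] /SymP sb; rewrite mulrDl ftr.1 -[tr (s d * b)](tr_anti _ hs).
by rewrite (proj1 hs.1) sb hs.2 trC (csF2 hD).
Qed.

Lemma form_symm n (c v : 'I_n -> D) k y z : (forall i, c i \in K) -> (forall i, v i \in Sym s) ->
  k \in K -> tr (k * \sum_i c i * y * v i * s z) = tr (k * \sum_i c i * z * v i * s y).
Proof.
case: hs => [[sM s1] ss] cK vS kK; rewrite !mulr_sumr !(funl_sum ftr); apply: eq_bigr => i _.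
rewrite -[LHS](tr_anti _ hs) !sM ss (sK kK) (sK (cK i)) (SymP _ _ (vS i)).
by rewrite -!mulrA [c i * k](fixed_comm (cK i) kK) trC -!mulrA trC -!mulrA trC -!mulrA trC -!mulrA trC -!mulrA.
Qed.

Lemma card_le_lt r : (#|[pred p : 'I_r * 'I_r | p.1 <= p.2]| + #|[pred p : 'I_r * 'I_r | p.1 < p.2]| = r * r)%N.
Proof.
rewrite -[X in (X * X)%N]card_ord -card_prod -(cardC [pred p : 'I_r * 'I_r | p.1 <= p.2]%N).
congr (_ + _)%N; pose sw (p : 'I_r * 'I_r) := (p.2, p.1).
have swi : injective sw by move=> [a b] [a' b'] [-> ->].
rewrite -(card_image swi); apply: eq_card => -[a b]; rewrite !inE /= -ltnNge.
apply/imageP/idP => [[[a' b'] /= h [-> ->]] //|h]; by exists (b, a).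
Qed.

Lemma Sym_bound : (m ^ 2 <= N)%N /\ ((K <= Alt s)%VS -> (m ^ 2 < N)%N).
Proof.
have [r [x [rm gen]]] := ex_left_basis.
have [[sM s1] ss] := hs.
have m0 : (0 < m)%N by exact: adim_gt0.
have vS (U : {vspace D}) : (U <= Sym s)%VS -> forall i : 'I_(\dim U), (vbasis U)`_i \in Sym s.
  by move=> /subvP h i; apply: h; apply: vbasis_mem; rewrite mem_nth // size_tuple.
have symS := vS _ (subvv _).
have altS := vS _ (Alt_Sym hs).
have hsym : (\dim (Sym s) <= #|[pred p : 'I_r * 'I_r | p.1 <= p.2]|)%N.
  rewrite -(leq_pmul2r m0); apply: (count_forms gen (basis_free (vbasisP _))) => c cK h k a b kK.
  case: (leqP a b) => ab; first exact: h.
  by rewrite form_symm //; apply: h => //; exact: ltnW.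
have halt : (\dim (Alt s) <= #|[pred p : 'I_r * 'I_r | p.1 < p.2]|)%N.
  rewrite -(leq_pmul2r m0); apply: (count_forms gen (basis_free (vbasisP _))) => c cK h k a b kK.
  case: (ltngtP a b) => ab; first exact: h.
    by rewrite form_symm //; apply: h.
  rewrite -(val_inj ab) mulr_sumr (funl_sum ftr) big1 // => i _.
  set w := _`_i; have -> : tr (k * (c i * x a * w * s (x a))) = tr (x a * w * s (x a) * (k * c i)).
    by rewrite [RHS]trC !mulrA.
  apply: tr_Alt_Sym; last by apply/SymP; rewrite sK // memvM.
  by apply: Alt_conj => //; apply: vbasis_mem; rewrite mem_nth // size_tuple.
have tot : (N <= r * r)%N by rewrite /N -(dim_SymAlt s) -card_le_lt leq_add.
have r0 : (0 < r)%N.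
  by rewrite lt0n; apply/eqP => r0; move: rm; rewrite r0 /N dimvf => E; have := FalgType_proper D; rewrite -E.
split; first by move: tot; rewrite -rm leq_pmul2l // => mr; rewrite expnS expn1 leq_mul2r mr orbT.
move=> KA; have [k1 [k1K one]] := gen 1.
have [i0 ki0] : exists i0, k1 i0 != 0.
  have [//|h] := EM (exists i0, k1 i0 != 0).
  have := oner_neq0 D; rewrite one big1 ?eqxx // => i _.
  have -> : k1 i = 0 by apply/eqP; apply: contra_notT h => h; exists i.
  by rewrite mul0r.
have hsym' : (\dim (Sym s) <= #|[predD1 [pred p : 'I_r * 'I_r | p.1 <= p.2] & (i0, i0)]|)%N.
  rewrite -(leq_pmul2r m0); apply: (count_forms gen (basis_free (vbasisP _))) => c cK h.
  set v := vbasis _ in h *.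
  have h' k a b : k \in K -> (a, b) != (i0, i0) -> tr (k * \sum_i c i * x a * v`_i * s (x b)) = 0.
    move=> kK n0; case: (leqP a b) => ab; first by apply: h; rewrite ?inE ?n0.
    rewrite form_symm //; apply: h => //; rewrite /= inE /= (ltnW ab) andbT.
    by move: n0; apply: contraNneq => -[-> ->].
  move=> k a b kK; have [[-> ->]|/h'] := eqVneq (a, b) (i0, i0); last by apply.
  (* All entries other than [(i0, i0)] are zero, so the value at [(1, 1)] is this entry times
     [q ^+ 2]; the choice of [k'] cancels that factor. *)
  pose q := k1 i0; have qK : q \in K by exact: k1K.
  pose k' := k * q^-1 * q^-1.
  have k'K : k' \in K by rewrite !memvM // memvV.
  have : tr (k' * \sum_i c i * 1 * v`_i * s 1) = 0.
    rewrite mulr_sumr (funl_sum ftr) big1 // => i _; rewrite s1 !mulr1 mulrA.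
    by apply: tr_Alt_Sym; [apply: (subvP KA); rewrite memvM | exact: symS].
  rewrite one linear_sum.
  rewrite (eq_bigr (fun i => \sum_a \sum_b c i * (k1 a * x a) * v`_i * s (k1 b * x b))); last first.
    move=> i _; rewrite mulr_sumr 2!mulr_suml; apply: eq_bigr => a' _.
    by rewrite mulr_sumr; apply: eq_bigr => b' _.
  rewrite exchange_big /= mulr_sumr (funl_sum ftr).
  have E a' b' : tr (k' * \sum_i c i * (k1 a' * x a') * v`_i * s (k1 b' * x b')) =
      tr ((k' * k1 a' * k1 b') * \sum_i c i * x a' * v`_i * s (x b')).
    rewrite !mulr_sumr !(funl_sum ftr); apply: eq_bigr => i _.
    rewrite sM (sK (k1K b')); pose Z := x a' * v`_i * s (x b').
    have -> : k' * k1 a' * k1 b' * (c i * x a' * v`_i * s (x b')) = k' * k1 a' * k1 b' * c i * Z by rewrite /Z !mulrA.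
    have -> : k' * k1 a' * k1 b' * c i = k1 b' * (k' * (c i * k1 a')).
      have kcK : k' * (c i * k1 a') \in K by rewrite memvM // memvM.
      by rewrite (fixed_comm (k1K b') kcK) (fixed_comm (cK i) (k1K a')) !mulrA -!mulrA (fixed_comm (cK i) (k1K b')).
    by rewrite -[in RHS]mulrA [RHS]trC /Z !mulrA.
  have S a' : tr (k' * \sum_i \sum_b c i * (k1 a' * x a') * v`_i * s (k1 b * x b)) =
      \sum_b tr ((k' * k1 a' * k1 b) * \sum_i c i * x a' * v`_i * s (x b)).
    rewrite exchange_big /= mulr_sumr (funl_sum ftr); apply: eq_bigr => b' _; exact: E.
  rewrite (eq_bigr _ (fun a' _ => S a')).
  rewrite (bigD1 i0) //= [X in _ + X]big1 => [|a' ai]; last first.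
    rewrite big1 // => b' _.
    by apply: h'; [rewrite !memvM // memvV | rewrite xpair_eqE (negbTE ai)].
  rewrite (bigD1 i0) //= [X in _ + X + _]big1 => [|b' bi]; last first.
    by apply: h'; [rewrite !memvM // memvV | rewrite xpair_eqE eqxx].
  by rewrite !addr0 /k' -/q !mulrVK ?(csU hD) // mulr_sumr.
have ci0 : (i0, i0) \in [pred p : 'I_r * 'I_r | p.1 <= p.2]%N by rewrite inE.
have := cardD1 (i0, i0) [pred p : 'I_r * 'I_r | p.1 <= p.2]%N; rewrite ci0 => cd.
have tot' : (N < r * r)%N.
  by rewrite /N -(dim_SymAlt s) -card_le_lt cd add1n addSn ltnS leq_add.
by move: tot'; rewrite -rm ltn_pmul2l // => mr; rewrite expnS expn1 ltn_mul2r m0.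
Qed.
End Forms.
End Involutions.

Definition symp (F : fieldType) (D : falgType F) (s : 'End(D)) := invol s /\ 1 \in Alt s.

Section Quartic.
Variables (F : fieldType) (D : falgType F) (hD : csdiv D).
Variables (tr : D -> F) (htr : trace_form tr).
Let ftr : funl tr. Proof. by case: htr. Qed.
Lemma ex_sep (W : {vspace D}) v : v \notin W ->
  exists2 f : D -> F, funl f & (forall w, w \in W -> f w = 0) /\ f v != 0.
Proof.
move=> vW; have v0 : v - projv W v != 0.
  by rewrite subr_eq0; apply: contraNneq vW => ->; exact: memv_proj.
have [g fg gv] := ex_funl v0.
exists (fun y => g (y - projv W y)) => //.
  split=> [y z|k y]; first by rewrite -fg.1 linearD /= opprD addrACA.
  by rewrite linearZ /= -scalerBr fg.2.
by split=> // w wW; rewrite projv_id // subrr -(scale0r 0) fg.2 mul0r.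
Qed.

Lemma funl_tr (f : D -> F) : funl f -> exists z, forall x, f x = tr (z * x).
Proof.
move=> ff; have [es hes] := ex_tr_dual hD htr.
exists (\sum_(i < \dim {:D}) f (vbasis {:D})`_i *: es i) => x.
rewrite mulr_suml (funl_sum ftr) {1}(dual_l ftr hes x) (funl_sum ff).
by apply: eq_bigr => i _; rewrite ff.2 -scalerAl ftr.2 mulrC.
Qed.

Lemma adjoin_ind (U : {vspace D}) (y : D) (V : {vspace D}) : 1 \in V ->
  (forall u x, u \in U -> x \in V -> u * x \in V) -> (forall x, x \in V -> y * x \in V) ->
  (<<U; y>> <= V)%VS.
Proof.
move=> V1 UV yV; apply: agenv_sub_modl; first by rewrite -memvE.
apply/prodvP => u x /memv_addP[a aU [b /vlineP[k ->] ->]] xV.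
by rewrite mulrDl; apply: memvD; [exact: UV | rewrite -scalerAl memvZ // yV].
Qed.

Variables (s : 'End(D)) (hs : symp s).
Let his : invol s. Proof. by case: hs. Qed.
Let sM x y : s (x * y) = s y * s x. Proof. by case: his => -[]. Qed.
Lemma line1P (x : D) : reflect (exists a : F, x = a *: 1) (x \in 1%VS).
Proof. exact: vlineP. Qed.

Lemma scale1_mem (V : {vspace D}) u x : 1 \in V -> u \in 1%VS -> x \in V -> u * x \in V.
Proof. by move=> _ /line1P[a ->] xV; rewrite -scalerAl mul1r memvZ. Qed.

Lemma adjoin_fixed y : s y = y -> forall k, k \in <<1; y>>%VS -> s k = k.
Proof.
move=> sy; suff /subvP h : (<<1; y>> <= Sym s :&: 'C[y])%VS.
  by move=> k /h /memv_capP[/(SymP hD)].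
have V1 : 1 \in (Sym s :&: 'C[y])%VS.
  by apply/memv_capP; split; [apply/(SymP hD); case: his => -[] | exact: cent1v1].
apply: adjoin_ind => [|u x|x].
- exact: V1.
- exact: scale1_mem.
rewrite !memv_cap => /andP[/(SymP hD) sx /cent1vP xy]; apply/andP; split.
  by apply/(SymP hD); rewrite sM sx sy xy.
by apply/cent1vP; rewrite -mulrA xy.
Qed.

(** The invariant keeps both [x] and [y * x] in [Alt s]: one more factor [y] turns [x] into
    [y * x * s y], again alternating. It starts from [1 \in Alt s], which is where symplecticity
    enters. *)
Lemma adjoin_Alt y : y \in Alt s -> (<<1; y>> <= Alt s)%VS.
Proof.
move=> yA; have /SymP sy := subvP (Alt_Sym hD his) _ yA.
suff: (<<1; y>> <= Alt s :&: (amull y @^-1: Alt s) :&: 'C[y])%VS.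
  by move/subv_trans; apply; rewrite -capvA capvSl.
have am x : (amull y x) = y * x by rewrite lfunE.
have V1 : 1 \in (Alt s :&: (amull y @^-1: Alt s) :&: 'C[y])%VS.
  apply/memv_capP; split; last exact: cent1v1.
  by apply/memv_capP; split; [exact: hs.2 | rewrite -memv_preim am mulr1].
apply: adjoin_ind => // [u x|x]; first exact: scale1_mem.
rewrite !memv_cap -!memv_preim !am => /andP[/andP[xA yxA] /cent1vP xy].
rewrite yxA /=; apply/andP; split; last by apply/cent1vP; rewrite -mulrA xy.
by rewrite -xy mulrA -[X in _ * X](sy hD) (Alt_conj _ his).
Qed.

Let W (y : D) j : {vspace D} := span [seq y ^+ i | i <- iota 0 j].

(** [j] is the degree of the minimal polynomial of [y]. *)
Lemma pow_basis (y : D) : exists2 j, free [seq y ^+ i | i <- iota 0 j] &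
  y ^+ j \in W y j /\ \dim <<1; y>>%VS = j.
Proof.
have exj : exists j, y ^+ j \in W y j.
  have [//|h] := EM (exists j, y ^+ j \in W y j).
  have dW j : \dim (W y j) = j.
    elim: j => [|j IH]; first by rewrite /W /= span_nil dimv0.
    rewrite /W -addn1 iotaD map_cat span_cat /= span_seq1 dimv_disjoint_sum -/(W y j).
      rewrite IH dim_vline; have [y0|//] := eqVneq (y ^+ (0 + j)) 0.
      by case: h; exists j; rewrite -[j]add0n y0 mem0v.
    apply/eqP; rewrite -subv0; apply/subvP => x; rewrite memv_cap memv0 => /andP[xW /vlineP[k xk]].
    have [k0|k0] := eqVneq k 0; first by rewrite xk k0 scale0r.
    case: h; exists j; rewrite -[y ^+ j](scalerK k0) -[j in y ^+ j]add0n -xk.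
    exact: memvZ.
  have := dimvS (subvf (W y (\dim {:D}).+1)); by rewrite dW ltnn.
have [j hj jmin] := ex_minnP exj.
have fj : free [seq y ^+ i | i <- iota 0 j].
  have fr i : (i <= j)%N -> free [seq y ^+ l | l <- iota 0 i].
    elim: i => [|i IH] ij; first exact: nil_free.
    rewrite -addn1 iotaD map_cat (perm_free (Y := y ^+ i :: [seq y ^+ l | l <- iota 0 i])).
      rewrite free_cons IH ?(ltnW ij) // andbT; apply/negP => /jmin; by rewrite leqNgt ij.
    by rewrite perm_catC /= add0n.
  exact: fr.
exists j => //; split=> //; have <- : (W y j = <<1; y>>)%VS.
  apply/eqP; rewrite eqEsubv; apply/andP; split.
    apply/span_subvP => x /mapP[i _ ->]; elim: i => [|i IH]; first by rewrite expr0 asp1.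
    by rewrite exprS (memvM (A := <<1; y>>%AS)) // memv_adjoin.
  have W1 : 1 \in W y j.
    case: (j) hj => [|i _]; first by rewrite expr0.
    by apply: memv_span; apply/mapP; exists 0%N.
  apply: adjoin_ind => // [u x|x xW]; first exact: scale1_mem.
  rewrite (coord_span (X := in_tuple _) xW) mulr_sumr; apply: rpred_sum => i _.
  rewrite -scalerAr memvZ // (nth_map 0%N) ?size_iota //; last by case: i; rewrite size_map size_iota.
  have il : (i < j)%N by case: i; rewrite size_map size_iota.
  rewrite nth_iota // add0n -exprS; case: (leqP j i.+1) => [ji|ij].
    by have -> : i.+1 = j by apply/eqP; rewrite eqn_leq il.
  by apply: memv_span; apply/mapP; exists i.+1; rewrite // mem_iota.
by move/eqP: fj; rewrite size_map size_iota.
Qed.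
End Quartic.

Section Degree8.
Variables (F : fieldType) (D : falgType F) (hD : csdiv D).
Let h2 := cs2 hD.
Variables (tr : D -> F) (htr : trace_form tr).
Definition free4 (y : D) := forall k0 k1 k2 k3 : F,
  k0 *: 1 + k1 *: y + k2 *: (y * y) + k3 *: (y * y * y) = 0 -> [/\ k0 = 0, k1 = 0, k2 = 0 & k3 = 0].

Definition quadratic (y : D) := exists a b : F, y * y = a *: 1 + b *: y.

Definition quartic (y : D) := free4 y /\ exists c0 c1 c2 c3 : F,
  y * y * y * y = c0 *: 1 + c1 *: y + c2 *: (y * y) + c3 *: (y * y * y).

Lemma dim_dvd (K : {aspace D}) : (\dim K %| \dim {:D})%N.
Proof. exact: (skew_field_dimS (B := {:D}%AS) (csU hD) (subvf K)). Qed.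

Section Pow.
Variable s : 'End(D).
Hypothesis hs : symp s.
Let his : invol s. Proof. by case: hs. Qed.
Lemma Alt_sym y : y \in Alt s -> s y = y.
Proof. by move=> /(subvP (Alt_Sym hD his)) /(SymP hD). Qed.

(** The degree of [y] divides 64, and it is below 8 by the strict part of [Sym_bound], since [F[y]]
    stays inside [Alt s]. *)
Lemma quadratic_or_quartic y : \dim {:D} = 64%N -> y \in Alt s -> quadratic y \/ quartic y.
Proof.
move=> d64 yA; have [j fj [yj dj]] := pow_basis hD y.
have jd : (j %| 64)%N by rewrite -d64 -dj; exact: (dim_dvd <<1; y>>%AS).
have [_ /(_ (adjoin_Alt hD hs yA))] := Sym_bound hD htr his (K := <<1; y>>%AS) (adjoin_fixed hD hs (Alt_sym yA)).
rewrite /= dj d64 => j8.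
have j8' : (j < 8)%N by rewrite -(ltn_sqr j 8).
have : (j == 1) || (j == 2) || (j == 4) by move: j8' jd; case: (j) => [|[|[|[|[|[|[|[|?]]]]]]]].
move=> /orP[/orP[]|] /eqP j_; move: fj yj; rewrite {}j_ /=.
- move=> _; rewrite span_seq1 expr0 expr1 => /vlineP[a ->]; left; exists 0, a.
  by nc h2 tt.
- move=> _; rewrite span_cons span_seq1 expr0 expr1 => /memv_addP[_ /vlineP[a ->] [_ /vlineP[b ->] E]].
  by left; exists a, b; rewrite -E expr2.
move=> fj; rewrite !span_cons span_nil addv0 expr0 expr1.
move=> /memv_addP[_ /vlineP[c0 ->] [_ /memv_addP[_ /vlineP[c1 ->] [_ /memv_addP[_ /vlineP[c2 ->] [_ /vlineP[c3 ->] ->]]] ->] E]].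
right; split; last first.
  by exists c0, c1, c2, c3; move: E; rewrite !exprSr expr0 !mul1r !addrA.
move=> k0 k1 k2 k3 E'; have /freeP/(_ (fun i : 'I_4 => [:: k0; k1; k2; k3]`_i)) : free [tuple y ^+ 0; y ^+ 1; y ^+ 2; y ^+ 3] := fj.
rewrite !big_ord_recl big_ord0 /= !exprSr expr0 !mul1r addr0 !addrA => /(_ E') H.
by split; [exact: (H (@Ordinal 4 0 isT)) | exact: (H (@Ordinal 4 1 isT)) | exact: (H (@Ordinal 4 2 isT)) | exact: (H (@Ordinal 4 3 isT))].
Qed.

Lemma free4_neq0 y : free4 y -> y != 0.
Proof.
move=> f4; apply/eqP => y0; have [|_ /eqP] := f4 0 1 0 0; first by rewrite y0; nc h2 tt.
by rewrite oner_eq0.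
Qed.

(** The inner derivation of [j] acts on [F[y]] as [d/dy] or [y d/dy]. Applied to the minimal
    polynomial it gives a shorter relation, which kills the coefficients of odd degree. *)
Lemma insep_quartic y j : quadratic y \/ quartic y -> (forall a : F, y != a%:A) ->
  j * y = y * j + 1 \/ j * y = y * j + y ->
  (exists a : F, y * y = a%:A) \/
  exists c0 c2 : F, y * y * y * y = c0 *: 1 + c2 *: (y * y) /\ free4 y.
Proof.
move=> H yF dj.
have y0 : y != 0 by have := yF 0; rewrite scale0r.
case: H => [[a [b E]]|[f4 [c0 [c1 [c2 [c3 E]]]]]].
  left; exists a; have [b00|b0] := eqVneq b 0; first by rewrite E b00 scale0r addr0.
  exfalso; have : j * (y * y) + (y * y) * j = j * (a *: 1 + b *: y) + (a *: 1 + b *: y) * j by rewrite E.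
  case: dj => dj.
    have -> : j * (y * y) + y * y * j = 0 by nc h2 dj.
    have -> : j * (a *: 1 + b *: y) + (a *: 1 + b *: y) * j = b *: 1 by nc h2 dj.
    by move/esym/eqP; rewrite scaler_eq0 oner_eq0 (negbTE b0).
  have -> : j * (y * y) + y * y * j = 0 by nc h2 dj.
  have -> : j * (a *: 1 + b *: y) + (a *: 1 + b *: y) * j = b *: y by nc h2 dj.
  by move/esym/eqP; rewrite scaler_eq0 (negbTE y0) (negbTE b0).
right; exists c0, c2; split=> //.
have : j * (y * y * y * y) + (y * y * y * y) * j =
    j * (c0 *: 1 + c1 *: y + c2 *: (y * y) + c3 *: (y * y * y)) +
    (c0 *: 1 + c1 *: y + c2 *: (y * y) + c3 *: (y * y * y)) * j by rewrite E.
case: dj => dj.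
  have -> : j * (y * y * y * y) + y * y * y * y * j = 0 by nc h2 dj.
  set R := (X in _ = X -> _); have -> : R = c1 *: 1 + 0 *: y + c3 *: (y * y) + 0 *: (y * y * y).
    by rewrite /R !scale0r; nc h2 dj.
  by move/esym/f4 => [c10 _ c30 _]; rewrite E c10 c30; nc h2 tt.
have -> : j * (y * y * y * y) + y * y * y * y * j = 0 by nc h2 dj.
set R := (X in _ = X -> _); have -> : R = 0 *: 1 + c1 *: y + 0 *: (y * y) + c3 *: (y * y * y).
  by rewrite /R !scale0r; nc h2 dj.
by move/esym/f4 => [_ c10 _ c30]; rewrite E c10 c30; nc h2 tt.
Qed.
End Pow.
End Degree8.

(** * Pfaffian traces *)

Section Pfaffian.
Variables (F : fieldType) (D : falgType F) (hD : csdiv D).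
Let h2 := cs2 hD.
Variables (tr : D -> F) (htr : trace_form tr).
Let ftr : funl tr. Proof. by case: htr. Qed.
Let trC x y : tr (x * y) = tr (y * x). Proof. by case: htr. Qed.
Variables (kp : F) (hkp : forall x, tr (x * x) = kp * tr x ^+ 2).
Variables (s : 'End(D)) (hs : symp s).
Let his : invol s. Proof. by case: hs. Qed.
Let sM x y : s (x * y) = s y * s x. Proof. by case: his => -[]. Qed.
Let ss x : s (s x) = x. Proof. by case: his. Qed.

(** Models the linear coefficient of the Pfaffian characteristic polynomial on [Alt s], which is
    half of the reduced trace when halving makes sense. *)
Definition pfaffian_trace (T : D -> F) :=
  [/\ funl T, (forall d, T (d + s d) = tr d) & forall m, m \in Alt s -> T (m * m) = kp * T m ^+ 2].

(** With [1 = l + s l], the functional [tr (_ * l)] takes at [d + s d] the value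
    [tr (d * (l + s l))]. *)
Lemma ex_pfaffian_trace : exists T, pfaffian_trace T.
Proof.
have /AltP[l hl] := hs.2; exists (fun m => tr (m * l)).
have R e : tr ((e + s e) * l) = tr e.
  rewrite mulrDl ftr.1 -(tr_anti hD htr (s e * l) his) sM ss [tr (s l * e)]trC -ftr.1 -mulrDr -hl.
  by rewrite mulr1.
split=> //.
  by split=> [x y|k x]; [rewrite mulrDl ftr.1 | rewrite -scalerAl ftr.2].
move=> m /AltP[d ->]; rewrite R -hkp.
have -> : (d + s d) * (d + s d) = (d * d + s (d * d)) + d * s d + s d * d by rewrite sM; nc h2 tt.
rewrite !mulrDl !ftr.1 -ftr.1 -mulrDl R.
have -> : tr (d * s d * l) = tr (s d * d * l).
  rewrite -{1}[s d]mul1r {1}hl.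
  have -> : d * ((l + s l) * s d) = d * l * s d + s (d * l * s d) by rewrite !sM ss; nc h2 tt.
  by rewrite R trC mulrA.
by rewrite -addrA (csF2 hD) addr0.
Qed.

Variables (T : D -> F) (hT : pfaffian_trace T).

(* When [T 1 != 0], evaluating [T] on the powers of [y] up to the sixth forces the minimal
   polynomial to factor as [(X^3 + c1) (X + c3)]. *)
Lemma pf_quartic_one y c0 c1 c2 c3 : y \in Alt s -> T y = 0 -> T y^-1 = 0 -> free4 y ->
  y * y * y * y = c0 *: 1 + c1 *: y + c2 *: (y * y) + c3 *: (y * y * y) -> T 1 = 0 /\ T (y * y * y) = 0.
Proof.
case: hT => fT Td Tsq yA Ty TVy f4 E.
have sy : s y = y := Alt_sym hD hs yA.
have y0 := free4_neq0 hD f4; have yU := csU hD y0.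
have KA x : x \in <<1; y>>%AS -> x \in Alt s by exact: (subvP (adjoin_Alt hD hs yA)).
have yK : y \in <<1; y>>%AS by exact: memv_adjoin.
have T2 : T (y * y) = 0 by rewrite Tsq // Ty expr0n mulr0.
have E3 : y * y * y = c0 *: y^-1 + c1 *: 1 + c2 *: y + c3 *: (y * y).
  by rewrite -[LHS](mulrK yU) E !mulrDl -!scalerAl mulrK // mulrV // mul1r mulrK.
have T3 : T (y * y * y) = c1 * T 1.
  by rewrite E3 !fT.1 !fT.2 TVy Ty T2 !mulr0 add0r !addr0.
have T4 : T (y * y * y * y) = 0.
  by rewrite -!mulrA mulrA Tsq ?T2 ?expr0n ?mulr0 // KA // memvM.
have T4' : (c0 + c1 * c3) * T 1 = 0.
  rewrite -[RHS]T4 E !fT.1 !fT.2 Ty T2 T3; ring.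
have T5 : T (y * y * y * y * y) = c2 * (c1 * T 1).
  rewrite E !mulrDl -!scalerAl mul1r !fT.1 !fT.2 Ty T2 T3 T4; ring.
have T11 : kp * T 1 ^+ 2 = T 1 by rewrite -Tsq ?mulr1 // KA // asp1.
have T6 : T (y * y * y * y * y * y) = c1 ^+ 2 * T 1.
  have -> : y * y * y * y * y * y = (y * y * y) * (y * y * y) by nc h2 tt.
  rewrite Tsq ?T3; last by rewrite KA // !memvM.
  by rewrite exprMn mulrCA T11.
have T6' : c1 * c2 * c3 * T 1 = 0.
  move: T6; rewrite {1}E !mulrDl -!scalerAl mul1r !fT.1 !fT.2 T2 T3 T4 T5 => T6.
  have : c1 ^+ 2 * T 1 + c1 * c2 * c3 * T 1 = c1 ^+ 2 * T 1 by rewrite -[RHS]T6; ring.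
  by move/eqP; rewrite -subr_eq0 addrAC subrr add0r => /eqP.
have [T10|T10] := eqVneq (T 1) 0; first by rewrite T3 T10 mulr0.
exfalso; move/eqP: T4'; rewrite mulf_eq0 (negbTE T10) orbF addr_eq0 => /eqP c0E.
have c0n : c0 != 0.
  apply/eqP => c00; have /f4[_ _ _ /eqP] : c1 *: 1 + c2 *: y + c3 *: (y * y) + 1 *: (y * y * y) = 0.
    apply: (cs_mulI hD y0); rewrite mulr0; apply: etrans (h2 (y * y * y * y)).
    by rewrite {2}E c00 scale0r; nc h2 tt.
  by rewrite oner_eq0.
have c13 : c1 * c3 != 0 by move: c0n; rewrite c0E oppr_eq0.
move: c13; rewrite mulf_eq0 negb_or => /andP[c1n c3n].
have c20 : c2 = 0.
  by move/eqP: T6'; rewrite !mulf_eq0 (negbTE T10) (negbTE c1n) (negbTE c3n) orbF /= orbF => /eqP.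
have c0E' : c0 = c1 * c3.
  by rewrite c0E; apply/eqP; rewrite eq_sym -addr_eq0 (csF2 hD).
have : (y * y * y + c1 *: 1) * (y + c3 *: 1) = 0.
  have E' : y * y * y * y = (c1 * c3) *: 1 + c1 *: y + c3 *: (y * y * y).
    by rewrite E c20 c0E' scale0r addr0.
  nc h2 E'.
move=> /(cs_mul0 hD)[h|h].
  have [|_ _ _ /eqP] := f4 c1 0 0 1; first by rewrite -h !scale0r; nc h2 tt.
  by rewrite oner_eq0.
have [|_ /eqP] := f4 c3 1 0 0; first by rewrite -h !scale0r; nc h2 tt.
by rewrite oner_eq0.
Qed.

Lemma quartic_basis (y : D) : quartic y -> basis_of <<1; y>>%VS [:: 1; y; y * y; y * y * y].
Proof.
case=> f4 [c0 [c1 [c2 [c3 E]]]].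
have f4' : free [tuple 1; y; y * y; y * y * y].
  apply/freeP => k; rewrite !big_ord_recl big_ord0 /= addr0 !addrA => /f4[h0 h1 h2' h3].
  by case=> -[|[|[|[|//]]]] i4 /=; [rewrite -[RHS]h0|rewrite -[RHS]h1|rewrite -[RHS]h2'|rewrite -[RHS]h3];
    congr k; apply: val_inj.
rewrite /basis_of f4' andbT eqEsubv; apply/andP; split.
  have yK : y \in <<1; y>>%AS by exact: memv_adjoin.
  by apply/span_subvP => x; rewrite !inE => /or4P[] /eqP ->; rewrite ?(asp1 hD) // !(memvM (A := <<1; y>>%AS)).
set X := [:: _; _; _; _]; have m x : x \in X -> x \in <<X>>%VS by exact: memv_span.
have X1 : 1 \in <<X>>%VS by apply: m; rewrite !inE eqxx.
apply: adjoin_ind => // [u x|x]; first exact: scale1_mem.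
have dec : x \in <<X>>%VS -> exists k0 k1 k2 k3 : F, x = k0 *: 1 + (k1 *: y + (k2 *: (y * y) + k3 *: (y * y * y))).
  rewrite !span_cons span_nil addv0 => /memv_addP[_ /vlineP[k0 ->] [_ /memv_addP[_ /vlineP[k1 ->] [_ /memv_addP[_ /vlineP[k2 ->] [_ /vlineP[k3 ->] ->]]] ->] ->]].
  by exists k0, k1, k2, k3.
move=> /dec[k0 [k1 [k2 [k3 ->]]]].
have -> : y * (k0 *: 1 + (k1 *: y + (k2 *: (y * y) + k3 *: (y * y * y)))) =
  k0 *: y + k1 *: (y * y) + k2 *: (y * y * y) + k3 *: (c0 *: 1 + c1 *: y + c2 *: (y * y) + c3 *: (y * y * y)).
  by rewrite -E; nc h2 tt.
by rewrite !memvD ?memvZ ?memvD ?memvZ // m ?inE ?eqxx ?orbT.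
Qed.

(** If 1 is not in the image of [ad y], some functional [tr (q * _)] kills this image but not 1;
    invariance of the trace turns the first property into [q * y = y * q]. *)
Lemma centralizer_or_comm (y : D) : (exists j, j * y = y * j + 1) \/
  (exists q, q * y = y * q /\ tr q != 0).
Proof.
pose L := amull y + amulr y.
have LE d : L d = y * d + d * y by rewrite add_lfunE !lfunE.
have [/memv_imgP[d _]|n1] := boolP (1 \in limg L).
  rewrite LE => E; left; exists d; rewrite E; nc h2 tt.
have [f ff [fL f1]] := ex_sep n1.
have [q hq] := funl_tr hD htr ff.
right; exists q; split; last by rewrite -[q]mulr1 -hq.
apply: (add2_eq hD); apply: (tr_nondeg hD htr) => d.
have := fL (L d) (memv_img _ (memvf _)); rewrite hq LE => E.
rewrite -[RHS]E mulrDr mulrDl !ftr.1 !mulrA; congr (_ + _).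
by rewrite [RHS]trC mulrA.
Qed.

(** When 1 is a commutator with [y], [insep_quartic] applies. Otherwise some [q] with [tr q != 0]
    commutes with [y]. For [a = q + s q] the value [T a] is non-zero, whereas [T] vanishes on [K =
    F[y]]; so [K] and [K * a] span an algebra of dimension 8 inside [Alt s], against [Sym_bound]. *)
Lemma pfaffian_quartic y : \dim {:D} = 64%N -> y \in Alt s -> (forall a : F, y != a%:A) ->
  T y = 0 -> T y^-1 = 0 -> quadratic y \/ exists c0 c2 : F, y * y * y * y = c0 *: 1 + c2 *: (y * y) /\ free4 y.
Proof.
move=> d64 yA yF Ty TVy.
have [[a [b qy]]|[f4 [c0 [c1 [c2 [c3 E]]]]]] := quadratic_or_quartic hD htr hs d64 yA.
  by left; exists a, b.
right; have [[j hj]|[q [qy tq]]] := centralizer_or_comm y.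
  have Q : quadratic y \/ quartic y by right; split=> //; exists c0, c1, c2, c3.
  have [[a E2]|//] := insep_quartic hD Q yF (or_introl hj).
  have [|_ _ /eqP] := f4 a 0 (1) 0; first by rewrite E2 !scale0r; nc h2 tt.
  by rewrite oner_eq0.
exfalso.
have [T1 T3] := pf_quartic_one yA Ty TVy f4 E.
case: hT => fT Td Tsq.
have sy : s y = y := Alt_sym hD hs yA.
have T2 : T (y * y) = 0 by rewrite Tsq // Ty expr0n mulr0.
have y0 := free4_neq0 hD f4.
pose K := <<1; y>>%AS.
have KA x : x \in K -> x \in Alt s by exact: (subvP (adjoin_Alt hD hs yA)).
have Ks x : x \in K -> s x = x by exact: (adjoin_fixed hD hs sy).
have yK : y \in K by exact: memv_adjoin.
have oneK : 1 \in K by exact: asp1.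
have K4 : \dim K = 4%N /\ forall x, x \in K -> T x = 0.
  have /quartic_basis B : quartic y by split=> //; exists c0, c1, c2, c3.
  have KE : K = span [:: 1; y; y * y; y * y * y] :> {vspace D} by rewrite (span_basis B).
  split; first by rewrite KE; apply/eqP; exact: (basis_free B).
  move=> x; rewrite -[x \in K]/(x \in (K : {vspace D})) KE !span_cons span_nil addv0.
  move=> /memv_addP[_ /vlineP[k0 ->] [_ /memv_addP[_ /vlineP[k1 ->] [_ /memv_addP[_ /vlineP[k2 ->] [_ /vlineP[k3 ->] ->]]] ->] ->]].
  by rewrite !fT.1 !fT.2 T1 Ty T2 T3 !mulr0 !addr0.
pose a := q + s q.
have aK : a \notin K by apply: contraNN tq => /K4.2; rewrite Td => ->.
have Kq x : x \in K -> x * q = q * x.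
  suff /subvP h : (<<1; y>> <= 'C[q])%VS by move=> /h/cent1vP.
  apply: adjoin_ind => [|u z uu zz|z zz]; [exact: cent1v1 | exact: scale1_mem (cent1v1 q) uu zz | ].
  by rewrite (memvM (A := 'C[q]%AS)) //; apply/cent1vP; rewrite qy.
have Ksq x : x \in K -> x * s q = s q * x.
  by move=> xK; rewrite -[x in LHS](Ks x xK) -sM -(Kq x xK) sM (Ks x xK).
have Ka x : x \in K -> x * a = a * x by move=> xK; rewrite mulrDr mulrDl Kq // Ksq.
have KaA x : x \in K -> x * a \in Alt s.
  move=> xK; apply/AltP; exists (x * q) => //; by rewrite sM (Ks x xK) -(Ksq x xK) -mulrDr.
have sa : s a = a by rewrite linearD /= ss addrC.
pose M := << K; a >>%AS.
have Mfix : forall x, x \in M -> s x = x.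
  suff /subvP h : (M <= Sym s :&: 'C(K) :&: 'C[a])%VS.
    by move=> ? /h /memv_capP[/memv_capP[/(SymP hD)]].
  have [h1 [h2' h3]] : 1 \in Sym s /\ 1 \in 'C(K)%VS /\ 1 \in 'C[a]%VS.
    by split; [apply/(SymP hD); case: his => -[] | split; [exact: centv1 | exact: cent1v1]].
  apply: adjoin_ind => [|u x uK /memv_capP[/memv_capP[/(SymP hD) sx xK] /cent1vP xa]|
                        x /memv_capP[/memv_capP[/(SymP hD) sx xK] /cent1vP xa]].
  - by apply/memv_capP; split=> //; apply/memv_capP.
  - have cx v : v \in K -> x * v = v * x by move: v; apply/centvP.
    have ux := cx u uK.
    have Kc v : v \in K -> u * v = v * u by move=> vK; rewrite -[LHS](Ks _ (memvM uK vK)) sM !Ks.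
    apply/memv_capP; split; last by apply/cent1vP; rewrite -mulrA xa !mulrA Ka.
    apply/memv_capP; split; first by apply/(SymP hD); rewrite sM sx (Ks u uK) ux.
    by apply/centvP => v vK; rewrite -mulrA cx // !mulrA Kc.
  have cx v : v \in K -> x * v = v * x by move: v; apply/centvP.
  apply/memv_capP; split; last by apply/cent1vP; rewrite -mulrA xa.
  apply/memv_capP; split; first by apply/(SymP hD); rewrite sM sx sa xa.
  by apply/centvP => v vK; rewrite -mulrA cx // !mulrA Ka.
have [M8 M8'] := Sym_bound hD htr his Mfix.
have a0 : a != 0 by apply: contraNneq aK => ->; exact: mem0v.
have KM : (K <= M)%VS by exact: subv_adjoin.
have aM : a \in M by exact: memv_adjoin.
have KaM : (K * <[a]> <= M)%VS.
  by apply/subvP => x /memv_cosetP[k kK ->]; rewrite memvM // (subvP KM).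
have dS : \dim (K + K * <[a]>) = 8%N.
  rewrite dimv_disjoint_sum; first by rewrite dim_cosetv_unit ?(csU hD) // K4.1.
  apply/eqP; rewrite -subv0; apply/subvP => x; rewrite memv_cap memv0 => /andP[xK /memv_cosetP[k kK E']].
  have [k0|k0] := eqVneq k 0; first by rewrite E' k0 mul0r.
  case/negP: aK; rewrite -[a](mulKr (csU hD k0)) -E' memvM // memvV //.
have SM : (K + K * <[a]> <= M)%VS by rewrite subv_add KM KaM.
have EM : (K + K * <[a]> = M)%VS.
  apply/eqP; rewrite eqEdim SM dS /=; move: M8; rewrite d64.
  by rewrite -(@leq_sqr _ 8).
have /M8' : (M <= Alt s)%VS.
  rewrite -EM subv_add; apply/andP; split; first by apply/subvP => x; exact: KA.
  by apply/subvP => x /memv_cosetP[k kK ->]; exact: KaA.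
by rewrite -EM dS d64.
Qed.
End Pfaffian.

(** * Artin-Schreier elements *)

Section ArtinSchreier.
Variables (F : fieldType) (D : falgType F) (hD : csdiv D).
Let h2 := cs2 hD.
Variables (tr : D -> F) (htr : trace_form tr).
Definition scalar (x : D) := exists a : F, x = a *: 1.
Definition artin_schreier (u : D) := ~ scalar u /\ exists a : F, u * u = u + a *: 1.

Lemma scalarC x y : scalar x -> x * y = y * x.
Proof. by case=> a ->; rewrite -scalerAl -scalerAr mul1r mulr1. Qed.

Lemma non_scalar_comm x : ~ scalar x -> exists y, y * x != x * y.
Proof.
move=> xF; have [//|h] := EM (exists y, y * x != x * y); case: xF.
by apply: (csC hD) => y; apply/eqP; apply: contra_notT h => h; exists y.
Qed.

Lemma ex_twist (s : 'End(D)) g : invol s -> g != 0 -> s g = g ->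
  exists t : 'End(D), invol t /\ forall x, t x = g * s x * g^-1.
Proof.
case=> [[sM s1] ss] g0 sg; have gU := csU hD g0.
have [t ht] : exists t : 'End(D), forall x, t x = g * s x * g^-1.
  by apply: ex_linfun => k x y; rewrite linearP mulrDr mulrDl -scalerAr -scalerAl.
have sV : s g^-1 = g^-1 by rewrite anti_inv ?sg.
exists t; split=> //; split; [split|] => [x y||x]; rewrite !ht.
- by rewrite sM !mulrA mulrVK.
- by rewrite s1 mulr1 mulrV.
by rewrite !sM ss sg sV !mulrA mulrV // mul1r mulrK.
Qed.

(** Right multiplication by [g^-1] carries [Alt s] into [Alt t], and [g] itself to 1. *)
Lemma ex_symp_twist (s : 'End(D)) g : invol s -> g != 0 -> g \in Alt s ->
  exists t : 'End(D), [/\ symp t, forall x, t x = g * s x * g^-1 &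
    forall d, (d + s d) * g^-1 = d * g^-1 + t (d * g^-1)].
Proof.
move=> hs g0 gA; have gU := csU hD g0.
have /(SymP hD) sg := subvP (Alt_Sym hD hs) _ gA.
have [t [ht tE]] := ex_twist hs g0 sg; have [[sM s1] ss] := hs.
have E d : (d + s d) * g^-1 = d * g^-1 + t (d * g^-1).
  by rewrite tE sM (anti_inv hD hs.1 g0) sg mulrDl mulrA mulrV // mul1r.
exists t; split=> //; split=> //; have /AltP[d gd] := gA.
by apply/AltP; exists (d * g^-1); rewrite -E -gd mulrV.
Qed.

Lemma ex_symp (s : 'End(D)) x : invol s -> s x != x -> exists t : 'End(D), symp t.
Proof.
move=> hs sx; have [||t [ht _ _]] := @ex_symp_twist s (x + s x) hs; last by exists t.
  by apply: contraNneq sx => /(add2_eq hD) <-.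
by apply/AltP; exists x.
Qed.

Lemma proper_sub_dim (K : {aspace D}) x : x \notin K -> (2 * \dim K <= \dim {:D})%N.
Proof.
move=> xK; have /dvdnP[q qd] := dim_dvd hD K.
case: q qd => [|[|q]] qd; last by rewrite qd leq_mul2r orbT.
  by have := adim_gt0 {:D}%AS; rewrite /= qd.
have : (K == {:D} :> {vspace D})%VS by rewrite eqEdim subvf qd mul1n leqnn.
by move/eqP => E; move: xK; rewrite -[x \in K]/(x \in (K : {vspace D})) E memvf.
Qed.

(** For a symmetric non-scalar [d], the image of [ad d] lies in [Alt s + Alt s * <[d]>], while its
    kernel is a proper subalgebra and has at most half the dimension. *)
Lemma dim_Alt (s : 'End(D)) : invol s -> (2 < \dim {:D})%N -> (\dim {:D} <= 4 * \dim (Alt s))%N.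
Proof.
move=> hs N2; have [[sM s1] ss] := hs.
have [d [ds dF]] : exists d, s d = d /\ ~ scalar d.
  have [//|h] := EM (exists d, s d = d /\ ~ scalar d).
  have SF : (Sym s <= 1)%VS.
    apply/subvP => d /(SymP hD) sd; apply/line1P.
    by have [//|nd] := EM (scalar d); case: h; exists d.
  have := dim_SymAlt s; have := dimvS SF; have := dimvS (Alt_Sym hD hs).
  rewrite dimv1 => a b c; move: N2; rewrite -c; lia.
pose L := amull d + amulr d.
have LE x : L x = d * x + x * d by rewrite add_lfunE !lfunE.
have LA : (limg L <= Alt s + Alt s * <[d]>)%VS.
  apply/subvP => _ /memv_imgP[x _ ->]; rewrite LE.
  have -> : d * x + x * d = (d * x + s (d * x)) + (x + s x) * d.
    by rewrite sM ds mulrDl; nc h2 tt.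
  by apply: memv_add; [apply/AltP; exists (d * x) | apply/memv_cosetP; exists (x + s x) => //; apply/AltP; exists x].
have d0 : d != 0 by apply/eqP => d0; case: dF; exists 0; rewrite scale0r.
have dL : (\dim (limg L) <= 2 * \dim (Alt s))%N.
  apply: leq_trans (dimvS LA) _; apply: leq_trans (dimv_add_leqif _ _) _.
  by rewrite dim_cosetv_unit ?(csU hD) // mul2n addnn.
have dK : (2 * \dim (lker L) <= \dim {:D})%N.
  have [y yd] := non_scalar_comm dF.
  have : y \notin 'C[d]%AS by apply/negP => /cent1vP E; rewrite E eqxx in yd.
  move/proper_sub_dim; apply: leq_trans; rewrite leq_mul2l /=; apply: dimvS.
  apply/subvP => x; rewrite memv_ker LE => /eqP /(add2_eq hD) E.
  exact/cent1vP.
have := limg_ker_dim L {:D}; rewrite capfv; lia.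
Qed.

(* Otherwise [d * e = e * s d] for [e := [j, d]], so that [s] is conjugate on the centraliser
   of [j] to the identity, which makes that centraliser commutative. *)
Lemma Alt_noncentral (s : 'End(D)) j : symp s -> (4 < \dim {:D})%N -> s j = j -> ~ scalar j ->
  scalar (j * j) -> exists a, a \in Alt s /\ j * a + a * j != 0.
Proof.
move=> hs N4 sj jF jjF; have his := hs.1; have [[sM s1] ss] := his.
have [//|h] := EM (exists a, a \in Alt s /\ j * a + a * j != 0).
have cA a : a \in Alt s -> j * a + a * j = 0.
  by move=> aA; apply/eqP; apply: contra_notT h => h; exists a.
have jj d : j * j * d = d * j * j by rewrite scalarC // mulrA.
pose de d := j * d + d * j.
have sde d : s (de d) = de d.
  rewrite /de linearD /= !sM sj; have dA : d + s d \in Alt s by apply/AltP; exists d.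
  apply: (add2_eq hD); rewrite -[RHS](cA _ dA); nc h2 tt.
have de0 d : d * de d = de d * s d.
  have dA : d + s d \in Alt s by apply/AltP; exists d.
  have dA' : d * s d \in Alt s by have := Alt_conj d his hs.2; rewrite mulr1.
  apply: (add2_eq hD); have E1 := cA _ dA; have E2 := cA _ dA'.
  have -> : d * de d + de d * s d = d * (j * (d + s d) + (d + s d) * j) + (j * (d * s d) + d * s d * j).
    by rewrite /de; nc h2 tt.
  by rewrite E1 E2 mulr0 addr0.
have [d ed] : exists d, de d != 0.
  have [y yj] := non_scalar_comm jF; exists y; apply: contraNneq yj => /(add2_eq hD) ->.
  by rewrite eqxx.
have [t [ht tE]] := ex_twist his ed (sde d).
have [] := Sym_bound hD htr ht (K := 'C[j]%AS).
  move=> k /cent1vP kj; rewrite tE.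
  have dek : de (d + k) = de d.
    have -> : de (d + k) = de d + (j * k + k * j) by rewrite /de; nc h2 tt.
    by rewrite kj h2 addr0.
  have := de0 (d + k); rewrite dek [s (d + k)]linearD /= [(d + k) * _]mulrDl [RHS]mulrDr de0 => /addrI <-.
  by rewrite mulrK // (csU hD).
have dK : (\dim {:D} <= 2 * \dim 'C[j]%VS)%N.
  pose L := amull j + amulr j.
  have LE x : L x = j * x + x * j by rewrite add_lfunE !lfunE.
  have kE : (lker L <= 'C[j])%VS.
    by apply/subvP => x; rewrite memv_ker LE => /eqP /(add2_eq hD) E; exact/cent1vP.
  have iE : (limg L <= lker L)%VS.
    apply/subvP => _ /memv_imgP[x _ ->]; rewrite memv_ker !LE; apply/eqP; nc h2 (jj x).
  have := limg_ker_dim L {:D}; rewrite capfv; have := dimvS kE; have := dimvS iE; lia.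
rewrite /= => H _; exfalso; move: H N4 dK; nia.
Qed.

(** A linear term in the quadratic equation of [y], or of [y * y], can be scaled to an
    Artin-Schreier equation. Without such a term, [y] or [y * y] is a square root of a scalar. *)
Lemma as_or_insep (t : 'End(D)) y : y \in Alt t -> symp t -> ~ scalar y ->
  (quadratic y \/ exists c0 c2 : F, y * y * y * y = c0 *: 1 + c2 *: (y * y) /\ free4 y) ->
  (exists u, artin_schreier u) \/ exists j, [/\ t j = j, ~ scalar j & scalar (j * j)].
Proof.
move=> yA ht yF [[a [b E]]|[c0 [c2 [E f4]]]]; have ty := Alt_sym hD ht yA.
  have [b0|b0] := eqVneq b 0.
    by right; exists y; split=> //; exists a; rewrite E b0 scale0r addr0.
  left; exists (b^-1 *: y); split.
    by move=> [k yk]; apply: yF; exists (b * k); rewrite -scalerA -yk scalerA mulfV // scale1r.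
  exists (b^-1 * b^-1 * a); rewrite -scalerAl -scalerAr E !scalerDr !scalerA.
  by rewrite mulrVK ?unitfE // addrC.
have yyF : ~ scalar (y * y).
  case=> k yk; have [|_ _ /eqP] := f4 k 0 1 0; last by rewrite oner_eq0.
  by rewrite yk !scale0r; nc h2 tt.
have [c20|c20] := eqVneq c2 0.
  right; exists (y * y); split=> //; first by rewrite (proj1 ht.1.1) ty.
  by exists c0; rewrite mulrA E c20 scale0r addr0.
left; exists (c2^-1 *: (y * y)); split.
  by move=> [k yk]; apply: yyF; exists (c2 * k); rewrite -scalerA -yk scalerA mulfV // scale1r.
exists (c2^-1 * c2^-1 * c0); rewrite -scalerAl -scalerAr mulrA E !scalerDr !scalerA.
by rewrite mulrVK ?unitfE // addrC.
Qed.

Definition alt_small := forall (t : 'End(D)) y, symp t -> y \in Alt t -> quadratic y \/ quartic y.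

(** Twisting by [c = j * a + a * j] replaces [a] by an alternating [d = a * c^-1] whose commutator
    with [j] is 1. If [d ^+ 2] is scalar, [j * d] is an Artin-Schreier element; if only [d ^+ 4] is
    scalar, [(j * d) ^+ 2] is one; otherwise a multiple of [d ^+ 2] is. *)
Lemma insep_as (s : 'End(D)) j : alt_small -> symp s -> (4 < \dim {:D})%N ->
  s j = j -> ~ scalar j -> scalar (j * j) -> exists u, artin_schreier u.
Proof.
move=> sm hs N4 sj jF jjF; have [a [aA ja]] := Alt_noncentral hs N4 sj jF jjF.
have his := hs.1; have [[sM s1] ss] := his.
have jj d : j * j * d = d * j * j by rewrite scalarC // mulrA.
pose c := j * a + a * j; have cU := csU hD ja.
have sa := Alt_sym hD hs aA.
have cA : c \in Alt s by apply/AltP; exists (j * a); rewrite sM sj sa.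
have [t [ht tE tA]] := ex_symp_twist his ja cA.
have /AltP[e ae] := aA.
pose d := a * c^-1.
have dA : d \in Alt t by apply/AltP; exists (e * c^-1); rewrite -tA -ae.
have jc : j * c^-1 = c^-1 * j.
  apply: (mulIr cU); rewrite mulrVK //; apply: (mulrI cU); rewrite !mulrA mulrV // mul1r.
  by rewrite /c; nc h2 (jj a).
have jd : j * d = d * j + 1.
  apply: (mulIr cU); rewrite mulrDl mul1r /d.
  have -> : a * c^-1 * j * c = a * j by rewrite -[a * _ * j]mulrA -jc mulrA mulrVK.
  by rewrite mulrA mulrVK // /c; nc h2 tt.
have dF : ~ scalar d.
  by move/scalarC => E; move: jd; rewrite E => /eqP; rewrite -subr_eq0 opprD addrA subrr sub0r oppr_eq0 oner_eq0.
have dF' (x : F) : d != x%:A by apply/eqP => dx; apply: dF; exists x.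
have [jk jjk] := jjF.
have [[k dd]|[c0 [c2 [E f4]]]] := insep_quartic hD (sm _ _ ht dA) dF' (or_introl jd).
  exists (j * d); split.
    move=> /(scalarC j) /= E; have : j * (j * d) + j * d * j = j by nc h2 (jj d, jd).
    by rewrite E h2 => j0; apply: jF; exists 0; rewrite scale0r.
  exists (jk * k); apply: (add2_eq hD); nc h2 (jd, jjk, dd).
have ddF : ~ scalar (d * d).
  case=> x yk; have [|_ _ /eqP] := f4 x 0 1 0; last by rewrite oner_eq0.
  by rewrite yk !scale0r; nc h2 tt.
have [c20|c20] := eqVneq c2 0; last first.
  exists (c2^-1 *: (d * d)); split.
    by move=> [x yk]; apply: ddF; exists (c2 * x); rewrite -scalerA -yk scalerA mulfV // scale1r.
  exists (c2^-1 * c2^-1 * c0); rewrite -scalerAl -scalerAr mulrA E !scalerDr !scalerA.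
  by rewrite mulrVK ?unitfE // addrC.
have E' : d * d * d * d = c0 *: 1 by rewrite E c20 scale0r addr0.
exists (j * d * (j * d)); split.
  move=> /(scalarC j) /= E1; have : j * (j * d * (j * d)) + j * d * (j * d) * j = jk *: 0 + j by nc h2 (jd, jjk).
  rewrite E1 h2 scaler0 add0r => j0; apply: jF; exists 0; by rewrite scale0r.
exists (jk * jk * c0); nc h2 (jd, jjk, E').
Qed.
End ArtinSchreier.

(** * Gradings defined by Artin-Schreier elements *)

Section Graded.
Variables (F : fieldType) (D : falgType F) (hD : csdiv D).
Let h2 := cs2 hD.

Definition flips (x u : D) := x * u = (u + 1) * x.

Lemma flips_neq (x u : D) : x != 0 -> flips x u -> x * u <> u * x.
Proof.
move=> x0 xu E; case/eqP: x0; rewrite -[x]add0r -(h2 (x * u)) {2}E xu; nc h2 tt.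
Qed.

Lemma flips_inv (x u : D) : x != 0 -> flips x u -> flips x^-1 u.
Proof.
move=> x0 xu; have xU := csU hD x0; apply: (mulrI xU); apply: (mulIr xU).
rewrite mulVKr // !mulrA mulrVK // mulrDr mulr1 xu; nc h2 tt.
Qed.

(** The equation of [u] makes [ad u] idempotent, so [D] is the sum of the elements that flip [u] and
    of the centraliser of [u]. This lemma and the next give the two projections. *)
Lemma flips_ad (u y : D) a : u * u = u + a *: 1 -> flips (u * y + y * u) u.
Proof. by move=> uu; rewrite /flips; nc h2 uu. Qed.

Lemma ad_decomp (u y : D) a : u * u = u + a *: 1 ->
  (y + (u * y + y * u)) * u = u * (y + (u * y + y * u)).
Proof. by move=> uu; nc h2 uu. Qed.

Lemma as_graded (u : D) : artin_schreier u -> exists2 x, x != 0 & flips x u.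
Proof.
case=> uF [a uu]; have [y yu] := non_scalar_comm hD uF.
exists (u * y + y * u); last exact: flips_ad uu.
by apply: contraNneq yu => /(add2_eq hD) ->; rewrite eqxx.
Qed.

Lemma comm_inv (x y : D) : x != 0 -> x * y = y * x -> x^-1 * y = y * x^-1.
Proof.
move=> x0 xy; have xU := csU hD x0; apply: (mulrI xU); apply: (mulIr xU).
by rewrite mulVKr // !mulrA mulrVK.
Qed.

(** The double centraliser of [u] in [P]. The element [be = f + x * f * x^-1] measures how
    conjugation by [x] moves [f]; both [be] and [al = f + be * u] commute with [x] and with the
    centraliser of [u], and these generate [P]. *)
Lemma cent_step (P : {aspace D}) (u x f : D) a : u \in P -> u * u = u + a *: 1 -> x \in P ->
  x != 0 -> flips x u -> f \in P -> f * u = u * f ->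
  (forall y, y \in P -> y * u = u * y -> y * f = f * y) ->
  exists al be, [/\ al \in P, be \in P, f = al + be * u,
    forall y, y \in P -> y * al = al * y & forall y, y \in P -> y * be = be * y].
Proof.
move=> uP uu xP x0 xu fP fu fC; have xU := csU hD x0.
have xVP : x^-1 \in P by rewrite memvV.
have VP : flips x^-1 u := flips_inv x0 xu.
pose be := f + x * f * x^-1; pose al := f + be * u.
have P0 : be \in P by rewrite memvD // !memvM.
have E0 : x * u = (u + 1) * x := xu.
have xxf : x * x * f = f * (x * x) by apply: fC; rewrite ?memvM //; nc h2 E0.
have bex : x * be = be * x.
  by rewrite mulrDr mulrDl mulrVK // addrC; congr (_ + _); rewrite !mulrA xxf !mulrA mulrK.
have beu : be * u = u * be.
  rewrite mulrDl mulrDr fu; congr (_ + _).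
  have E1 : x^-1 * u = (u + 1) * x^-1 := VP.
  have E2 : x * u = (u + 1) * x := xu.
  by nc h2 (E1, E2, fu).
have beC y : y \in P -> y * u = u * y -> y * be = be * y.
  move=> yP yu; rewrite mulrDr mulrDl fC //; congr (_ + _).
  pose z := x^-1 * y * x.
  have E1 : x^-1 * u = (u + 1) * x^-1 := VP.
  have E2 : x * u = (u + 1) * x := xu.
  have zf : z * f = f * z by apply: fC; rewrite ?memvM // /z; nc h2 (E1, E2, yu).
  have -> : y * (x * f * x^-1) = x * (z * f) * x^-1 by rewrite /z !mulrA mulrV // mul1r.
  by rewrite zf /z !mulrA mulrK.
have full (c y : D) : (forall y, y \in P -> y * u = u * y -> y * c = c * y) -> x * c = c * x -> y \in P -> y * c = c * y.
  move=> cC xc yP; pose y1 := u * y + y * u; pose y0 := y + y1.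
  have y1P : y1 \in P by rewrite memvD // memvM.
  have y0C : y0 * c = c * y0 by apply: cC; [rewrite memvD | exact: ad_decomp uu].
  have y1u : flips y1 u := flips_ad _ uu.
  have zC : y1 * x^-1 * c = c * (y1 * x^-1).
    apply: cC; first by rewrite memvM.
    have E1 : x^-1 * u = (u + 1) * x^-1 := VP.
    have E2 : y1 * u = (u + 1) * y1 := y1u.
    by nc h2 (E1, E2).
  have -> : y = y0 + y1 * x^-1 * x by rewrite mulrVK // /y0; nc h2 tt.
  by rewrite mulrDl mulrDr y0C -[_ * x * c]mulrA xc mulrA zC !mulrA.
have beC' y : y \in P -> y * be = be * y by apply: full.
exists al, be; split=> //; first by rewrite memvD // memvM.
- by rewrite /al; nc h2 tt.
move=> z zP; apply: (full al z) => // [y yP yu|].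
  have yf := fC y yP yu; have yb := beC' y yP; by rewrite /al; nc h2 (yf, yb, yu).
have E2 : x * u = (u + 1) * x := xu.
have E3 : x * f = be * x + f * x by rewrite /be mulrDl mulrVK //; nc h2 tt.
by rewrite /al; nc h2 (E2, E3, bex).
Qed.

(** Left multiplication by the inverse of one flipping element embeds the image of [ad u] into the
    centraliser, which therefore makes up at least half of [K]. *)
Lemma halve (K : {aspace D}) u a : u * u = u + a *: 1 ->
  (forall y, y \in K -> u * y + y * u \in K) -> (\dim K <= 2 * \dim (K :&: 'C[u])%VS)%N.
Proof.
move=> uu uK; pose L := amull u + amulr u.
have LE x : L x = u * x + x * u by rewrite add_lfunE !lfunE.
have kE : (K :&: lker L <= K :&: 'C[u])%VS.
  apply/subvP => x /memv_capP[xK]; rewrite memv_ker LE => /eqP /(add2_eq hD) E.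
  by apply/memv_capP; split=> //; exact/cent1vP.
have := limg_ker_dim L K; have := dimvS kE.
suff : (\dim (L @: K) <= \dim (K :&: 'C[u]))%N by lia.
have [/eqP -> //|] := boolP (L @: K == 0)%VS; first by rewrite dimv0.
rewrite -vpick0; set y := vpick _ => y0.
have /memv_imgP[y1 y1K yE] : y \in (L @: K)%VS by exact: memv_pick.
have yu : flips y u by rewrite yE LE; exact: flips_ad uu.
have yK : y \in K by rewrite yE LE uK.
rewrite -(dim_cosetv_unit _ (u := y^-1)) ?unitrV ?(csU hD) //; apply: dimvS.
apply/subvP => _ /memv_cosetP[_ /memv_imgP[z zK ->] ->]; rewrite LE.
apply/memv_capP; split; first by rewrite memvM ?uK // memvV.
apply/cent1vP; have E1 : y^-1 * u = (u + 1) * y^-1 by apply: flips_inv.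
have E2 : (u * z + z * u) * u = (u + 1) * (u * z + z * u) by exact: flips_ad uu.
by move: E2; set q := u * z + z * u => E2; nc h2 (E1, E2).
Qed.

(** The element [h = w + s w + 1] satisfies [h * s w = w * h]; when it is zero, [s w = w + 1] and
    [z] can replace it. Twisting [s] by a symmetrised [h] fixes [w], and keeps [U] fixed since [h]
    commutes with [U]. *)
Lemma fix_step (s : 'End(D)) (U : seq D) w z a : invol s -> (forall u, u \in U -> s u = u) ->
  (forall u, u \in U -> u * w = w * u) -> w * w = w + a *: 1 ->
  z != 0 -> flips z w -> (forall u, u \in U -> z * u = u * z) ->
  exists t : 'End(D), invol t /\ forall u, u \in w :: U -> t u = u.
Proof.
move=> hs sU Uw ww z0 zw zU; have [[sM s1] ss] := hs.
have sw2 : s w * s w = s w + a *: 1 by rewrite -sM ww linearD linearZ /= s1.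
have [h [h0 hw hU]] : exists h, [/\ h != 0, h * s w = w * h & forall u, u \in U -> h * u = u * h].
  have [E|E] := eqVneq (w + s w + 1) 0.
    exists z; split=> //; have -> : s w = w + 1.
      by apply: (add2_eq hD); rewrite -E; nc h2 tt.
    by have E2 : z * w = (w + 1) * z := zw; nc h2 E2.
  exists (w + s w + 1); split=> // [|u uU]; first by nc h2 (sw2, ww).
  have Ew := Uw u uU; have Esw : s w * u = u * s w by rewrite -{1}(sU u uU) -sM Ew sM sU.
  by nc h2 (Ew, Esw).
have shw : s h * s w = w * s h by rewrite -sM -hw sM ss.
have shU u : u \in U -> s h * u = u * s h by move=> uU; rewrite -{1}(sU u uU) -sM -hU // sM sU.
have [g [g0 gw gU sg]] : exists g, [/\ g != 0, g * s w = w * g, (forall u, u \in U -> g * u = u * g) & s g = g].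
  have [E|E] := eqVneq (h + s h) 0.
    by exists h; split=> //; rewrite [RHS](add2_eq hD E).
  exists (h + s h); split=> // [|u uU|]; rewrite ?mulrDl ?mulrDr ?hw ?shw ?hU ?shU //.
  by rewrite linearD /= ss addrC.
have [t [ht tE]] := ex_twist hD hs g0 sg; have gUn := csU hD g0.
exists t; split=> // u; rewrite inE tE => /orP[/eqP ->|uU].
  by rewrite gw mulrK.
by rewrite sU // gU // mulrK.
Qed.

(** Twist by [y + s y], which conjugates [U] like [x]. If [x + s x = 0], take [y = u0 * x]: the
    shift of [u0] is 1, so [y + s y = u0 * x + x * u0 = x]. *)
Lemma flip_symp (s : 'End(D)) (U : seq (D * F)) x u0 : invol s ->
  (forall p, p \in U -> s p.1 = p.1) -> x != 0 -> (forall p, p \in U -> x * p.1 = (p.1 + p.2 *: 1) * x) ->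
  (u0, 1) \in U -> (forall p, p \in U -> u0 * p.1 = p.1 * u0) ->
  exists t : 'End(D), symp t /\ forall p, p \in U -> t p.1 = p.1 + p.2 *: 1.
Proof.
move=> hs sU x0 xU u0U u0C; have [[sM s1] ss] := hs.
have [y [yU yn]] : exists y, (forall p, p \in U -> y * p.1 = (p.1 + p.2 *: 1) * y) /\ y + s y != 0.
  have [E|E] := eqVneq (x + s x) 0; last by exists x.
  exists (u0 * x); split=> [p pU|].
    by rewrite -mulrA xU // mulrA mulrDr u0C // mulrDl; nc h2 tt.
  have sx : s x = x by rewrite [RHS](add2_eq hD E).
  rewrite sM sx (sU _ u0U) (xU _ u0U) /=; apply: contraNneq x0 => <-; apply/eqP; nc h2 tt.
have syU p : p \in U -> s y * p.1 = (p.1 + p.2 *: 1) * s y.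
  case: p => r e pU; have yr := yU _ pU; have sr := sU _ pU; rewrite /= in yr sr *.
  rewrite -{1}sr -sM; have -> : r * y = y * r + e *: y by rewrite yr; nc h2 tt.
  by rewrite linearD linearZ /= sM sr; nc h2 tt.
have gA : y + s y \in Alt s by apply/AltP; exists y.
have [t [ht tE _]] := ex_symp_twist hD hs yn gA; have gUn := csU hD yn.
exists t; split=> // p pU.
by rewrite tE (sU p pU) [(y + s y) * p.1]mulrDl (yU p pU) (syU p pU) -mulrDr mulrK.
Qed.
End Graded.

(** * Existence of an Artin-Schreier element in degree 8 *)

Section ExistsAS.
Variables (F : fieldType) (D : falgType F) (hD : csdiv D).
Let h2 := cs2 hD.
Hypothesis d64 : \dim {:D} = 64%N.

Lemma alt_small64 : alt_small D.
Proof.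
move=> t y ht yA; have [tr htr] := ex_trace_form hD.
apply: (quadratic_or_quartic hD htr ht d64 yA).
Qed.

(** An alternating [y] with [T y = T y^-1 = 0] is sought as [x * g^-1], for the involution twisted
    by [g] in [M = F[y0]] and with [x = d + s d]. The first condition reads [tr (d * g^-1) = 0] and
    holds once [d] is orthogonal to [M]; the second is linear in [g], so it has a non-zero solution
    because [M] has dimension at least 2. *)
Lemma ex_artin_schreier64 (s : 'End(D)) : symp s -> exists u : D, artin_schreier u.
Proof.
move=> hs; have [tr htr] := ex_trace_form hD; have [ftr trC _] := htr.
have [kp hkp] := ex_tr_sq hD htr.
have his := hs.1; have [[sM s1] ss] := his.
have dA : (16 <= \dim (Alt s))%N.
  by have := dim_Alt hD his; rewrite d64 => /(_ isT); lia.
have [y0 [y0A y0F]] : exists y0, y0 \in Alt s /\ y0 \notin 1%VS.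
  have [//|h] := EM (exists y0, y0 \in Alt s /\ y0 \notin 1%VS).
  have : (Alt s <= 1)%VS.
    by apply/subvP => y yA; apply/negPn/negP => y1; case: h; exists y.
  by move/dimvS; rewrite dimv1; lia.
pose M := <<1; y0>>%AS.
have MA := adjoin_Alt hD hs y0A.
have Ms := adjoin_fixed hD hs (Alt_sym hD hs y0A).
have [_ /(_ MA)] := Sym_bound hD htr his (K := M) Ms; rewrite d64 => m8.
have m2 : (2 <= \dim M)%N.
  have : (1 + <[y0]> <= M)%VS by rewrite subv_add -!memvE memv_adjoin (asp1 hD).
  move/dimvS; apply: leq_trans; rewrite dimv_disjoint_sum ?dimv1 ?dim_vline.
    by case: eqVneq y0F => // ->; rewrite mem0v.
  apply/eqP; rewrite -subv0; apply/subvP => x; rewrite memv_cap memv0 => /andP[x1 /vlineP[k xk]].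
  have [k0|k0] := eqVneq k 0; first by rewrite xk k0 scale0r.
  by case/negP: y0F; rewrite -[y0](scalerK k0) -xk memvZ.
have m7 : (\dim M < 8)%N by rewrite -(ltn_sqr _ 8).
have [L LE] : exists L : 'End(D), forall d, L d = \sum_(i < \dim M) tr ((vbasis M)`_i * d) *: (vbasis M)`_i.
  apply: ex_linfun => k x y; rewrite scaler_sumr -big_split; apply: eq_bigr => i _ /=.
  by rewrite mulrDr -scalerAr ftr.1 ftr.2 scalerDl scalerA.
have LM : (limg L <= M)%VS.
  apply/subvP => _ /memv_imgP[d _ ->]; rewrite LE; apply: rpred_sum => i _; apply: memvZ.
  by apply: vbasis_mem; rewrite mem_nth // size_tuple.
have Lker d k : d \in lker L -> k \in M -> tr (k * d) = 0.
  rewrite memv_ker LE => /eqP h kM; rewrite (coord_vbasis kM) mulr_suml (funl_sum ftr) big1 // => i _.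
  rewrite -scalerAl ftr.2; have -> := free_seq (basis_free (vbasisP M)) h i; exact: mulr0.
(* The orthogonal of [M] has dimension at least 57 and [Sym s] at most 48, so [s + 1] maps the
   former onto a space of dimension at least 9, too large for [M]. *)
have [d [dL xM]] : exists d, d \in lker L /\ d + s d \notin M.
  have [//|h] := EM (exists d, d \in lker L /\ d + s d \notin M).
  have : ((s + \1%VF) @: lker L <= M)%VS.
    apply/subvP => _ /memv_imgP[d dL ->]; rewrite add_lfunE id_lfunE addrC.
    by apply/negPn/negP => xM; case: h; exists d.
  move/dimvS => a1; have a2 := limg_ker_dim (s + \1%VF) (lker L).
  have a3 : (\dim (lker L :&: lker (s + \1%VF)%R) <= \dim (Sym s))%N by rewrite dimvS // capvSr.
  have a4 := dim_SymAlt s; have a5 := limg_ker_dim L {:D}; rewrite capfv in a5.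
  have a6 := dimvS LM; lia.
pose x := d + s d; have sx : s x = x by rewrite linearD /= ss addrC.
have x0 : x != 0 by apply: contraNneq xM => xx; rewrite -/x xx mem0v.
have xU := csU hD x0.
have [f fE] : exists f : 'Hom(D, F^o), forall k, f k = tr (x^-1 * d * x^-1 * k).
  by apply: ex_linfun => k a b; rewrite mulrDr -scalerAr ftr.1 ftr.2.
have : (M :&: lker f != 0)%VS.
  rewrite -dimv_eq0 -lt0n; have := limg_ker_dim f M; have := dimvS (subvf (f @: M)).
  have -> : \dim {:F^o} = 1%N by rewrite dimvf.
  lia.
rewrite -vpick0; set g := vpick _ => g0; have gU := csU hD g0.
have /memv_capP[gM] : g \in (M :&: lker f)%VS by exact: memv_pick.
rewrite memv_ker fE => /eqP gf.
have gA := subvP MA _ gM; have gs : s g = g := Ms _ gM.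
have [t [ht tE tA]] := ex_symp_twist hD his g0 gA.
have [T hT] := ex_pfaffian_trace hD htr hkp ht.
pose y := x * g^-1.
have yA : y \in Alt t by apply/AltP; exists (d * g^-1); rewrite -tA.
have yF : ~ scalar y.
  case=> a ya; case/negP: xM; rewrite -/x -[x](mulrVK gU) -/y ya -scalerAl mul1r memvZ //.
have yF' (a : F) : y != a%:A by apply/eqP => ya; apply: yF; exists a.
have Ty : T y = 0.
  rewrite /y tA; case: hT => _ -> _; rewrite trC; apply: Lker => //; by rewrite memvV.
have TVy : T y^-1 = 0.
  have -> : y^-1 = g * x^-1 * d * x^-1 + t (g * x^-1 * d * x^-1).
    have -> : y^-1 = g * x^-1 by rewrite /y invrM ?unitrV // invrK.
    rewrite tE !sM (anti_inv hD his.1 x0) sx gs.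
    have -> : g * (x^-1 * (s d * (x^-1 * g))) * g^-1 = g * x^-1 * s d * x^-1 by rewrite !mulrA mulrK.
    by rewrite -mulrDl -mulrDr -/x mulrVK.
  case: hT => _ -> _; rewrite -[RHS]gf [RHS]trC !mulrA //.
have := pfaffian_quartic hD htr ht hT d64 yA yF' Ty TVy.
move/(as_or_insep hD yA ht yF) => [//|[j [tj jF jj]]].
by refine (insep_as hD htr alt_small64 ht _ tj jF jj); rewrite d64.
Qed.

Section Core.
Variables (u : D) (s : 'End(D)) (hs : symp s).
Let his : invol s. Proof. by case: hs. Qed.
Let sM x y : s (x * y) = s y * s x. Proof. by case: his => -[]. Qed.
Variables (C0 : {aspace D}) (D1 : {vspace D}).
Hypothesis D1u : forall d, d \in D1 -> flips d u.
Hypothesis sD1 : forall d, d \in D1 -> s d \in D1.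
Hypothesis C01 : forall c d, c \in C0 -> d \in D1 -> c * d \in D1.
Hypothesis D11 : forall c d, c \in D1 -> d \in D1 -> c * d \in C0.
Hypothesis D10 : forall c d, c \in D1 -> d \in C0 -> c * d \in D1.
Hypothesis uC0 : u \in C0.
Hypothesis W0 : exists x, [/\ x \in Alt s, x \in D1 & x != 0].
Hypothesis Wz : forall z, s z = z -> (forall c, c \in C0 \/ c \in D1 -> c * z = z * c) -> scalar z.
Hypothesis W4 : forall x, x \in Alt s -> x \in D1 -> scalar (x * x * x * x).

(* [cube x] is the third power of [ad x], the part linear in [d] of [(x + d) ^+ 4]. *)
Definition cube (x d : D) := x * x * x * d + x * x * d * x + x * d * x * x + d * x * x * x.

(** The coefficient of [c] in [(x + c *: x') ^+ 4] is isolated from the values at 1, [c] and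
    [c + 1]. Over the field of two elements there is no such [c], but then the non-zero scalar
    [x ^+ 4] is 1, which forces [x = 1], and 1 flips nothing. *)
Lemma cube_scalar x x' : x \in Alt s -> x \in D1 -> x != 0 -> x' \in Alt s -> x' \in D1 ->
  scalar (cube x x').
Proof.
move=> xA xD x0 xA' xD'.
have S (c : F) : (x + c *: x') * (x + c *: x') * (x + c *: x') * (x + c *: x') \in 1%VS.
  by apply/line1P; apply: W4; rewrite memvD // memvZ.
have S0 : x * x * x * x \in 1%VS by apply/line1P; exact: W4.
have S1 : x' * x' * x' * x' \in 1%VS by apply/line1P; exact: W4.
pose B := x * x * x' * x' + x * x' * x * x' + x * x' * x' * x + x' * x * x * x' + x' * x * x' * x + x' * x' * x * x.
pose C := x' * x' * x' * x + x' * x' * x * x' + x' * x * x' * x' + x * x' * x' * x'.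
have R (c : F) : c != 0 -> cube x x' + c *: B + (c * c) *: C \in 1%VS.
  move=> c0; rewrite -[X in X \in _](scalerK c0); apply: memvZ.
  have -> : c *: (cube x x' + c *: B + (c * c) *: C) = (x + c *: x') * (x + c *: x') * (x + c *: x') * (x + c *: x') +
     x * x * x * x + (c * c * c * c) *: (x' * x' * x' * x') by rewrite /cube /B /C; nc h2 tt.
  by rewrite !memvD // memvZ.
have [[c [c0 c1]]|noc] := EM (exists c : F, c != 0 /\ c != 1).
  have c10 : c + 1 != 0 by rewrite -(inj_eq (addIr 1)) -addrA (csF2 hD) addr0 add0r.
  have R1 := R 1 (oner_neq0 F); have Rc := R c c0; have Rc1 := R (c + 1) c10.
  apply/line1P; have -> : cube x x' = (cube x x' + 1 *: B + (1 * 1) *: C) + ((cube x x' + c *: B + (c * c) *: C) +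
    (cube x x' + (c + 1) *: B + ((c + 1) * (c + 1)) *: C)) by nc h2 tt.
  by apply: memvD => //; apply: memvD.
exfalso; have /line1P [c xc] := S0.
have [c0|c0] := eqVneq c 0.
  move: xc; rewrite c0 scale0r -mulrA => /(cs_mul0 hD)[]/(cs_mul0 hD)[] xx; by rewrite xx eqxx in x0.
have c1 : c = 1 by apply/eqP; apply: contra_notT noc => c1; exists c.
have E : (x + 1) * (x + 1) * ((x + 1) * (x + 1)) = 0.
  have -> : (x + 1) * (x + 1) * ((x + 1) * (x + 1)) = x * x * x * x + 1 by nc h2 tt.
  by rewrite xc c1 scale1r h2.
have xE : x = 1 by apply: (add2_eq hD); case/(cs_mul0 hD): E => /(cs_mul0 hD)[].
apply: (flips_neq hD x0 (D1u xD)); by rewrite xE mul1r mulr1.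
Qed.

(** Since [x ^+ 4] is scalar, the fourth power of [ad x] is zero, so the centraliser of [x] has at
    least a quarter of the dimension. Polarising [x ^+ 4], or [x ^+ 2] when all squares are scalar,
    gives a [z0] commuting with [x] such that [b * z0 + s (b * z0)] is scalar for every [b] in [C0]
    commuting with [x]; replacing [b] by [b * z0^-1] removes [z0]. *)
Lemma core : exists x, [/\ x \in Alt s, x \in D1, x != 0, (forall b, b \in C0 -> b * x = x * b -> scalar (b + s b)) &
  (16 <= \dim 'C[x]%VS)%N].
Proof.
have key x z0 : x \in Alt s -> x \in D1 -> x != 0 -> z0 \in C0 -> z0 != 0 -> z0 * x = x * z0 ->
    (forall b, b \in C0 -> b * x = x * b -> scalar (b * z0 + s (b * z0))) ->
    exists x, [/\ x \in Alt s, x \in D1, x != 0, (forall b, b \in C0 -> b * x = x * b -> scalar (b + s b)) & (16 <= \dim 'C[x]%VS)%N].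
  move=> xA xD x0 zC z0n zx h; exists x; split=> //.
    move=> b bC bx; rewrite -[b](mulrVK (csU hD z0n)); apply: h; first by rewrite memvM // memvV.
    by have E := comm_inv hD z0n zx; nc h2 (bx, E).
  pose L := amull x + amulr x.
  have LE y : L y = x * y + y * x by rewrite add_lfunE !lfunE.
  have [k xk] := W4 xA xD.
  have L4 y : L (L (L (L y))) = 0.
    rewrite !LE; apply: etrans (h2 (k *: y)).
    have -> : k *: y + k *: y = (k *: 1) * y + y * (k *: 1) by nc h2 tt.
    by rewrite -xk; nc h2 tt.
  have kE : (lker L <= 'C[x])%VS.
    by apply/subvP => y; rewrite memv_ker LE => /eqP /(add2_eq hD) E; exact/cent1vP.
  have dk := dimvS kE.
  have st (V : {vspace D}) : (\dim V <= \dim (L @: V) + \dim 'C[x])%N.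
    have := limg_ker_dim L V; have : (\dim (V :&: lker L) <= \dim (lker L))%N by rewrite dimvS // capvSr.
    lia.
  have := st {:D}%VS; have := st (L @: {:D})%VS; have := st (L @: (L @: {:D}))%VS; have := st (L @: (L @: (L @: {:D})))%VS.
  have -> : (L @: (L @: (L @: (L @: {:D}))) = 0)%VS.
    apply/eqP; rewrite -subv0; apply/subvP => y /memv_imgP[y1 /memv_imgP[y2 /memv_imgP[y3 /memv_imgP[y4 _ ->] ->] ->] ->].
    by rewrite L4 mem0v.
  rewrite dimv0 d64; lia.
have [[x [xA xD x0 x2]]|nx] := EM (exists x, [/\ x \in Alt s, x \in D1, x != 0 & ~ scalar (x * x)]).
  have xE : x * u = (u + 1) * x := D1u xD.
  have sx : s x = x := Alt_sym hD hs xA.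
  have [k x4] := W4 xA xD.
  (* If [cube x] vanished on [D1] it would vanish on [C0] too, and comparing its values at [d * u]
     and [d] would make [x * x] commute with both. *)
  have [d0 [d0D d0n]] : exists d0, d0 \in D1 /\ cube x d0 != 0.
    have [//|h] := EM (exists d0, d0 \in D1 /\ cube x d0 != 0).
    have c1 d : d \in D1 -> cube x d = 0.
      by move=> dD; apply/eqP; apply: contra_notT h => h; exists d.
    have c0 d : d \in C0 -> cube x d = 0.
      move=> dC; have := c1 _ (C01 dC xD).
      have -> : cube x (d * x) = cube x d * x by rewrite /cube !mulrDl !mulrA.
      by case/(cs_mul0 hD) => // xx; rewrite xx eqxx in x0.
    have c01 d : d \in C0 \/ d \in D1 -> cube x d = 0 by case; [exact: c0|exact: c1].
    case: x2; apply: Wz; first by rewrite sM sx.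
    move=> d dC; have dC' : d * u \in C0 \/ d * u \in D1.
      by case: dC => dC; [left; rewrite memvM | right; apply: D10].
    have := c01 _ dC'; have := c01 _ dC => E1 E2; apply: (add2_eq hD); apply: (cs_mulIr hD x0).
    rewrite mul0r -[RHS]E2; apply: (add2_eq hD); rewrite -[RHS](mul0r u) -[in RHS]E1 /cube.
    by nc h2 xE.
  apply: (key x (cube x d0)) => //.
  - have m1 y z : y \in D1 -> z \in D1 -> y * z \in C0 by exact: D11.
    have m2 y1 y2 y3 y4 : y1 \in D1 -> y2 \in D1 -> y3 \in D1 -> y4 \in D1 -> y1 * y2 * y3 * y4 \in C0.
      by move=> *; rewrite -mulrA memvM // D11.
    by rewrite /cube !memvD // m2.
  - apply: (add2_eq hD).
    have -> : cube x d0 * x + x * cube x d0 = (x * x * x * x) * d0 + d0 * (x * x * x * x) by rewrite /cube; nc h2 tt.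
    by rewrite x4; nc h2 tt.
  move=> b bC bx; have bd : b * d0 \in D1 by exact: C01.
  have -> : b * cube x d0 = cube x (b * d0) by rewrite /cube; nc h2 bx.
  have -> : cube x (b * d0) + s (cube x (b * d0)) = cube x (b * d0 + s (b * d0)).
    by rewrite /cube !linearD /= !sM sx; nc h2 tt.
  by apply: cube_scalar => //; [apply/AltP; exists (b * d0) | rewrite memvD // sD1].
have [x [xA xD x0]] := W0.
have xs y : y \in Alt s -> y \in D1 -> scalar (y * y).
  move=> yA yD; have [->|y0] := eqVneq y 0; first by exists 0; rewrite mul0r scale0r.
  by have [//|h] := EM (scalar (y * y)); case: nx; exists y.
have xE : x * u = (u + 1) * x := D1u xD.
have sx : s x = x := Alt_sym hD hs xA.
apply: (key x (x * x)) => //; [exact: D11 | exact: cs_mul_neq0 | by rewrite mulrA|].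
(* The factor [u] makes [x * d + d * x] equal to [b * (x * x)], because [x] flips [u]. *)
move=> b bC bx; pose d := b * u * x.
have dD : d \in D1 by rewrite /d C01 // memvM.
have -> : b * (x * x) + s (b * (x * x)) = (x + (d + s d)) * (x + (d + s d)) + x * x + (d + s d) * (d + s d).
  have -> : b * (x * x) = x * d + d * x by have xb := esym bx; rewrite /d; nc h2 (xE, xb).
  by rewrite linearD /= !sM sx; nc h2 tt.
have dA : d + s d \in Alt s by apply/AltP; exists d.
have dD' : d + s d \in D1 by rewrite memvD // sD1.
apply/line1P; apply: memvD; first apply: memvD.
- by apply/line1P; apply: xs; rewrite memvD.
- by apply/line1P; apply: xs.
by apply/line1P; apply: xs.
Qed.
End Core.
End ExistsAS.

(** * Triquadratic subfields *)

Section Triquadratic.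
Variables (F : fieldType) (D : falgType F) (hD : csdiv D).
Let h2 := cs2 hD.

Definition flipv (u : D) : {vspace D} := lker (amulr u - amull (u + 1)).

Lemma flipvP u x : reflect (flips x u) (x \in flipv u).
Proof.
rewrite memv_ker add_lfunE opp_lfunE !lfunE /= subr_eq0.
exact: (iffP eqP).
Qed.

Lemma in_cap (U V : {vspace D}) x : x \in U -> x \in V -> x \in (U :&: V)%VS.
Proof. by rewrite memv_cap => -> ->. Qed.

(** [x + x1] is the component of [x] that commutes with [v]. When it is zero, [x1] equals [x] and
    flips [v], as [g] does, so [x1 * g] commutes with [v]. Other shifts persist. *)
Lemma commute_adjust (x v g : D) b : v * v = v + b *: 1 -> x != 0 -> g != 0 -> flips g v ->
  exists x', [/\ x' != 0, x' * v = v * x' & forall t (e : F), t * v = v * t -> g * t = t * g ->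
    x * t = (t + e *: 1) * x -> x' * t = (t + e *: 1) * x'].
Proof.
move=> vv x0 g0 gv; pose x1 := v * x + x * v.
have gv' : g * v = (v + 1) * g := gv.
have [E|E] := eqVneq (x + x1) 0; last first.
  by exists (x + x1); split=> // [|t e tv gt xt]; rewrite /x1; [nc h2 vv | have vt := esym tv; nc h2 (vt, xt)].
have x1n : x1 != 0 by apply: contraNneq x0 => x1E; rewrite x1E addr0 in E; rewrite E.
exists (x1 * g); split=> [||t e tv gt xt]; first exact: cs_mul_neq0.
  by rewrite /x1; nc h2 (vv, gv').
by have vt := esym tv; rewrite /x1; nc h2 (vt, xt, gt).
Qed.

Lemma full_cent_scalar (u x f : D) a : u * u = u + a *: 1 -> x != 0 -> flips x u -> f * u = u * f ->
  (forall y, y * u = u * y -> y * f = f * y) -> exists al be : F, f = al *: 1 + be *: u.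
Proof.
move=> uu x0 xu fu fC.
have [al [be [_ _ -> alC beC]]] :=
  cent_step hD (P := {:D}%AS) (memvf u) uu (memvf x) x0 xu (memvf f) fu (fun y _ => fC y).
have [k ->] := csC hD (z := al) (fun y => alC y (memvf y)).
have [l ->] := csC hD (z := be) (fun y => beC y (memvf y)).
by exists k, l; rewrite -scalerAl mul1r.
Qed.

Lemma algid_in (K L : {aspace D}) : algid K \in L.
Proof. by rewrite (skew_field_algid1 (csU hD)) asp1. Qed.

Lemma proper_asp_dim (K L : {aspace D}) x : (K <= L)%VS -> x \in L -> x \notin K ->
  (2 * \dim K <= \dim L)%N.
Proof.
move=> KL xL xK; have /dvdnP[q qd] := skew_field_dimS (csU hD) KL.
case: q qd => [|[|q]] qd; last by rewrite qd leq_mul2r orbT.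
  by have := adim_gt0 L; rewrite /= qd.
have : (K == L :> {vspace D})%VS by rewrite eqEdim KL qd mul1n leqnn.
by move/eqP => E; move: xK; rewrite -[x \in K]/(x \in (K : {vspace D})) E [x \in _]xL.
Qed.

Lemma Sym_scalar_dim (s : 'End(D)) (B : {vspace D}) : (forall b, b \in B -> scalar (b + s b)) ->
  (\dim B <= \dim (B :&: Sym s) + 1)%N.
Proof.
move=> hB; have : ((s + \1%VF) @: B <= 1)%VS.
  apply/subvP => _ /memv_imgP[b bB ->]; rewrite add_lfunE id_lfunE addrC.
  exact/line1P/hB.
move/dimvS; rewrite dimv1 => le1; rewrite -(limg_ker_dim (s + \1%VF) B).
by rewrite leq_add2l.
Qed.

(* An involution moving every element of [B] by a scalar makes symmetric elements central,
   because their inner derivations have rank at most 2. *)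
Lemma Sym_scalar_central (s : 'End(D)) (B : {aspace D}) d b : invol s -> (forall b, b \in B -> scalar (b + s b)) ->
  (4 < \dim B)%N -> d \in B -> s d = d -> b \in B -> d * b = b * d.
Proof.
move=> hs hB B4 dB sd bB; apply/eqP/negPn/negP => dbn; have [[sM s1] ss] := hs.
pose K := aspace_cap (algid_in B 'C[d]%AS).
have KB : (K <= B)%VS by exact: capvSl.
have bK : b \notin K by apply/negP => /memv_capP[_ /cent1vP E]; rewrite E eqxx in dbn.
have := proper_asp_dim KB bB bK.
pose L := amull d + amulr d.
have LE x : L x = d * x + x * d by rewrite add_lfunE !lfunE.
have kE : (B :&: lker L <= K)%VS.
  apply/subvP => y /memv_capP[yB]; rewrite memv_ker LE => /eqP /(add2_eq hD) E.
  by apply: in_cap => //; exact/cent1vP.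
have iE : (L @: B <= 1 + <[d]>)%VS.
  apply/subvP => _ /memv_imgP[x xB ->]; rewrite LE.
  have [k hk] := hB x xB; have [l hl] := hB _ (memvM dB xB).
  have -> : d * x + x * d = l *: 1 + k *: d.
    have -> : k *: d = (k *: 1) * d by nc h2 tt.
    by rewrite -hl -hk sM sd; nc h2 tt.
  by apply: memv_add; [apply/line1P; exists l | apply/vlineP; exists k].
have a1 := limg_ker_dim L B; have a2 := dimvS kE; have a3 := dimvS iE.
have a4 : (\dim (1 + <[d]>) <= 2)%N.
  apply: leq_trans (dimv_add_leqif _ _) _; rewrite dimv1 dim_vline.
  by case: (d != 0).
move=> a5; have a6 := leq_trans a3 a4; move: a1 a2 a5 a6 B4; lia.
Qed.

(** Otherwise [s] is the identity on all elements that flip [u]. Its twist by one of them is the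
    identity on the centraliser of [u], which has half the dimension of [D] and violates
    [Sym_bound]. *)
Lemma ex_graded_alt (u : D) a (s : 'End(D)) : u * u = u + a *: 1 -> ~ scalar u -> symp s -> s u = u + 1 ->
  (4 < \dim {:D})%N -> exists x, [/\ x \in Alt s, x \in flipv u & x != 0].
Proof.
move=> uu uF hs su d4; have his := hs.1; have [[sM s1] ss] := his.
have [tr htr] := ex_trace_form hD.
have [x0 x0n x0u] : exists2 x, x != 0 & flips x u by apply: as_graded => //; split=> //; exists a.
have sD1 d : d \in flipv u -> s d \in flipv u.
  move=> /flipvP du; apply/flipvP; have E : d * u = (u + 1) * d := du.
  have := congr1 s E; rewrite !sM linearD /= s1 su => E2; rewrite /flips E2; nc h2 tt.
have dC : (\dim {:D} <= 2 * \dim 'C[u]%VS)%N.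
  by have := halve hD (K := {:D}%AS) uu (fun y _ => memvf _); rewrite /= capfv.
have [//|h] := EM (exists x, [/\ x \in Alt s, x \in flipv u & x != 0]).
have sid d : d \in flipv u -> s d = d.
  move=> dD; apply/esym; apply: (add2_eq hD); apply/eqP; apply: contra_notT h => dn.
  by exists (d + s d); split=> //; [apply/AltP; exists d | rewrite memvD // sD1].
have sx0 : s x0 = x0 by apply: sid; exact/flipvP.
have [t [ht tE]] := ex_twist hD his x0n sx0.
have [] := Sym_bound hD htr ht (K := 'C[u]%AS).
  move=> d /cent1vP du; rewrite tE.
  have : s (d * x0) = d * x0.
    by apply: sid; apply/flipvP; have E : x0 * u = (u + 1) * x0 := x0u; rewrite /flips; nc h2 (du, E).
  by rewrite sM sx0 => ->; rewrite mulrK // (csU hD).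
by move: dC d4; rewrite /=; move: (\dim _) (\dim _) => n m; nia.
Qed.

Hypothesis d64 : \dim {:D} = 64%N.

(** Since [u * x = x * u + x], the minimal polynomial of [x] is even; as [x ^+ 4] is not scalar,
    [x * x] satisfies a separable quadratic equation. *)
Lemma quartic_as (s : 'End(D)) x u : symp s -> x \in Alt s -> x != 0 -> flips x u -> ~ scalar (x * x * x * x) ->
  exists v b, [/\ v * v = v + b *: 1, exists k, v = k *: (x * x) & ~ scalar v].
Proof.
move=> hs xA x0 xu x4.
have xu' : x * u = (u + 1) * x := xu.
have xF (k : F) : x != k%:A.
  apply/eqP => xk; apply: (flips_neq hD x0 xu); by apply: scalarC; exists k.
have [|[k x2]|[c0 [c2 [E f4]]]] := insep_quartic hD (alt_small64 hD d64 hs xA) xF (j := u) (or_intror _).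
- by nc h2 xu'.
- by case: x4; exists (k * k); rewrite -mulrA x2; nc h2 tt.
have [c20|c20] := eqVneq c2 0; first by case: x4; exists c0; rewrite E c20 scale0r addr0.
exists (c2^-1 *: (x * x)), (c2^-1 * c2^-1 * c0); split; last 2 first.
- by exists c2^-1.
- move=> [k xk]; have [|_ _ /eqP] := f4 (c2 * k) 0 1 0; last by rewrite oner_eq0.
  by rewrite -scalerA -xk scalerA mulfV // !scale0r; nc h2 tt.
rewrite -scalerAl -scalerAr mulrA E !scalerDr !scalerA.
by rewrite mulrVK ?unitfE // addrC.
Qed.

(** A multiple of [x ^+ 2] works when some alternating [x] flips [u] and has a non-scalar fourth
    power. If there is none, [core] gives [x] such that [s] moves the elements of [B], the
    centraliser of [x] and [u], by scalars only. If [s] fixes [B], it fixes the centraliser of [x],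
    which is too large. If some [b1 + s b1] is a scalar [k1 != 0], then
    [k1 *: d = d * b1 + s (d * b1)] makes every symmetric [d] of [B] scalar, whence
    [\dim B <= 2]. *)
Lemma ex_second_as (u : D) a (s : 'End(D)) : u * u = u + a *: 1 -> ~ scalar u -> symp s -> s u = u + 1 ->
  exists v b, [/\ v * v = v + b *: 1, v * u = u * v & forall al be : F, v <> al *: 1 + be *: u].
Proof.
move=> uu uF hs su; have his := hs.1; have [[sM s1] ss] := his.
have [tr htr] := ex_trace_form hD.
have [x0 x0n x0u] : exists2 x, x != 0 & flips x u by apply: as_graded => //; split=> //; exists a.
have sD1 d : d \in flipv u -> s d \in flipv u.
  move=> /flipvP du; apply/flipvP; have E : d * u = (u + 1) * d := du.
  have := congr1 s E; rewrite !sM linearD /= s1 su => E2; rewrite /flips E2; nc h2 tt.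
have [[x [xA xD x0' x4]]|nx] := EM (exists x, [/\ x \in Alt s, x \in flipv u, x != 0 & ~ scalar (x * x * x * x)]).
  have /flipvP xu := xD; have xu' : x * u = (u + 1) * x := xu.
  have [v [b [vv [k vk] vF]]] := quartic_as hs xA x0' xu x4.
  exists v, b; split=> //; first by rewrite vk; nc h2 xu'.
  move=> al be vE; have xv : x * v = v * x by rewrite vk -scalerAl -scalerAr mulrA.
  have : be *: x = 0 by rewrite -[RHS](h2 (x * v)) {2}xv vE; nc h2 xu'.
  move/eqP; rewrite scaler_eq0 (negbTE x0') orbF => /eqP be0.
  by apply: vF; exists al; rewrite vE be0 scale0r addr0.
exfalso.
have [x [xA /flipvP xu x0' hB dx]] : exists x, [/\ x \in Alt s, x \in flipv u, x != 0,
    (forall b, b \in 'C[u]%AS -> b * x = x * b -> scalar (b + s b)) & (16 <= \dim 'C[x]%VS)%N].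
  apply: (core hD d64 (u := u) hs (C0 := 'C[u]%AS) (D1 := flipv u)).
  - by move=> d /flipvP.
  - exact: sD1.
  - move=> c d /cent1vP cu /flipvP du; apply/flipvP; have E : d * u = (u + 1) * d := du.
    by rewrite /flips; nc h2 (cu, E).
  - move=> c d /flipvP cu /flipvP du; apply/cent1vP; have E1 : c * u = (u + 1) * c := cu.
    by have E : d * u = (u + 1) * d := du; nc h2 (E1, E).
  - move=> c d /flipvP cu /cent1vP du; apply/flipvP; have E1 : c * u = (u + 1) * c := cu.
    by rewrite /flips; nc h2 (E1, du).
  - exact: cent1v_id.
  - by apply: (ex_graded_alt uu uF hs su); rewrite d64.
  - move=> z sz zC; apply: (csC hD) => y; rewrite -[y](addrK (u * y + y * u)) (char2_opp h2).
    rewrite mulrDl mulrDr !zC //; [right; apply/flipvP; exact: flips_ad uu | left; apply/cent1vP; exact: ad_decomp uu].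
  - move=> x xA xD; have [->|x0'] := eqVneq x 0; first by exists 0; rewrite !mul0r scale0r.
    by have [//|h] := EM (scalar (x * x * x * x)); case: nx; exists x.
have xu' : x * u = (u + 1) * x := xu.
have sx : s x = x := Alt_sym hD hs xA.
pose B := ('C[x] :&: 'C[u])%VS.
have BP y : y \in B <-> y * x = x * y /\ y * u = u * y.
  split=> [/memv_capP[/cent1vP yx /cent1vP yu] //|[yx yu]]; apply: in_cap; exact/cent1vP.
have hB' b : b \in B -> scalar (b + s b).
  by move=> /BP[bx bu]; apply: hB => //; apply/cent1vP.
have dB : (8 <= \dim B)%N.
  have := halve hD (K := 'C[x]%AS) uu _; rewrite /= -/B => H.
  have : (\dim 'C[x] <= 2 * \dim B)%N.
    by apply: H => y /cent1vP /esym yx; apply/cent1vP; nc h2 (yx, xu').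
  lia.
pose BA := aspace_cap (algid_in 'C[x]%AS 'C[u]%AS).
have dS := Sym_scalar_dim hB'.
have symC d b : d \in (B :&: Sym s)%VS -> b \in B -> d * b = b * d.
  move=> /memv_capP[dB' /(SymP hD) sd] bB; apply: (Sym_scalar_central (s := s) (B := BA)) => //.
  exact: leq_trans dB.
have [[b1 [b1B b1n]]|nob] := EM (exists b1, b1 \in B /\ b1 + s b1 != 0); last first.
  have sB b : b \in B -> s b = b.
    by move=> bB; apply/esym/(add2_eq hD)/eqP; apply: contra_notT nob => h; exists b.
  have [] := Sym_bound hD htr his (K := 'C[x]%AS).
    move=> y /cent1vP yx; rewrite -[y](addrK (u * y + y * u)) (char2_opp h2).
    set y1 := u * y + y * u; have xV := comm_inv hD x0' (erefl (x * x)).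
    have y1x : y1 * x = x * y1 by have xy := esym yx; rewrite /y1; nc h2 (xy, xu').
    have y0B : y + y1 \in B.
      apply/BP; split; last exact: ad_decomp uu.
      by rewrite mulrDl mulrDr yx y1x.
    have y1B : y1 * x^-1 \in B.
      apply/BP; split; first by rewrite mulrVK ?(csU hD) // mulrA -y1x mulrK // (csU hD).
      have E1 : x^-1 * u = (u + 1) * x^-1 := flips_inv hD x0' xu.
      have E2 : y1 * u = (u + 1) * y1 by exact: flips_ad uu.
      by nc h2 (E1, E2).
    have sy1 : s y1 = y1.
      have /BP[yx' _] := y1B.
      by rewrite -{1}(mulrVK (csU hD x0') y1) sM sx (sB _ y1B) -yx' mulrVK // (csU hD).
    by rewrite linearD /= (sB _ y0B) sy1.
  by rewrite d64 /= => dx2 _; move: dx2 dx; rewrite -[X in (_ <= X)%N]/(8 ^ 2)%N leq_sqr; lia.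
have [k1 hk1] := hB' _ b1B.
have : (B :&: Sym s <= 1)%VS.
  apply/subvP => d dS'; have /memv_capP[dB' /(SymP hD) sd] := dS'.
  have dbB : d * b1 \in B by exact: (memvM (A := BA)).
  have [k hk] := hB' _ dbB.
  have k1n : k1 != 0 by apply: contraNneq b1n => k10; rewrite hk1 k10 scale0r.
  have E : k1 *: d = k *: 1.
    rewrite -hk sM sd; have E := symC d b1 dS' b1B.
    have -> : k1 *: d = (k1 *: 1) * d by nc h2 tt.
    by rewrite -hk1; nc h2 E.
  by apply/line1P; exists (k1^-1 * k); rewrite -scalerA -E scalerA mulVf // scale1r.
move/dimvS; rewrite dimv1; lia.
Qed.

(** The dichotomy of [ex_second_as] inside the centraliser of [v]. Here [s v = v + 1], so [v] plays
    the part of [b1]: a symmetric [d] of [B] equals [d * v + s (d * v)] and is scalar. *)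
Lemma ex_third_as (u v : D) a b (s : 'End(D)) y0 x0 : u * u = u + a *: 1 -> v * v = v + b *: 1 -> v * u = u * v ->
  y0 != 0 -> flips y0 v -> y0 * u = u * y0 -> x0 != 0 -> flips x0 u -> x0 * v = v * x0 ->
  symp s -> s u = u -> s v = v + 1 ->
  exists w c, [/\ w * w = w + c *: 1, w * u = u * w, w * v = v * w &
    forall al be ga de : F, w <> al *: 1 + be *: u + ga *: v + de *: (u * v)].
Proof.
move=> uu vv vu y0n y0v y0u x0n x0u x0v hs su sv; have his := hs.1; have [[sM s1] ss] := his.
have [tr htr] := ex_trace_form hD.
pose D1 := (flipv u :&: 'C[v])%VS.
have D1P d : d \in D1 <-> d * u = (u + 1) * d /\ d * v = v * d.
  split=> [/memv_capP[/flipvP du /cent1vP dv] //|[du dv]]; apply: in_cap; [exact/flipvP|exact/cent1vP].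
pose C0 := aspace_cap (algid_in 'C[u]%AS 'C[v]%AS).
have C0P d : d \in C0 <-> d * u = u * d /\ d * v = v * d.
  split=> [/memv_capP[/cent1vP du /cent1vP dv] //|[du dv]]; apply: in_cap; exact/cent1vP.
have sD1 d : d \in D1 -> s d \in D1.
  move=> /D1P[du dv]; apply/D1P.
  have := congr1 s dv; have := congr1 s du; rewrite !sM linearD /= s1 su sv => E1 E2.
  have E1' : u * s d = s d * u + s d by rewrite E1; nc h2 tt.
  have E2' : s d * v = s d + (v + 1) * s d by rewrite E2; nc h2 tt.
  by split; [nc h2 E1' | rewrite E2'; nc h2 tt].
have vF (e g : F) : e *: 1 + g *: v = 0 -> g = 0.
  move=> E; have : g *: y0 = 0.
    have -> : g *: y0 = y0 * (e *: 1 + g *: v) + (e *: 1 + g *: v) * y0.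
      by have E0 : y0 * v = (v + 1) * y0 := y0v; nc h2 E0.
    by rewrite E mulr0 mul0r addr0.
  by move/eqP; rewrite scaler_eq0 (negbTE y0n) orbF => /eqP.
have [[x [xA xD x0' x4]]|nx] := EM (exists x, [/\ x \in Alt s, x \in D1, x != 0 & ~ scalar (x * x * x * x)]).
  have /D1P[xu xv] := xD.
  have [w [c [ww [k wk] wF]]] := quartic_as hs xA x0' xu x4.
  exists w, c; split=> //; [by rewrite wk; nc h2 xu | by rewrite wk; nc h2 xv|].
  move=> al be ga de wE; have xw : x * w = w * x by rewrite wk -scalerAl -scalerAr mulrA.
  have : (be *: 1 + de *: v) * x = 0.
    by rewrite -[RHS](h2 (x * w)) {2}xw wE; have uv := esym vu; nc h2 (xu, xv, vu).
  case/(cs_mul0 hD) => [E|xx]; last by rewrite xx eqxx in x0'.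
  have de0 := vF _ _ E; move: E; rewrite de0 scale0r addr0 => /eqP.
  rewrite scaler_eq0 oner_eq0 orbF => /eqP be0.
  have wE' : w = al *: 1 + ga *: v by rewrite wE de0 be0 !scale0r !addr0.
  have sw : s w = w by rewrite wk linearZ /= sM (Alt_sym hD hs xA).
  have ga0 : ga = 0.
    move: sw; rewrite wE' linearD !linearZ /= s1 sv => /eqP; rewrite -subr_eq0 => /eqP E.
    have /eqP : ga *: (1 : D) = 0 by rewrite -[RHS]E; nc h2 tt.
    by rewrite scaler_eq0 oner_eq0 orbF => /eqP.
  by apply: wF; exists al; rewrite wE' ga0 scale0r addr0.
exfalso.
have [x [xA xD x0' hB dx]] : exists x, [/\ x \in Alt s, x \in D1, x != 0,
    (forall b, b \in C0 -> b * x = x * b -> scalar (b + s b)) & (16 <= \dim 'C[x]%VS)%N].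
  apply: (core hD d64 (u := u) hs (C0 := C0) (D1 := D1)).
  - by move=> d /D1P[].
  - exact: sD1.
  - move=> c d /C0P[cu cv] /D1P[du dv]; apply/D1P; split; [nc h2 (cu, du) | nc h2 (cv, dv)].
  - move=> c d /D1P[cu cv] /D1P[du dv]; apply/C0P; split; [nc h2 (cu, du) | nc h2 (cv, dv)].
  - move=> c d /D1P[cu cv] /C0P[du dv]; apply/D1P; split; [nc h2 (cu, du) | nc h2 (cv, dv)].
  - by apply/C0P.
  - have [//|h] := EM (exists x, [/\ x \in Alt s, x \in D1 & x != 0]).
    have sid d : d \in D1 -> s d = d.
      move=> dD; apply/esym; apply: (add2_eq hD); apply/eqP; apply: contra_notT h => dn.
      by exists (d + s d); split=> //; [apply/AltP; exists d | rewrite memvD // sD1].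
    have sx0 : s x0 = x0 by apply: sid; apply/D1P.
    have : s (v * x0) = v * x0.
      apply: sid; apply/D1P; have E : x0 * u = (u + 1) * x0 := x0u; split; [nc h2 (E, vu) | nc h2 x0v].
    rewrite sM sx0 sv => E; case/eqP: x0n; rewrite -[RHS](h2 (v * x0)) -{1}E; nc h2 x0v.
  - move=> z sz zC.
    have Cv y : y * v = v * y -> y * z = z * y.
      move=> yv; rewrite -[y](addrK (u * y + y * u)) (char2_opp h2).
      rewrite mulrDl mulrDr !zC //; [right; apply/D1P; split | left; apply/C0P; split].
      - exact: flips_ad uu.
      - by have uv := esym vu; nc h2 (yv, uv).
      - exact: ad_decomp uu.
      - by have uv := esym vu; nc h2 (yv, uv).
    have zv : z * v = v * z by rewrite Cv.
    have [al [be zE]] := full_cent_scalar vv y0n y0v zv Cv.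
    exists al; rewrite zE; move: sz; rewrite zE linearD !linearZ /= s1 sv => /eqP; rewrite -subr_eq0 => /eqP E.
    suff -> : be = 0 by rewrite scale0r addr0.
    have /eqP : be *: (1 : D) = 0 by rewrite -[RHS]E; nc h2 tt.
    by rewrite scaler_eq0 oner_eq0 orbF => /eqP.
  move=> x xA xD; have [->|x0'] := eqVneq x 0; first by exists 0; rewrite !mul0r scale0r.
  by have [//|h] := EM (scalar (x * x * x * x)); case: nx; exists x.
have /D1P[xu xv] := xD.
pose B1 := aspace_cap (algid_in 'C[x]%AS 'C[u]%AS).
pose B := (B1 :&: 'C[v])%VS.
have BP y : y \in B <-> [/\ y * x = x * y, y * u = u * y & y * v = v * y].
  split=> [/memv_capP[/memv_capP[/cent1vP yx /cent1vP yu] /cent1vP yv] //|[yx yu yv]].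
  by apply: in_cap; [apply: in_cap|]; exact/cent1vP.
have hB' y : y \in B -> scalar (y + s y).
  by move=> /BP[yx yu yv]; apply: hB => //; apply/C0P.
have dB : (4 <= \dim B)%N.
  have H1 : (\dim 'C[x] <= 2 * \dim B1)%N.
    by apply: (halve hD (K := 'C[x]%AS) uu) => y /cent1vP /esym yx; apply/cent1vP; nc h2 (yx, xu).
  have H2 : (\dim B1 <= 2 * \dim B)%N.
    apply: (halve hD (K := B1) vv) => y /memv_capP[/cent1vP yx /cent1vP yu].
    have xy := esym yx; have uy := esym yu; have uv := esym vu.
    by apply: in_cap; apply/cent1vP; [nc h2 (xy, xv) | nc h2 (uy, uv)].
  lia.
have dS := Sym_scalar_dim hB'.
have : (B :&: Sym s <= 1)%VS.
  apply/subvP => d /memv_capP[/BP[dx' du dv] /(SymP hD) sd].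
  have /hB' : d * v \in B by apply/BP; have vx := esym xv; split; [nc h2 (dx', vx) | nc h2 (du, vu) | nc h2 dv].
  have -> : d * v + s (d * v) = d by rewrite sM sd sv; nc h2 dv.
  by move/line1P.
move/dimvS; rewrite dimv1; lia.
Qed.
End Triquadratic.

(** * Generators in degree 8 *)

Section Tower.
Variables (F : fieldType) (D : falgType F) (hD : csdiv D).
Let h2 := cs2 hD.

(* [u], [v], [w] generate a triquadratic maximal subfield; conjugation by [x], [y], [z] adds 1 to
   [u], [v], [w] respectively. The parameters of the algebra are the coefficients of the squares
   of [y], [z], [x y], [x z], [x y z], and [s] fixes all six generators. *)
Record tower (u v w x y z : D) (a b c e0 e1 f0 f1 m0 m1 l0 l1 q0 q1 : F) (s : 'End(D)) : Prop := Tower {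
  tw_uu : u * u = u + a *: 1; tw_vv : v * v = v + b *: 1; tw_ww : w * w = w + c *: 1;
  tw_vu : v * u = u * v; tw_wu : w * u = u * w; tw_wv : w * v = v * w;
  tw_xu : x * u = (u + 1) * x; tw_xv : x * v = v * x; tw_xw : x * w = w * x;
  tw_yu : y * u = u * y; tw_yv : y * v = (v + 1) * y; tw_yw : y * w = w * y;
  tw_zu : z * u = u * z; tw_zv : z * v = v * z; tw_zw : z * w = (w + 1) * z;
  tw_zy : z * y = y * z; tw_x0 : x != 0; tw_y0 : y != 0; tw_z0 : z != 0;
  tw_Y : y * y = e0 *: 1 + e1 *: u; tw_Z : z * z = f0 *: 1 + f1 *: u;
  tw_M : x * y * (x * y) = m0 *: 1 + m1 *: w; tw_L : x * z * (x * z) = l0 *: 1 + l1 *: v;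
  tw_Q : x * y * z * (x * y * z) = q0 *: 1 + q1 *: (v + w);
  tw_s : antim s; tw_fix : [/\ s u = u, s v = v, s w = w & [/\ s x = x, s y = y & s z = z]] }.

Definition in000 (u v w f : D) := [/\ f * u = u * f, f * v = v * f & f * w = w * f].

(** Galois descent: [f] is fixed by conjugation by [g] and by [h], which shift [v] and [w], so only
    [F(u)] is left. In detail, [f] commutes with the whole centraliser of [u], assembled from its
    components relative to [v] and [w]. *)
Lemma cent_all_scalar (u v w f gx g h : D) a b c : u * u = u + a *: 1 -> v * v = v + b *: 1 -> w * w = w + c *: 1 ->
  v * u = u * v -> w * u = u * w -> w * v = v * w ->
  (forall f g, in000 u v w f -> in000 u v w g -> f * g = g * f) ->
  gx != 0 -> flips gx u -> g != 0 -> g * u = u * g -> flips g v -> g * w = w * g ->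
  h != 0 -> h * u = u * h -> h * v = v * h -> flips h w ->
  in000 u v w f -> f * g = g * f -> f * h = h * f -> exists al be : F, f = al *: 1 + be *: u.
Proof.
move=> uu vv ww vu wu wv cm gx0 gxu g0 gu gv gw h0 hu hv hw f0 fg fh.
have [fu fv fw] := f0; have gv' : g * v = (v + 1) * g := gv; have hw' : h * w = (w + 1) * h := hw.
apply: (full_cent_scalar hD uu gx0 gxu fu) => y yu.
have step (P : D -> Prop) (t k : D) d : t * t = t + d *: 1 -> k != 0 -> flips k t -> f * k = k * f ->
    (forall y, P y -> (y + (t * y + y * t)) * f = f * (y + (t * y + y * t))) ->
    (forall y, P y -> ((t * y + y * t) * k^-1) * f = f * ((t * y + y * t) * k^-1)) ->
    forall y, P y -> y * f = f * y.
  move=> tt k0 kt fk H0 H1 y' Py; have E0 := H0 y' Py; have E1 := H1 y' Py.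
  have -> : y' = (y' + (t * y' + y' * t)) + (t * y' + y' * t) * k^-1 * k.
    by rewrite mulrVK ?(csU hD) //; nc h2 tt.
  by rewrite mulrDl mulrDr E0; congr (_ + _); rewrite -mulrA -fk !mulrA E1 !mulrA.
have V k : k != 0 -> flips k v -> flips k^-1 v by move=> k0 kv; exact: flips_inv.
have gi : g^-1 * v = (v + 1) * g^-1 := flips_inv hD g0 gv.
have hi : h^-1 * w = (w + 1) * h^-1 := flips_inv hD h0 hw.
have giu := comm_inv hD g0 gu; have giw := comm_inv hD g0 gw.
have hiu := comm_inv hD h0 hu; have hiv := comm_inv hD h0 hv.
have two t : t * u = u * t /\ t * v = v * t -> t * f = f * t.
  apply: (step (fun t => t * u = u * t /\ t * v = v * t) w h c ww h0 hw fh) => {}t [tu tv]; apply: cm => //; split.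
  - by nc h2 (tu, wu).
  - by nc h2 (tv, wv).
  - by nc h2 ww.
  - by nc h2 (tu, wu, hiu).
  - by nc h2 (tv, wv, hiv).
  - by nc h2 (ww, hi).
apply: (step (fun y => y * u = u * y) v g b vv g0 gv fg) yu => y' y'u; apply: two; split.
- by nc h2 (y'u, vu).
- by nc h2 vv.
- by nc h2 (y'u, vu, giu).
- by nc h2 (vv, gi).
Qed.

Variables (u v w : D) (a b c : F).
Hypotheses (uu : u * u = u + a *: 1) (vv : v * v = v + b *: 1) (ww : w * w = w + c *: 1).
Hypotheses (vu : v * u = u * v) (wu : w * u = u * w) (wv : w * v = v * w).

(** Homogeneity for the grading of [D] by the conjugation action on [u], [v], [w], with degrees
    written as scalars. *)
Definition grd (g : D) (e1 e2 e3 : F) :=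
  [/\ g * u = (u + e1 *: 1) * g, g * v = (v + e2 *: 1) * g & g * w = (w + e3 *: 1) * g].

Lemma grd0P f : grd f 0 0 0 <-> in000 u v w f.
Proof. by rewrite /grd /in000 !scale0r !addr0. Qed.

Lemma grdM g h e1 e2 e3 e1' e2' e3' : grd g e1 e2 e3 -> grd h e1' e2' e3' ->
  grd (g * h) (e1 + e1') (e2 + e2') (e3 + e3').
Proof. by move=> [A1 A2 A3] [B1 B2 B3]; split; [nc h2 (A1, B1) | nc h2 (A2, B2) | nc h2 (A3, B3)]. Qed.

Lemma grdV g e1 e2 e3 : g != 0 -> grd g e1 e2 e3 -> grd g^-1 e1 e2 e3.
Proof.
move=> g0; have gU := csU hD g0.
have V (t : D) e : g * t = (t + e *: 1) * g -> g^-1 * t = (t + e *: 1) * g^-1.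
  move=> E; apply: (mulrI gU); apply: (mulIr gU); rewrite mulVKr // !mulrA mulrVK //.
  by rewrite mulrDr E; nc h2 E.
by case=> A1 A2 A3; split; exact: V.
Qed.

Lemma grdD g h e1 e2 e3 : grd g e1 e2 e3 -> grd h e1 e2 e3 -> grd (g + h) e1 e2 e3.
Proof. by move=> [A1 A2 A3] [B1 B2 B3]; split; rewrite mulrDr mulrDl ?A1 ?A2 ?A3 ?B1 ?B2 ?B3. Qed.

Hypothesis gen8 : forall f, in000 u v w f -> f \in << << <<1; u>>; v>>; w>>%VS.

Lemma comm8 f g : in000 u v w f -> in000 u v w g -> f * g = g * f.
Proof.
move=> /gen8 f8 [gu gv gw]; suff /subvP h : (<< << <<1; u>>; v>>; w>> <= 'C[g])%VS.
  exact/cent1vP/h.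
have m (t : D) : t * g = g * t -> forall x, x \in 'C[g]%VS -> t * x \in 'C[g]%VS.
  by move=> tg x xg; apply: (memvM (A := 'C[g]%AS)) => //; apply/cent1vP.
have A1 : (<<1; u>> <= 'C[g])%VS.
  by apply: adjoin_ind => [|k x|]; [exact: cent1v1 | exact: scale1_mem (cent1v1 g) | exact: m].
have A2 : (<< <<1; u>>; v>> <= 'C[g])%VS.
  apply: adjoin_ind => [|k x kK|]; [exact: cent1v1 | | exact: m].
  by apply: m; apply/cent1vP; exact: (subvP A1).
apply: adjoin_ind => [|k x kK|]; [exact: cent1v1 | | exact: m].
by apply: m; apply/cent1vP; exact: (subvP A2).
Qed.

(** On the field generated by [u], [v], [w], which is commutative, [t] and conjugation by [g] are
    both homomorphisms, and they agree on the generators. *)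
Lemma anti_conj (t : 'End(D)) g e1 e2 e3 : antim t -> t u = u + e1 *: 1 -> t v = v + e2 *: 1 ->
  t w = w + e3 *: 1 -> grd g e1 e2 e3 -> forall f, in000 u v w f -> t f * g = g * f.
Proof.
move=> [tM t1] tu tv tw [gu gv gw].
have [V VP] : exists V : {vspace D}, forall f, f \in V <-> t f * g = g * f.
  exists (lker ((amulr g \o t)%VF - amull g)) => f.
  by split=> [/eqlfunP|E]; [|apply/eqlfunP]; rewrite comp_lfunE !lfunE.
have VM f k : in000 u v w k -> f * k = k * f -> k \in V -> f \in V -> k * f \in V.
  by move=> _ fk /VP kV /VP fV; apply/VP; rewrite tM; nc h2 (kV, fV, fk).
pose W := (V :&: ('C[u] :&: ('C[v] :&: 'C[w])))%VS.
have WP f : f \in W <-> f \in V /\ in000 u v w f.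
  split=> [/memv_capP[fV /memv_capP[/cent1vP fu /memv_capP[/cent1vP fv /cent1vP fw]]] //|[fV [fu fv fw]]].
  by apply: in_cap => //; apply: in_cap; [|apply: in_cap]; exact/cent1vP.
have W1 : 1 \in W by apply/WP; split; [apply/VP; rewrite t1 mul1r mulr1 | rewrite /in000 !mul1r !mulr1].
have in000M f k : in000 u v w f -> in000 u v w k -> in000 u v w (f * k).
  by move=> [A1 A2 A3] [B1 B2 B3]; split; [nc h2 (A1, B1) | nc h2 (A2, B2) | nc h2 (A3, B3)].
have WM k x : k \in W -> x \in W -> k * x \in W.
  move=> /WP[kV k0] /WP[xV x0]; apply/WP; split; last exact: in000M.
  by apply: VM => //; exact: comm8.
have uW : u \in W by apply/WP; split; [apply/VP; rewrite tu gu | split].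
have vW : v \in W by apply/WP; split; [apply/VP; rewrite tv gv | split].
have wW : w \in W by apply/WP; split; [apply/VP; rewrite tw gw | split].
have A1 : (<<1; u>> <= W)%VS.
  by apply: adjoin_ind => [|k x|x]; [exact: W1 | exact: scale1_mem W1 | exact: WM].
have A2 : (<< <<1; u>>; v>> <= W)%VS.
  by apply: adjoin_ind => [|k x kK|x]; [exact: W1 | apply: WM; exact: (subvP A1) | exact: WM].
have A3 : (<< << <<1; u>>; v>>; w>> <= W)%VS.
  by apply: adjoin_ind => [|k x kK|x]; [exact: W1 | apply: WM; exact: (subvP A2) | exact: WM].
by move=> f /gen8 /(subvP A3) /WP[/VP].
Qed.

Lemma anti_grd (t : 'End(D)) d e1 e2 e3 k1 k2 k3 : antim t -> t u = u + e1 *: 1 -> t v = v + e2 *: 1 ->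
  t w = w + e3 *: 1 -> grd d k1 k2 k3 -> grd (t d) k1 k2 k3.
Proof.
move=> [tM t1] tu tv tw [A1 A2 A3].
have H r e k : t r = r + e *: 1 -> d * r = (r + k *: 1) * d -> t d * r = (r + k *: 1) * t d.
  move=> tr E; have := congr1 t E; rewrite !tM linearD linearZ /= t1 tr => E2.
  have E3 : r * t d = t d * (r + k *: 1) by apply: (add2_eq hD); rewrite -[RHS](h2 ((r + e *: 1) * t d)) {2}E2; nc h2 tt.
  by rewrite mulrDl E3; nc h2 tt.
by split; [exact: H tu A1 | exact: H tv A2 | exact: H tw A3].
Qed.

Lemma sym_grd (t : 'End(D)) g e1 e2 e3 k1 k2 k3 : invol t -> t u = u + e1 *: 1 -> t v = v + e2 *: 1 ->
  t w = w + e3 *: 1 -> g != 0 -> grd g k1 k2 k3 -> exists q, [/\ q != 0, t q = q & grd q k1 k2 k3].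
Proof.
move=> [ta tt] tu tv tw g0 gg; have [E|E] := eqVneq (g + t g) 0.
  by exists g; split=> //; rewrite [RHS](add2_eq hD E).
exists (g + t g); split=> //; first by rewrite linearD /= tt addrC.
by apply: grdD => //; exact: anti_grd ta tu tv tw gg.
Qed.

Lemma in000_sq g e1 e2 e3 : grd g e1 e2 e3 -> in000 u v w (g * g).
Proof. by move=> gg; have := grdM gg gg; rewrite !(csF2 hD) => /grd0P. Qed.

Variables (gx gy gz : D).
Hypotheses (gx0 : gx != 0) (gy0 : gy != 0) (gz0 : gz != 0).
Hypotheses (gxg : grd gx 1 0 0) (gyg : grd gy 0 1 0) (gzg : grd gz 0 0 1).
Variables (s : 'End(D)) (hs : invol s) (su : s u = u) (sv : s v = v) (sw : s w = w).

Lemma flip_grd (g : D) e1 e2 e3 u0 : g != 0 -> grd g e1 e2 e3 ->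
  (u0, 1) \in [:: (u, e1); (v, e2); (w, e3)] ->
  exists t : 'End(D), [/\ invol t, t u = u + e1 *: 1, t v = v + e2 *: 1 & t w = w + e3 *: 1].
Proof.
move=> g0 [A1 A2 A3] u0U; have uv := esym vu; have uw := esym wu; have vw := esym wv.
have [t [ht tE]] : exists t : 'End(D), symp t /\
    forall p, p \in [:: (u, e1); (v, e2); (w, e3)] -> t p.1 = p.1 + p.2 *: 1.
  refine (flip_symp hD (U := [:: (u, e1); (v, e2); (w, e3)]) hs _ g0 _ u0U _) => p; rewrite !inE => /or3P[] /eqP -> //=.
  - by move: u0U; rewrite !inE => /or3P[] /eqP [-> _].
  - by move: u0U; rewrite !inE => /or3P[] /eqP [-> _].
  - by move: u0U; rewrite !inE => /or3P[] /eqP [-> _].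
exists t; split; first exact: ht.1.
- by rewrite (tE (u, e1)) // !inE eqxx.
- by rewrite (tE (v, e2)) // !inE eqxx orbT.
by rewrite (tE (w, e3)) // !inE eqxx !orbT.
Qed.

Lemma comm_in000 f g : in000 u v w f -> in000 u v w g -> f * g = g * f.
Proof. exact: comm8. Qed.

(** [t] acts on the triquadratic field as conjugation by [gz]. For a [t]-symmetric [y] the square is
    [t]-symmetric, so it commutes with [gz] besides [y]. *)
Lemma ex_y : exists y e0 e1, [/\ y != 0, grd y 0 1 0 & y * y = e0 *: 1 + e1 *: u].
Proof.
have [|t [ht tu tv tw]] := @flip_grd gz 0 0 1 w gz0 gzg; first by rewrite !inE eqxx !orbT.
have [y [y0 ty yg]] := sym_grd ht tu tv tw gy0 gyg.
have yy := in000_sq yg.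
have [gxu _ _] := gxg; have [yu yv yw] := yg; have [zu zv zw] := gzg.
have [al [be E]] : exists al be : F, y * y = al *: 1 + be *: u.
  apply: (cent_all_scalar uu vv ww vu wu wv comm_in000 (gx := gx) (g := y) (h := gz)) => //.
  - by rewrite /flips gxu scale1r.
  - by rewrite yu scale0r addr0.
  - by rewrite /flips yv scale1r.
  - by rewrite yw scale0r addr0.
  - by rewrite zu scale0r addr0.
  - by rewrite zv scale0r addr0.
  - by rewrite /flips zw scale1r.
  - by rewrite mulrA.
  - by rewrite -[RHS](anti_conj ht.1 tu tv tw gzg yy) (proj1 ht.1) ty.
by exists y, al, be.
Qed.

(** For the involution [t] that shifts [u] alone, it is enough to find [x] with [t y * x = x * y]
    and [t z * x = x * z]: the twist of [t] by [x^-1] then fixes all six generators. The candidate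
    [x2] is right for [z]; its failure on [y] is a factor [nu] of norm 1, corrected as in Hilbert
    90. *)
Lemma ex_tower : exists u v w x y z a b c e0 e1 f0 f1 m0 m1 l0 l1 q0 q1 s,
  tower u v w x y z a b c e0 e1 f0 f1 m0 m1 l0 l1 q0 q1 s.
Proof.
have [y [e0 [e1 [y0 yg Ey]]]] := ex_y; have yU := csU hD y0.
have yyu k : k * u = u * k -> y * y * k = k * (y * y).
  by move=> ku; rewrite Ey; nc h2 ku.
have yVg := grdV y0 yg.
(* [gz] is averaged over conjugation by [y], which has order two on it since [y * y] lies in
   [F + F u]. *)
have [z [z0 zg zy]] : exists z, [/\ z != 0, grd z 0 0 1 & z * y = y * z].
  have [E|E] := eqVneq (gz + y * gz * y^-1) 0.
    exists gz; split=> //; have := congr1 ( *%R^~ y) E; rewrite mul0r mulrDl mulrVK // => E'.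
    exact: (add2_eq hD).
  exists (gz + y * gz * y^-1); split=> //.
    apply: grdD => //; have := grdM (grdM yg gzg) yVg; by rewrite !addr0 !add0r (csF2 hD).
  rewrite mulrDl mulrVK // mulrDr addrC; congr (_ + _); rewrite !mulrA yyu ?mulrA ?mulrK //.
  by have [-> _ _] := gzg; rewrite scale0r addr0.
have [yu yv yw] : [/\ y * u = u * y, y * v = (v + 1) * y & y * w = w * y].
  by case: yg; rewrite scale1r !scale0r !addr0.
have [zu zv zw] : [/\ z * u = u * z, z * v = v * z & z * w = (w + 1) * z].
  by case: zg; rewrite scale1r !scale0r !addr0.
have [gxu _ _] := gxg; rewrite scale1r in gxu.
have [f0 [f1 Ez]] : exists al be : F, z * z = al *: 1 + be *: u.
  apply: (cent_all_scalar uu vv ww vu wu wv comm_in000 (gx := gx) (g := y) (h := z)) => //.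
  - exact: in000_sq zg.
  - by nc h2 zy.
  - by rewrite mulrA.
have [|t [ht tu tv tw]] := @flip_grd gx 1 0 0 u gx0 gxg; first by rewrite !inE eqxx.
have [ta tt] := ht; have [tM t1] := ta.
have [q [q0 tq qg]] := sym_grd ht tu tv tw (cs_mul_neq0 hD gx0 z0) (grdM gxg zg).
have tK g : grd g 1 0 0 -> forall f, in000 u v w f -> t f * g = g * f := anti_conj ta tu tv tw.
(* Write [g = k * x'] with [x'] symmetric: then [t k = x' * k * x'^-1], and [x' * x'] commutes with
   [k]. *)
have tfix g : g != 0 -> grd g 1 0 0 -> t g = g.
  move=> g0 gg; have [x' [x0 tx xg]] := sym_grd ht tu tv tw gx0 gxg; have xU := csU hD x0.
  have k0 : in000 u v w (g * x'^-1).
    by have := grdM gg (grdV x0 xg); rewrite !addr0 (csF2 hD) => /grd0P.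
  rewrite -(mulrVK xU g) tM tx; set k := g * x'^-1 in k0 *.
  by apply: (mulIr xU); rewrite -[LHS]mulrA tK // mulrA (comm8 (in000_sq xg) k0) mulrA.
pose x2 := q * z^-1; have zU := csU hD z0.
have x2z : x2 * z = q by rewrite mulrVK.
have x2g : grd x2 1 0 0.
  by have := grdM qg (grdV z0 zg); rewrite !addr0 !add0r (csF2 hD).
have x20 : x2 != 0 by apply: contraNneq q0 => E; rewrite -x2z E mul0r.
have x2U := csU hD x20.
have tx2 := tfix _ x20 x2g.
have x2Vg := grdV x20 x2g.
pose z' := t z.
have z'x2 : z' * x2 = x2 * z by rewrite -{1}tx2 -tM x2z tq.
pose y' := x2 * y * x2^-1.
have y'x2 : y' * x2 = x2 * y by rewrite mulrVK.
have y'g : grd y' 0 1 0.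
  by have := grdM (grdM x2g yg) x2Vg; rewrite !addr0 !add0r (csF2 hD).
have y'0 : y' != 0 by do 2?[apply: cs_mul_neq0 => //]; rewrite invr_eq0.
have y'U := csU hD y'0.
have tyg := anti_grd ta tu tv tw yg.
pose nu := t y * y'^-1.
have nu0 : in000 u v w nu.
  by have := grdM tyg (grdV y'0 y'g); rewrite !addr0 (csF2 hD) => /grd0P.
have tyE : t y = nu * y' by rewrite mulrVK.
have y'z' : y' * z' = z' * y'.
  by apply: (mulIr x2U); nc h2 (z'x2, y'x2, zy).
have tzy : nu * y' * z' = z' * nu * y' by rewrite -[RHS]mulrA -tyE /z' -!tM zy.
have nuz' : nu * z' = z' * nu.
  by apply: (mulIr y'U); have zy' := esym y'z'; nc h2 (zy', tzy).
(* That [t] has order two says that [nu] times its conjugate by [y'] is 1. *)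
have nuy' : nu * y' * nu = y'.
  have xxnu := comm8 (in000_sq x2g) nu0.
  have tnu := tK _ x2g _ nu0.
  have ty' : x2 * t y' = nu * y' * x2 by have := congr1 t y'x2; rewrite (tM y' x2) (tM x2 y) tx2 tyE.
  have yE : y = t y' * t nu by rewrite -(tM nu y') -tyE tt.
  apply: (mulIr x2U); apply: (mulIr x2U); transitivity (x2 * y * x2); last by nc h2 y'x2.
  by rewrite yE; nc h2 (ty', tnu, xxnu).
(* Hilbert 90: [nu + 1] solves [nu * y' * eta = eta * y'], and if it is zero then [nu = 1] and
   [eta = 1] is a solution. *)
pose eta := if nu + 1 == 0 then 1 else nu + 1.
have eta_n0 : eta != 0 by rewrite /eta; case: ifPn => // _; exact: oner_neq0.
have one0 : in000 u v w 1 by rewrite /in000 !mul1r !mulr1.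
have eta0 : in000 u v w eta.
  rewrite /eta; case: ifP => _ //; apply/grd0P; apply: grdD; exact/grd0P.
have etaz' : eta * z' = z' * eta.
  by rewrite /eta; case: ifP => _; [rewrite mul1r mulr1 | rewrite mulrDl mulrDr nuz' mul1r mulr1].
have etay' : nu * y' * eta = eta * y'.
  rewrite /eta; case: ifP => [/eqP E|_]; last by rewrite mulrDr nuy' mulr1 mulrDl mul1r addrC.
  by rewrite (add2_eq hD E) !mul1r mulr1.
pose x := eta * x2.
have x0 : x != 0 by exact: cs_mul_neq0.
have xg : grd x 1 0 0 by have /grd0P h := eta0; have := grdM h x2g; rewrite !add0r.
have tx := tfix _ x0 xg.
have txy : t y * x = x * y by rewrite tyE mulrA etay' -[eta * y' * x2]mulrA y'x2 mulrA.
have txz : t z * x = x * z by rewrite -/z' mulrA -etaz' -mulrA z'x2 mulrA.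
have xU := csU hD x0.
have xVn : x^-1 != 0 by rewrite invr_eq0.
have [sg [hsg sgE]] := ex_twist hD ht xVn (etrans (anti_inv hD ta x0) (congr1 _ tx)).
have [xu xv xw] : [/\ x * u = (u + 1) * x, x * v = v * x & x * w = w * x].
  by case: xg; rewrite scale1r !scale0r !addr0.
rewrite scale1r in tu; rewrite scale0r addr0 in tv; rewrite scale0r addr0 in tw.
have sgfix : [/\ sg u = u, sg v = v, sg w = w & [/\ sg x = x, sg y = y & sg z = z]].
  have V d : t d * x = x * d -> sg d = d by move=> E; rewrite sgE invrK -mulrA E mulKr.
  by split; [apply: V; rewrite tu xu | apply: V; rewrite tv xv | apply: V; rewrite tw xw | split; apply: V; rewrite ?tx].
have cm8 : forall f g, in000 u v w f -> in000 u v w g -> f * g = g * f := comm8.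
have txyz : t (x * y * z) = x * y * z.
  by rewrite (tM (x * y)) (tM x y) tx txy mulrA txz -!mulrA zy.
have fixx f : in000 u v w f -> t f = f -> f * x = x * f.
  by move=> f0' tf; rewrite -{1}tf; apply: tK.
have csq f g : f = x * g -> f * f * x = x * (f * f) -> f * f * g = g * (f * f).
  move=> fE fx; apply: (cs_mulI hD x0); transitivity (f * f * f); last by rewrite {1}fE !mulrA.
  by rewrite [LHS]mulrA -fx -[LHS]mulrA -fE.
have c3 f : in000 u v w f -> in000 w u v f by case=> *; split.
have c3' f : in000 w u v f -> in000 u v w f by case=> *; split.
have c2 f : in000 u v w f -> in000 v u w f by case=> *; split.
have c2' f : in000 v u w f -> in000 u v w f by case=> *; split.
(* [x * y] is [t]-symmetric, so its square commutes with [x], hence with [y]; these shift [u] and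
   [v], which leaves [F + F w]. The next two squares are treated alike, [y * z] shifting [v] and [w]
   together and so fixing [v + w]. *)
have [m0 [m1 EM']] : exists al be : F, x * y * (x * y) = al *: 1 + be *: w.
  have sq0 : in000 u v w (x * y * (x * y)) by exact: in000_sq (grdM xg yg).
  have fx : x * y * (x * y) * x = x * (x * y * (x * y)) by apply: fixx => //; rewrite (tM (x * y)) (tM x y) tx txy.
  apply: (cent_all_scalar ww uu vv _ _ _ _ (gx := z) (g := x) (h := y)) => //.
  - by move=> f g /c3' f0' /c3' g0'; exact: cm8.
  - exact: c3.
  - exact: (csq _ y).
have [l0 [l1 EL]] : exists al be : F, x * z * (x * z) = al *: 1 + be *: v.
  have sq0 : in000 u v w (x * z * (x * z)) by exact: in000_sq (grdM xg zg).
  have fx : x * z * (x * z) * x = x * (x * z * (x * z)) by apply: fixx => //; rewrite (tM (x * z)) (tM x z) tx txz.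
  apply: (cent_all_scalar vv uu ww _ _ _ _ (gx := y) (g := x) (h := z)) => //.
  - by move=> f g /c2' f0' /c2' g0'; exact: cm8.
  - exact: c2.
  - exact: (csq _ z).
have [q0' [q1 EQ]] : exists al be : F, x * y * z * (x * y * z) = al *: 1 + be *: (v + w).
  have sq0 : in000 u v w (x * y * z * (x * y * z)) by exact: in000_sq (grdM (grdM xg yg) zg).
  have fx : x * y * z * (x * y * z) * x = x * (x * y * z * (x * y * z)) by apply: fixx => //; rewrite tM txyz.
  have vw2 : (v + w) * (v + w) = v + w + (b + c) *: 1 by nc h2 (vv, ww, wv).
  have cv f : in000 (v + w) u w f -> in000 u v w f.
    by case=> A1 A2 A3; split=> //; have := A1; rewrite mulrDr mulrDl A3 => /addIr.
  apply: (cent_all_scalar vw2 uu ww _ _ _ _ (gx := y) (g := x) (h := y * z)) => //.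
  - by nc h2 (vu, wu).
  - by nc h2 wv.
  - by move=> f g /cv f0' /cv g0'; exact: cm8.
  - by rewrite /flips; nc h2 (yv, yw).
  - by nc h2 (xv, xw).
  - exact: cs_mul_neq0.
  - by nc h2 (yv, yw, zv, zw).
  - by nc h2 (yu, zu).
  - by rewrite /flips; nc h2 (yw, zw).
  - by case: sq0 => A1 A2 A3; split=> //; rewrite mulrDr mulrDl A2 A3.
  - by apply: (csq _ (y * z)) => //; rewrite mulrA.
exists u, v, w, x, y, z, a, b, c, e0, e1, f0, f1, m0, m1, l0, l1, q0', q1, sg.
by split=> //; case: hsg.
Qed.
End Tower.

Section Tower64.
Variables (F : fieldType) (D : falgType F) (hD : csdiv D).
Let h2 := cs2 hD.

Lemma flips_or_commutes (P : D -> Prop) (v : D) b : v * v = v + b *: 1 ->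
  (forall y, P y -> P (v * y + y * v)) ->
  (exists y, [/\ y != 0, P y & flips y v]) \/ (forall y, P y -> y * v = v * y).
Proof.
move=> vv hP; have [|h] := EM (exists y, [/\ y != 0, P y & flips y v]); first by left.
right=> y Py; have [E|E] := eqVneq (v * y + y * v) 0; first by rewrite [RHS](add2_eq hD E).
by case: h; exists (v * y + y * v); split; [| exact: hP | exact: flips_ad vv].
Qed.

Lemma not_in_gen (u g : D) (V : {vspace D}) : g != 0 -> flips g u -> (V <= 'C[g])%VS -> u \notin V.
Proof.
move=> g0 gu /subvP VC; apply/negP => /VC /cent1vP E.
exact: (flips_neq hD g0 gu).
Qed.

(** Each new Artin-Schreier element comes with an element that flips it and commutes with the
    earlier ones and with an involution fixing all those found so far; when another search follows,
    a symplectic involution shifting only the newest one is prepared for it. *)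
Lemma ex_tower64 (s : 'End(D)) : \dim {:D} = 64%N -> symp s ->
  exists u v w x y z a b c e0 e1 f0 f1 m0 m1 l0 l1 q0 q1 s,
  @tower F D u v w x y z a b c e0 e1 f0 f1 m0 m1 l0 l1 q0 q1 s.
Proof.
move=> d64 hs; have [u uAS] := ex_artin_schreier64 hD d64 hs; have [uF [a uu]] := uAS.
have [x1 x10 x1u] := as_graded hD uAS.
have [sA [hA sAu]] : exists t : 'End(D), invol t /\ forall r, r \in [:: u] -> t r = r.
  exact: (fix_step hD hs.1 _ _ uu x10 x1u).
have [sB [hB sBu]] : exists t : 'End(D), symp t /\ forall p, p \in [:: (u, 1)] -> t p.1 = p.1 + p.2 *: 1.
  apply: (flip_symp hD (U := [:: (u, 1)]) (u0 := u) hA _ x10).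
  - by move=> p; rewrite inE => /eqP ->; apply: sAu; rewrite inE.
  - by move=> p; rewrite inE => /eqP -> /=; rewrite scale1r.
  - by rewrite inE.
  - by move=> p; rewrite inE => /eqP ->.
have su1 : sB u = u + 1 by rewrite (sBu (u, 1)) ?inE //= scale1r.
have [v [b [vv vu vF]]] := ex_second_as hD d64 uu uF hB su1.
have uv := esym vu.
have hPv y : y * u = u * y -> (v * y + y * v) * u = u * (v * y + y * v) by move=> yu; nc h2 (yu, vu).
have [[gy [gy0 gyu gyv]]|h] := @flips_or_commutes (fun y => y * u = u * y) v b vv hPv; last first.
  have [al [be E]] := full_cent_scalar hD uu x10 x1u vu h; by case: (vF al be).
have gyv' : gy * v = (v + 1) * gy := gyv.
have [x2 [x20 x2v x2t]] := commute_adjust hD vv x10 gy0 gyv.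
have x2u : x2 * u = (u + 1) * x2.
  have := x2t u 1 uv gyu; rewrite scale1r; exact.
have [sC [hC sCuv]] : exists t : 'End(D), invol t /\ forall r, r \in [:: v; u] -> t r = r.
  apply: (fix_step hD hA sAu _ vv gy0 gyv) => r; rewrite inE => /eqP -> //.
have sCu : sC u = u by apply: sCuv; rewrite !inE eqxx orbT.
have sCv : sC v = v by apply: sCuv; rewrite !inE eqxx.
have [sD [hsD sDuv]] : exists t : 'End(D), symp t /\ forall p, p \in [:: (v, 1); (u, 0)] -> t p.1 = p.1 + p.2 *: 1.
  apply: (flip_symp hD (U := [:: (v, 1); (u, 0)]) (u0 := v) hC _ gy0).
  - by move=> p; rewrite !inE => /orP[] /eqP ->.
  - by move=> p; rewrite !inE => /orP[] /eqP -> /=; rewrite ?scale1r ?scale0r ?addr0.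
  - by rewrite !inE eqxx.
  - by move=> p; rewrite !inE => /orP[] /eqP ->.
have sDu : sD u = u by rewrite (sDuv (u, 0)) ?inE ?eqxx ?orbT //= scale0r addr0.
have sDv : sD v = v + 1 by rewrite (sDuv (v, 1)) ?inE ?eqxx //= scale1r.
have [w [c [ww wu wv wF]]] := ex_third_as hD d64 uu vv vu gy0 gyv gyu x20 x2u x2v hsD sDu sDv.
have uw := esym wu; have vw := esym wv.
have hPw y : y * u = u * y /\ y * v = v * y ->
    (w * y + y * w) * u = u * (w * y + y * w) /\ (w * y + y * w) * v = v * (w * y + y * w).
  by move=> [yu yv]; split; [nc h2 (yu, wu) | nc h2 (yv, wv)].
have [[gz [gz0 [gzu gzv] gzw]]|h] := @flips_or_commutes (fun y => y * u = u * y /\ y * v = v * y) w c ww hPw; last first.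
  have mC r : r * u = u * r -> r \in 'C[u]%AS by move=> E; apply/cent1vP.
  have hh r : r \in 'C[u]%AS -> r * v = v * r -> r * w = w * r by move=> /cent1vP ru rv; apply: h.
  have [al [be [/cent1vP alu /cent1vP beu wE alC beC]]] := cent_step hD (P := 'C[u]%AS) (mC _ vu) vv (mC _ gyu) gy0 gyv (mC _ wu) wv hh.
  have [p [q pq]] := full_cent_scalar hD uu x10 x1u alu (fun y yu => alC y (mC _ yu)).
  have [r [t rt]] := full_cent_scalar hD uu x10 x1u beu (fun y yu => beC y (mC _ yu)).
  by case: (wF p q r t); rewrite wE pq rt; nc h2 tt.
have [y [y0 yw yt]] := commute_adjust hD ww gy0 gz0 gzw.
have [x [x0 xw xt]] := commute_adjust hD ww x20 gz0 gzw.
have xu : x * u = (u + 1 *: 1) * x by apply: xt => //; rewrite scale1r.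
have xv : x * v = (v + 0 *: 1) * x by apply: xt => //; rewrite scale0r addr0.
have yv : y * v = (v + 1 *: 1) * y by apply: yt => //; rewrite scale1r.
have yu : y * u = (u + 0 *: 1) * y by apply: yt => //; rewrite scale0r addr0.
have [sE [hE sEall]] : exists t : 'End(D), invol t /\ forall r, r \in [:: w; v; u] -> t r = r.
  apply: (fix_step hD hC sCuv _ ww gz0 gzw) => r; rewrite !inE => /orP[] /eqP -> //.
have gx : grd u v w x 1 0 0 by split=> //; rewrite scale0r addr0.
have gy' : grd u v w y 0 1 0 by split=> //; rewrite scale0r addr0.
have gz' : grd u v w gz 0 0 1 by split; rewrite ?scale0r ?scale1r ?addr0.
apply: (ex_tower hD uu vv ww vu wu wv _ x0 y0 gz0 gx gy' gz' hE); last 3 first.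
- by apply: sEall; rewrite !inE eqxx !orbT.
- by apply: sEall; rewrite !inE eqxx !orbT.
- by apply: sEall; rewrite !inE eqxx.
move: xu xv yv yu; rewrite !scale1r !scale0r !addr0 => xu xv yv yu f [fu fv fw].
(* Each centraliser of the chain has at most half the dimension of the preceding one, and each
   adjunction at least doubles the dimension, so the field and its centraliser coincide in dimension
   8. *)
pose C1 : {aspace D} := 'C[u]%AS.
pose C2 := aspace_cap (algid_in hD C1 'C[v]%AS).
pose C3 := aspace_cap (algid_in hD C2 'C[w]%AS).
have C2P r : r \in C2 -> r * v = v * r by move=> /memv_capP[_ /cent1vP].
have C3P r : r \in C3 -> r * w = w * r by move=> /memv_capP[_ /cent1vP].
have d1 : (2 * \dim C1 <= 64)%N.
  rewrite -d64; apply: (proper_asp_dim hD (L := {:D}%AS) (x := x) (subvf _) (memvf _)).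
  by apply/negP => /cent1vP E; exact: (flips_neq hD x0 xu).
have d2 : (2 * \dim C2 <= \dim C1)%N.
  apply: (proper_asp_dim hD (K := C2) (L := C1) (x := y) (capvSl _ _)); first exact/cent1vP.
  by apply/negP => /C2P E; exact: (flips_neq hD y0 yv).
have d3 : (2 * \dim C3 <= \dim C2)%N.
  apply: (proper_asp_dim hD (K := C3) (L := C2) (x := gz) (capvSl _ _)); first by apply: in_cap; exact/cent1vP.
  by apply/negP => /C3P E; exact: (flips_neq hD gz0 gzw).
pose G1 := <<1; u>>%AS; pose G2 := <<G1; v>>%AS; pose G3 := <<G2; w>>%AS.
have adjK (K : {aspace D}) (U : {vspace D}) r : (U <= K)%VS -> r \in K -> (<<U; r>> <= K)%VS.
  move=> UK rK; apply: adjoin_ind => [|k t kU tK|t tK]; rewrite ?asp1 // memvM //.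
  exact: (subvP UK).
have one (K : {aspace D}) : (1 <= K)%VS by rewrite -memvE asp1.
have G1g g : g * u = u * g -> (G1 <= 'C[g])%VS by move=> gu; apply: (adjK 'C[g]%AS _ _ (one _)); apply/cent1vP.
have g1 : (2 <= \dim G1)%N.
  have : (2 * \dim (1%VS : {vspace D}) <= \dim G1)%N; last by rewrite dimv1.
  apply: (proper_asp_dim hD (K := 1%AS) (L := G1) (x := u) (one G1)); first exact: memv_adjoin.
  by apply: (not_in_gen x0 xu); exact: (one 'C[x]%AS).
have g2 : (2 * \dim G1 <= \dim G2)%N.
  apply: (proper_asp_dim hD (K := G1) (L := G2) (x := v)); [exact: subv_adjoin | exact: memv_adjoin|].
  exact: (not_in_gen y0 yv (G1g _ yu)).
have g3 : (2 * \dim G2 <= \dim G3)%N.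
  apply: (proper_asp_dim hD (K := G2) (L := G3) (x := w)); [exact: subv_adjoin | exact: memv_adjoin|].
  apply: (not_in_gen gz0 gzw); apply: (adjK 'C[gz]%AS); [exact: G1g | exact/cent1vP].
have G3C : (G3 <= C3)%VS.
  apply: (adjK C3); last by apply: in_cap; [apply: in_cap|]; exact/cent1vP.
  apply: (adjK C3); last by apply: in_cap; [apply: in_cap|]; exact/cent1vP.
  apply: (adjK C3); first exact: (one C3).
  by apply: in_cap; [apply: in_cap|]; exact/cent1vP.
have : (G3 == C3 :> {vspace D})%VS by rewrite eqEdim G3C; lia.
move/eqP => G3E; rewrite -[f \in _]/(f \in (G3 : {vspace D})) G3E.
by apply: in_cap; [apply: in_cap|]; exact/cent1vP.
Qed.
End Tower64.

(** * Fields of parameters *)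

Section Sspan.
Variables (F : fieldType) (A : falgType F).

Record subfield_pred (S : F -> Prop) : Prop := SubfieldPred {
  sf1 : S 1; sfB : forall a b, S a -> S b -> S (a - b);
  sfM : forall a b, S a -> S b -> S (a * b); sfV : forall a, S a -> S a^-1 }.

(** A span over the subfield cut out by [S], kept inside [F] so that [S] can vary. *)
Fixpoint sspan (S : F -> Prop) (X : seq A) (v : A) : Prop :=
  if X is x :: X' then exists c v', [/\ S c, sspan S X' v' & v = c *: x + v'] else v = 0.

Variables (S : F -> Prop) (hS : subfield_pred S).

Lemma sf0 : S 0. Proof. by rewrite -(subrr 1); apply: sfB hS _ _ _ _; exact: sf1. Qed.
Lemma sfN a : S a -> S (- a). Proof. by move=> Sa; rewrite -sub0r; apply: sfB => //; exact: sf0. Qed.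
Lemma sfD a b : S a -> S b -> S (a + b).
Proof. by move=> Sa Sb; rewrite -[b]opprK; apply: sfB => //; exact: sfN. Qed.

Lemma sspan0 X : sspan S X 0.
Proof. by elim: X => //= x X IH; exists 0, 0; split; rewrite ?scale0r ?addr0 //; exact: sf0. Qed.

Lemma sspanD X v w : sspan S X v -> sspan S X w -> sspan S X (v + w).
Proof.
elim: X v w => /= [v w -> ->|x X IH v w [c [v' [Sc Xv ->]]] [d [w' [Sd Xw ->]]]]; first by rewrite addr0.
exists (c + d), (v' + w'); split; [exact: sfD | exact: IH | by rewrite scalerDl addrACA].
Qed.

Lemma sspanZ X a v : S a -> sspan S X v -> sspan S X (a *: v).
Proof.
move=> Sa; elim: X v => /= [v ->|x X IH v [c [v' [Sc Xv ->]]]]; first by rewrite scaler0.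
by exists (a * c), (a *: v'); split; [exact: sfM | exact: IH | rewrite scalerDr scalerA].
Qed.

Lemma sspan_mem X x : x \in X -> sspan S X x.
Proof.
elim: X => //= y X IH; rewrite inE => /orP[/eqP -> |/IH Xx].
  by exists 1, 0; split; [exact: sf1 | exact: sspan0 | rewrite scale1r addr0].
by exists 0, x; split=> //; [exact: sf0 | rewrite scale0r add0r].
Qed.

Lemma sspan_ind X (P : A -> Prop) : P 0 -> (forall v w, P v -> P w -> P (v + w)) ->
  (forall a v, S a -> P v -> P (a *: v)) -> (forall x, x \in X -> P x) -> forall v, sspan S X v -> P v.
Proof.
move=> P0 PD PZ; elim: X => /= [_ v -> //|x X IH PX v [c [v' [Sc Xv ->]]]].
apply: PD; first by apply: PZ => //; apply: PX; rewrite inE eqxx.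
by apply: IH Xv => y yX; apply: PX; rewrite inE yX orbT.
Qed.

Lemma sspan_sub X Y : {subset X <= Y} -> forall v, sspan S X v -> sspan S Y v.
Proof.
move=> XY; apply: sspan_ind; [exact: sspan0 | exact: sspanD | exact: sspanZ |].
by move=> x /XY; exact: sspan_mem.
Qed.

Definition stab X p := forall v, sspan S X v -> sspan S X (p * v).

Lemma stab_gen X p : (forall x, x \in X -> sspan S X (p * x)) -> stab X p.
Proof.
move=> h; apply: sspan_ind => //; first by rewrite mulr0; exact: sspan0.
- by move=> v w; rewrite mulrDr; exact: sspanD.
- by move=> a v Sa; rewrite -scalerAr; exact: sspanZ.
Qed.

Lemma stabM X p q : stab X p -> stab X q -> stab X (p * q).
Proof. by move=> hp hq v Xv; rewrite -mulrA; apply/hp/hq. Qed.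

Lemma stabD X p q : stab X p -> stab X q -> stab X (p + q).
Proof. by move=> hp hq v Xv; rewrite mulrDl; apply: sspanD; [exact: hp | exact: hq]. Qed.

Lemma stabZ X a p : S a -> stab X p -> stab X (a *: p).
Proof. by move=> Sa hp v Xv; rewrite -scalerAl; apply: sspanZ => //; exact: hp. Qed.

Lemma stab1 X : stab X 1. Proof. by move=> v; rewrite mul1r. Qed.

(** Iterated over the generators, starting from 1, this lists the monomial basis. *)
Definition dbl (p : A) (X : seq A) := X ++ [seq p * x | x <- X].

Lemma dbl_ind p X (Q : A -> Prop) : (forall x, x \in X -> Q x) -> (forall x, Q x -> Q (p * x)) ->
  forall x, x \in dbl p X -> Q x.
Proof. by move=> QX Qp x; rewrite mem_cat => /orP[/QX //|/mapP[y /QX yX ->]]; exact: Qp. Qed.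

Lemma sspan_dbl_l p X v : sspan S X v -> sspan S (dbl p X) v.
Proof. by apply: sspan_sub => x xX; rewrite mem_cat xX. Qed.

Lemma sspan_dbl_r p X v : sspan S X v -> sspan S (dbl p X) (p * v).
Proof.
move: v; apply: sspan_ind; first by rewrite mulr0; exact: sspan0.
- by move=> v w; rewrite mulrDr; exact: sspanD.
- by move=> a v Sa; rewrite -scalerAr; exact: sspanZ.
by move=> x xX; apply: sspan_mem; rewrite mem_cat map_f ?orbT.
Qed.

Lemma stab_dbl X p q q' : stab X q -> stab X q' -> q * p = p * q' -> stab (dbl p X) q.
Proof.
move=> hq hq' E; apply: stab_gen => x; rewrite mem_cat => /orP[xX|/mapP[y yX ->]].
  by apply: sspan_dbl_l; apply: hq; exact: sspan_mem.
by rewrite mulrA E -mulrA; apply: sspan_dbl_r; apply: hq'; exact: sspan_mem.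
Qed.

Lemma stab_dbl_self X p r0 r1 : stab X r0 -> stab X r1 -> p * p = p * r1 + r0 -> stab (dbl p X) p.
Proof.
move=> h0 h1 E; apply: stab_gen => x; rewrite mem_cat => /orP[xX|/mapP[y yX ->]].
  by apply: sspan_dbl_r; exact: sspan_mem.
rewrite mulrA E mulrDl -mulrA; apply: sspanD.
  by apply: sspan_dbl_r; apply: h1; exact: sspan_mem.
by apply: sspan_dbl_l; apply: h0; exact: sspan_mem.
Qed.
End Sspan.

(* Every field of parameters containing the nine scalars [T i] supports a form of [A]
   that is stable under the anti-automorphism [s]. *)
Definition nine_parameters (F : fieldType) (A : falgType F) :=
  exists (T : 'I_9 -> F) (s : 'End(A)) (X : seq A), [/\ antim s, basis_of {:A} X &
    forall S : F -> Prop, subfield_pred S -> (forall i, S (T i)) ->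
      [/\ sspan S X 1, (forall x y, x \in X -> y \in X -> sspan S X (x * y)) &
          (forall x, x \in X -> sspan S X (s x))]].

Section TowerSpan.
Variables (F : fieldType) (D : falgType F) (hD : csdiv D).
Let h2 := cs2 hD.

Lemma free_dbl (p : D) X : p != 0 -> free X ->
  (forall a b, a \in <<X>>%VS -> b \in <<X>>%VS -> a + p * b = 0 -> b = 0) -> free (dbl p X).
Proof.
move=> p0 fX h; rewrite cat_free fX /=.
have lE : [seq p * x | x <- X] = map (amull p) X by apply: eq_map => x; rewrite lfunE.
have l0 : lker (amull p) == 0%VS by rewrite lker0_amull // (csU hD).
have fpX : free [seq p * x | x <- X].
  rewrite /free lE -limg_span size_map; have := fX; rewrite /free => /eqP <-.
  by apply/eqP; rewrite -[LHS]/(\dim _) limg_dim_eq // (eqP l0) capv0.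
rewrite fpX /=; apply/directv_addP/eqP; rewrite -subv0; apply/subvP => x.
rewrite memv_cap lE -limg_span => /andP[xX /memv_imgP[b bX xE]].
rewrite lfunE /= in xE; have b0 : b = 0 by apply: (h x b) => //; rewrite -xE h2.
by rewrite xE b0 mulr0 mem0v.
Qed.

Lemma span_comm (X : seq D) t : (forall x, x \in X -> x * t = t * x) -> forall a, a \in <<X>>%VS -> a * t = t * a.
Proof.
move=> h a; have /subvP s : (<<X>> <= 'C[t])%VS by apply/span_subvP => x /h E; exact/cent1vP.
by move/s/cent1vP.
Qed.

(** [ad t] annihilates the span of [X] and is the identity on [p] times it, which separates the two
    halves. *)
Lemma free_dbl_flip (p t : D) X : p != 0 -> free X -> (forall x, x \in X -> x * t = t * x) ->
  p * t = (t + 1) * p -> free (dbl p X).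
Proof.
move=> p0 fX Xt pt; apply: free_dbl => // a b /(span_comm Xt) at_ /(span_comm Xt) bt E.
suff : p * b = 0 by case/(cs_mul0 hD) => // p00; rewrite p00 eqxx in p0.
have -> : p * b = t * (a + p * b) + (a + p * b) * t by nc h2 (at_, bt, pt).
by rewrite E mulr0 mul0r addr0.
Qed.

Lemma free_dbl_flipped (p g : D) X : p != 0 -> g != 0 -> free X -> (forall x, x \in X -> x * g = g * x) ->
  g * p = (p + 1) * g -> free (dbl p X).
Proof.
move=> p0 g0 fX Xg gp; apply: free_dbl => // a b /(span_comm Xg) ag /(span_comm Xg) bg E.
suff : g * b = 0 by case/(cs_mul0 hD) => // g00; rewrite g00 eqxx in g0.
have ga := esym ag; have gb := esym bg.
have -> : g * b = g * (a + p * b) + (a + p * b) * g by nc h2 (ga, gb, gp).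
by rewrite E mulr0 mul0r addr0.
Qed.

Variables (u v w x y z : D) (a b c e0 e1 f0 f1 m0 m1 l0 l1 q0 q1 : F) (s : 'End(D)).
Hypothesis tw : tower u v w x y z a b c e0 e1 f0 f1 m0 m1 l0 l1 q0 q1 s.

(** The norm of [p0 + p1 X] from the quadratic extension [X ^+ 2 = X + t]. *)
Definition nrm (p0 p1 t : F) := p0 * p0 + p0 * p1 + p1 * p1 * t.

(** The symmetry between [(v, y)] and [(w, z)] transfers each result on [x] and [y] to [x] and
    [z]. *)
Lemma tower_swap : tower u w v x z y a c b f0 f1 e0 e1 l0 l1 m0 m1 q0 q1 s.
Proof.
case: tw => uu vv ww vu wu wv xu xv xw yu yv yw zu zv zw zy x0 y0 z0 Y Z M L Q sa [su sv sw [sx sy sz]].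
have Q' : x * z * y * (x * z * y) = q0 *: 1 + q1 *: (w + v).
  by rewrite [w + v]addrC -Q; nc h2 zy.
by split=> //; apply/esym.
Qed.

Let uu := tw_uu tw. Let vv := tw_vv tw. Let ww := tw_ww tw.
Let vu := tw_vu tw. Let wu := tw_wu tw. Let wv := tw_wv tw.
Let xu := tw_xu tw. Let xv := tw_xv tw. Let xw := tw_xw tw.
Let yu := tw_yu tw. Let yv := tw_yv tw. Let yw := tw_yw tw.
Let zy := tw_zy tw.
Let x0 := tw_x0 tw. Let y0 := tw_y0 tw. Let z0 := tw_z0 tw.
Let Y := tw_Y tw. Let L := tw_L tw. Let Q := tw_Q tw. Let M := tw_M tw.

Let Yc : D := e0 *: 1 + e1 *: (u + 1).
Let Lc : D := l0 *: 1 + l1 *: (v + 1).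
Let Qc : D := q0 *: 1 + q1 *: (v + w + 1).
Let ny := nrm e0 e1 a. Let nl := nrm l0 l1 b. Let nq := nrm q0 q1 (b + c).

Lemma nrm_neq0 (t g r : D) p0 p1 d : t * t = t + d *: 1 -> g != 0 -> g * t = (t + 1) * g -> r != 0 ->
  r = p0 *: 1 + p1 *: t -> nrm p0 p1 d != 0.
Proof.
move=> tt g0 gt rn rE; apply/eqP => n0.
have : r * (p0 *: 1 + p1 *: (t + 1)) = nrm p0 p1 d *: 1 by rewrite rE /nrm; nc h2 tt.
rewrite n0 scale0r => /(cs_mul0 hD)[r0|c0]; first by rewrite r0 eqxx in rn.
have : g * r = 0.
  by transitivity ((p0 *: 1 + p1 *: (t + 1)) * g); [rewrite rE; nc h2 gt | rewrite c0 mul0r].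
by case/(cs_mul0 hD) => [E|E]; [rewrite E eqxx in g0 | rewrite E eqxx in rn].
Qed.

(** As [z] commutes with [y], substituting [z * x * z = x^-1 * (l0 + l1 v)] in the square of
    [x * y * z] eliminates [z] and leaves a commutation rule for [x] and [y]. Moving [x] past
    [y * y] by applying it twice, and comparing with the known [y * y], gives the norm relation. *)
Lemma tower_yx0 : nq *: (y * x) = x * Qc * Yc * Lc * y /\ nq != 0 /\ nq = ny * nl.
Proof.
have xU := csU hD x0; pose xi := x^-1.
have xix : x * xi = 1 by rewrite mulrV.
have xix' : xi * x = 1 by rewrite /xi mulVr.
have zxz : z * x * z = xi * (l0 *: 1 + l1 *: v).
  by rewrite -L; nc h2 xix'.
have nyn : ny != 0 := nrm_neq0 uu x0 xu (cs_mul_neq0 hD y0 y0) Y.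
have nln : nl != 0 := nrm_neq0 vv y0 yv (cs_mul_neq0 hD (cs_mul_neq0 hD x0 z0) (cs_mul_neq0 hD x0 z0)) L.
have xyz0 : x * y * z != 0 by rewrite !(cs_mul_neq0 hD).
have vw2 : (v + w) * (v + w) = v + w + (b + c) *: 1 by nc h2 (vv, ww, wv).
have nqn : nq != 0.
  by apply: (nrm_neq0 vw2 y0 _ (cs_mul_neq0 hD xyz0 xyz0) Q); nc h2 (yv, yw).
have E1 : x * y * xi * (l0 *: 1 + l1 *: v) * y = q0 *: 1 + q1 *: (v + w).
  rewrite -Q -(mulrA _ xi) -zxz !mulrA; nc h2 zy.
have xiu : xi * u = (u + 1) * xi := flips_inv hD x0 xu.
have xiv : xi * v = v * xi := comm_inv hD x0 xv.
have xiw : xi * w = w * xi := comm_inv hD x0 xw.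
have E2 : (ny * nl) *: (x * y) = (q0 *: 1 + q1 *: (v + w)) * y * x * Lc * (e0 *: 1 + e1 *: u).
  rewrite -E1 /ny /nl /nrm /Lc; nc h2 (uu, vv, vu, wu, wv, xu, xv, xw, yu, yv, yw, xiu, xiv, xiw, xix', xix, Y).
have Eyx : nq *: (y * x) = x * Qc * Yc * Lc * y.
  have nyl : ny * nl != 0 by rewrite mulf_neq0.
  have K : (nq * (ny * nl)) *: (y * x) = (ny * nl) *: (x * Qc * Yc * Lc * y).
    have -> : (ny * nl) *: (x * Qc * Yc * Lc * y) = Qc * ((ny * nl) *: (x * y)) * Yc * (l0 *: 1 + l1 *: v).
      by rewrite /Qc /Yc /Lc; nc h2 (uu, vv, ww, vu, wu, wv, xu, xv, xw, yu, yv, yw).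
    rewrite E2 /nq /ny /nl /nrm /Qc /Yc /Lc.
    nc h2 (uu, vv, ww, vu, wu, wv, xu, xv, xw, yu, yv, yw).
  by apply: (can_inj (scalerK nyl)); rewrite -K scalerA mulrC.
split=> //; split=> //.
have E3 : (nq * nq) *: (y * y * x) = (nq * nl) *: (x * Yc * Yc * (e0 *: 1 + e1 *: u)).
  transitivity (nq *: (y * (nq *: (y * x)))); first by nc h2 tt.
  rewrite Eyx; transitivity (nq *: (y * x) * (Qc * Yc * Lc * y)); first by rewrite -!scalerAl; congr (_ *: _); rewrite !mulrA.
  rewrite Eyx -Y /nq /nl /nrm /Qc /Yc /Lc.
  nc h2 (uu, vv, ww, vu, wu, wv, xu, xv, xw, yu, yv, yw).
have E4 : x * Yc * Yc * (e0 *: 1 + e1 *: u) = ny *: (y * y * x).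
  by rewrite Y /ny /nrm /Yc; nc h2 (uu, xu).
move: E3; rewrite E4 scalerA => /eqP; rewrite -subr_eq0 -scalerBl scaler_eq0.
rewrite (negbTE (cs_mul_neq0 hD (cs_mul_neq0 hD y0 y0) x0)) orbF subr_eq0 -mulrA => /eqP /(mulfI nqn) ->.
by rewrite mulrC.
Qed.

(** The rule for [y * x] eliminates [y] from the square of [x * y]. *)
Lemma tower_xx : nq *: (x * x) = (m0 *: 1 + m1 *: w) * (l0 *: 1 + l1 *: v) * (q0 *: 1 + q1 *: (v + w)).
Proof.
have [Eyx [nqn nE]] := tower_yx0.
rewrite -M; apply: esym; transitivity (nq^-1 *: (x * (nq *: (y * x)) * y * (l0 *: 1 + l1 *: v) * (q0 *: 1 + q1 *: (v + w)))).
  by rewrite -scalerAr -!scalerAl scalerK // !mulrA.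
rewrite Eyx; apply: (can_inj (scalerK nqn)); rewrite scalerA mulfV // scale1r.
transitivity ((nq * (ny * nl)) *: (x * x)); last by rewrite -nE scalerA.
rewrite /nq /ny /nl /nrm /Qc /Yc /Lc.
nc h2 (uu, vv, ww, vu, wu, wv, xu, xv, xw, yu, yv, yw, Y).
Qed.
End TowerSpan.

Section NineTower.
Variables (F : fieldType) (D : falgType F) (hD : csdiv D).
Let h2 := cs2 hD.

Lemma flip_neq0 (g t : D) : g != 0 -> g * t = (t + 1) * g -> t != 0.
Proof.
by move=> g0 gt; apply: contraNneq g0 => t0; move: gt; rewrite t0 mulr0 add0r mul1r => <-.
Qed.

Lemma dbl_comm (g p : D) X : p * g = g * p -> (forall x, x \in X -> x * g = g * x) ->
  forall x, x \in dbl p X -> x * g = g * x.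
Proof. by move=> pg Xg; apply: dbl_ind => // x xg; nc h2 (xg, pg). Qed.

Lemma gen_sspan S (gs : seq D) (s : 'End(D)) : subfield_pred S -> antim s -> (forall g, g \in gs -> s g = g) ->
  let X := foldr (@dbl F D) [:: 1] gs in (forall g, g \in gs -> stab S X g) ->
  [/\ sspan S X 1, (forall g h, g \in X -> h \in X -> sspan S X (g * h)) & (forall g, g \in X -> sspan S X (s g))].
Proof.
move=> hS sa fixs X gst.
have X1 : sspan S X 1.
  apply: (sspan_mem hS); rewrite /X; elim: (gs) => [|g gs' IH] /=; first by rewrite inE.
  by rewrite mem_cat IH.
have XI (P : D -> Prop) : P 1 -> (forall p t, p \in gs -> P t -> P (p * t)) -> forall t, t \in X -> P t.
  move=> P1; rewrite /X; elim: (gs) => [|g gs' IH] Pp t /=; first by rewrite inE => /eqP ->.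
  move: t; apply: dbl_ind => [|t]; last by apply: Pp; rewrite inE eqxx.
  by apply: IH => p t pg; apply: Pp; rewrite inE pg orbT.
have Xst t : t \in X -> stab S X t.
  by apply: XI => [|p r /gst pS]; [exact: stab1 | exact: stabM].
split=> // [g h gX hX|]; first by apply: Xst => //; exact: (sspan_mem hS).
apply: XI; first by rewrite (proj2 sa).
move=> p t pG; rewrite (proj1 sa) (fixs _ pG); move: (s t) => r.
move: r; apply: (sspan_ind (S := S)).
- by rewrite mul0r; exact: sspan0.
- by move=> r r'; rewrite mulrDl; exact: sspanD.
- by move=> k r Sk; rewrite -scalerAl; exact: sspanZ.
by move=> r rX; apply: (Xst r rX); rewrite -[p]mulr1; apply: gst.
Qed.

Section Fixed.
Variables (u v w x y z : D) (a b c e0 e1 f0 f1 m0 m1 l0 l1 q0 q1 : F) (s : 'End(D)).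
Hypothesis tw : tower u v w x y z a b c e0 e1 f0 f1 m0 m1 l0 l1 q0 q1 s.

Lemma tower_shift_u k : tower (u + k *: 1) v w x y z (a + k * k + k) b c (e0 + e1 * k) e1 (f0 + f1 * k) f1
  m0 m1 l0 l1 q0 q1 s.
Proof.
case: tw => uu vv ww vu wu wv xu xv xw yu yv yw zu zv zw zy x0 y0 z0 Y Z M L Q sa [su sv sw [sx sy sz]].
split=> //; first [by nc h2 uu | by nc h2 vu | by nc h2 wu | by nc h2 xu | by nc h2 yu | by nc h2 zu |
  by rewrite Y; nc h2 tt | by rewrite Z; nc h2 tt | split=> //].
by rewrite linearD linearZ /= su (proj2 sa).
Qed.

Lemma tower_shift_v k : tower u (v + k *: 1) w x y z a (b + k * k + k) c e0 e1 f0 f1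
  m0 m1 (l0 + l1 * k) l1 (q0 + q1 * k) q1 s.
Proof.
case: tw => uu vv ww vu wu wv xu xv xw yu yv yw zu zv zw zy x0 y0 z0 Y Z M L Q sa [su sv sw [sx sy sz]].
split=> //; first [by nc h2 vv | by nc h2 vu | by nc h2 wv | by nc h2 xv | by nc h2 yv | by nc h2 zv |
  by rewrite L; nc h2 tt | by rewrite Q; nc h2 tt | split=> //].
by rewrite linearD linearZ /= sv (proj2 sa).
Qed.

Lemma tower_sspan S : subfield_pred S -> S a -> S b -> S c -> S e0 -> S e1 -> S f0 -> S f1 ->
  S m0 -> S m1 -> S l0 -> S l1 -> S q0 -> S q1 ->
  let X := dbl x (dbl y (dbl z (dbl u (dbl v (dbl w [:: 1]))))) in
  [/\ sspan S X 1, (forall g h, g \in X -> h \in X -> sspan S X (g * h)) & (forall g, g \in X -> sspan S X (s g))].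
Proof.
move=> hS Sa Sb Sc Se0 Se1 Sf0 Sf1 Sm0 Sm1 Sl0 Sl1 Sq0 Sq1.
have [Eyx [nqn _]] := tower_yx0 hD tw.
have [Ezx [nqn' _]] := tower_yx0 hD (tower_swap hD tw).
have Exx := tower_xx hD tw.
case: (tw) => uu vv ww vu wu wv xu xv xw yu yv yw zu zv zw zy x0 y0 z0 Y Z M L Q sa [su sv sw [sx sy sz]].
have S0 := sf0 hS; have S1 := sf1 hS; have SD := sfD hS; have SM := sfM hS.
have Snq : S (nrm q0 q1 (b + c))^-1 by apply: (sfV hS); rewrite /nrm; do ?[apply: (SD) | apply: (SM)].
have Snq' : S (nrm q0 q1 (c + b))^-1 by apply: (sfV hS); rewrite /nrm; do ?[apply: (SD) | apply: (SM)].
pose X0 : seq D := [:: 1]; pose Xw := dbl w X0; pose Xv := dbl v Xw; pose Xu := dbl u Xv.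
pose Xz := dbl z Xu; pose Xy := dbl y Xz; pose X := dbl x Xy.
have st1 (W : seq D) : stab S W 1 by exact: stab1.
have stM (W : seq D) (p q : D) : stab S W p -> stab S W q -> stab S W (p * q) by exact: stabM.
have stD (W : seq D) (p q : D) : stab S W p -> stab S W q -> stab S W (p + q) by exact: stabD.
have stZ (W : seq D) k (p : D) : S k -> stab S W p -> stab S W (k *: p) by exact: stabZ.
have st_lin (W : seq D) (t : D) p0 p1 : stab S W t -> S p0 -> S p1 -> stab S W (p0 *: (1 : D) + p1 *: t).
  by move=> h h0 h1; apply: (stD); apply: (stZ).
have stS (W : seq D) k : S k -> stab S W (k *: (1 : D)) by move=> Sk; apply: (stZ).
have selfAS (W : seq D) (t : D) d : t * t = t + d *: 1 -> S d -> stab S (dbl t W) t.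
  by move=> tt Sd; apply: (stab_dbl_self hS (r0 := d *: 1) (r1 := 1)) => //; [exact: stS | rewrite mulr1].
have comm W (t p : D) : stab S W t -> t * p = p * t -> stab S (dbl p W) t by move=> h; exact: stab_dbl.
have ww1 : stab S Xw w by exact: selfAS ww Sc.
have vv1 : stab S Xv v by exact: selfAS vv Sb.
have vw1 : stab S Xv w by exact: comm wv.
have uu1 : stab S Xu u by exact: selfAS uu Sa.
have uv1 : stab S Xu v by exact: comm vu.
have uw1 : stab S Xu w by exact: comm wu.
have flip W (t p : D) : stab S W t -> p * t = (t + 1) * p -> stab S (dbl p W) t.
  move=> h E; have h1 : stab S W (t + 1) by apply: (stD).
  apply: (stab_dbl (q' := t + 1) hS) => //; nc h2 E.
have zu1 : stab S Xz u by apply: (comm).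
have zv1 : stab S Xz v by apply: (comm).
have zw1 : stab S Xz w by apply: (flip).
have stab0 (W : seq D) : stab S W 0 by rewrite -(scale0r (1 : D)); exact: stS.
have zz1 : stab S Xz z.
  by apply: (stab_dbl_self hS (st_lin _ _ _ _ uu1 Sf0 Sf1) (stab0 _)); rewrite mulr0 add0r.
have yu1 : stab S Xy u by apply: (comm).
have yv1 : stab S Xy v by apply: (flip).
have yw1 : stab S Xy w by apply: (comm).
have yz1 : stab S Xy z by apply: (comm).
have yy1 : stab S Xy y.
  by apply: (stab_dbl_self hS (st_lin _ _ _ _ zu1 Se0 Se1) (stab0 _)); rewrite mulr0 add0r.
have xu1 : stab S X u by apply: (flip).
have xv1 : stab S X v by apply: (comm).
have xw1 : stab S X w by apply: (comm).
have xy1 : stab S X y.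
  apply: (stab_dbl hS yy1 (q' := (nrm q0 q1 (b + c))^-1 *: ((q0 *: 1 + q1 *: (v + w + 1)) *
     (e0 *: 1 + e1 *: (u + 1)) * (l0 *: 1 + l1 *: (v + 1)) * y))).
    by do ?[apply: (stZ) | apply: (stM) | apply: (stD)].
  by rewrite -scalerAr !mulrA -Eyx scalerK.
have xz1 : stab S X z.
  apply: (stab_dbl hS yz1 (q' := (nrm q0 q1 (c + b))^-1 *: ((q0 *: 1 + q1 *: (w + v + 1)) *
     (f0 *: 1 + f1 *: (u + 1)) * (m0 *: 1 + m1 *: (w + 1)) * z))).
    by do ?[apply: (stZ) | apply: (stM) | apply: (stD)].
  by rewrite -scalerAr !mulrA -Ezx scalerK.
have xx1 : stab S X x.
  apply: (stab_dbl_self hS (r1 := 0) (r0 := (nrm q0 q1 (b + c))^-1 *: ((m0 *: 1 + m1 *: w) * (l0 *: 1 + l1 *: v) * (q0 *: 1 + q1 *: (v + w))))) => //.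
    by do ?[apply: (stZ) | apply: (stM) | apply: (stD)].
  by rewrite mulr0 add0r -Exx scalerK.
by apply: (gen_sspan (gs := [:: x; y; z; u; v; w]) hS sa) => g; rewrite !inE; do 5? [case/predU1P => [-> //|]]; move/eqP ->.
Qed.

Lemma tower_basis : \dim {:D} = 64%N -> basis_of {:D} (dbl x (dbl y (dbl z (dbl u (dbl v (dbl w [:: 1])))))).
Proof.
move=> d64.
case: (tw) => uu vv ww vu wu wv xu xv xw yu yv yw zu zv zw zy x0 y0 z0 Y Z M L Q sa sfix.
have o1 g : forall t : D, t \in [:: 1] -> t * g = g * t by move=> t; rewrite inE => /eqP ->; rewrite mul1r mulr1.
have fr : free (dbl x (dbl y (dbl z (dbl u (dbl v (dbl w [:: 1])))))).
  apply: (free_dbl_flip hD x0 _ _ xu); last by do 5![apply: dbl_comm => //]; exact: o1.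
  apply: (free_dbl_flip hD y0 _ _ yv); last by do 4![apply: dbl_comm => //]; exact: o1.
  apply: (free_dbl_flip hD z0 _ _ zw); last by do 3![apply: dbl_comm => //]; exact: o1.
  apply: (free_dbl_flipped hD (flip_neq0 x0 xu) x0 _ _ xu); last by do 2![apply: dbl_comm => //]; exact: o1.
  apply: (free_dbl_flipped hD (flip_neq0 y0 yv) y0 _ _ yv); last by do 1![apply: dbl_comm => //]; exact: o1.
  apply: (free_dbl_flipped hD (flip_neq0 z0 zw) z0 _ _ zw); last exact: o1.
  by rewrite seq1_free oner_neq0.
apply/andP; split=> //; rewrite eqEdim subvf /= d64.
by move: fr => /eqnP ->; rewrite /dbl ?(size_cat, size_map).
Qed.

Lemma tower_norm : nrm q0 q1 (b + c) = nrm e0 e1 a * nrm l0 l1 b /\ nrm l0 l1 b != 0.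
Proof. by have [_ [n0 E]] := tower_yx0 hD tw; split=> //; move: n0; rewrite E mulf_eq0 negb_or => /andP[]. Qed.
End Fixed.

Definition nine (r0 r1 r2 r3 r4 r5 r6 r7 r8 : F) (i : 'I_9) : F := [:: r0; r1; r2; r3; r4; r5; r6; r7; r8]`_i.

Lemma nineP (S : F -> Prop) r0 r1 r2 r3 r4 r5 r6 r7 r8 : (forall i, S (nine r0 r1 r2 r3 r4 r5 r6 r7 r8 i)) ->
  [/\ S r0, S r1, S r2 & [/\ S r3, S r4, S r5 & [/\ S r6, S r7 & S r8]]].
Proof.
move=> h; have H k : (k < 9)%N -> S ([:: r0; r1; r2; r3; r4; r5; r6; r7; r8]`_k).
  by move=> k9; exact: (h (Ordinal k9)).
by split; [exact: (H 0%N) | exact: (H 1%N) | exact: (H 2%N) | split; [exact: (H 3%N) | exact: (H 4%N) | exact: (H 5%N) |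
  split; [exact: (H 6%N) | exact: (H 7%N) | exact: (H 8%N)]]].
Qed.

(** A pair of coefficients one of which is zero counts as a single parameter, their sum. *)
Lemma nine_split (S : F -> Prop) p q : subfield_pred S -> p = 0 \/ q = 0 -> S (p + q) -> S p /\ S q.
Proof. by move=> hS [->|->]; rewrite ?add0r ?addr0; split=> //; exact: sf0 hS. Qed.

Lemma shift_zero (p q : F) : exists k, p + q * k = 0 \/ q = 0.
Proof.
have [->|q0] := eqVneq q 0; first by exists 0; right.
exists (q^-1 * p); left; by rewrite mulVKf // (csF2 hD).
Qed.

(* Adding scalars to [u], [v], [w] kills one coefficient of [y * y], [x * z * (x * z)] and
   [x * y * (x * y)]; when [e1 != 0] the norm relation [tower_norm] moreover determines [a]. *)
Lemma tower_nine u v w x y z a b c e0 e1 f0 f1 m0 m1 l0 l1 q0 q1 s : \dim {:D} = 64%N ->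
  @tower F D u v w x y z a b c e0 e1 f0 f1 m0 m1 l0 l1 q0 q1 s -> nine_parameters D.
Proof.
move=> d64.
wlog eZ : u v w x y z a b c e0 e1 f0 f1 m0 m1 l0 l1 q0 q1 / e1 = 0 -> f1 = 0.
  move=> W tw; have [f10|f10] := eqVneq f1 0; first exact: (W _ _ _ _ _ _ _ _ _ _ _ _ _ _ _ _ _ _ _ _ tw).
  have [e10|e10] := eqVneq e1 0; last by apply: (W _ _ _ _ _ _ _ _ _ _ _ _ _ _ _ _ _ _ _ _ tw) => e1z; rewrite e1z eqxx in e10.
  by apply: (W _ _ _ _ _ _ _ _ _ _ _ _ _ _ _ _ _ _ _ _ (tower_swap hD tw)) => f1z; rewrite f1z eqxx in f10.
move=> tw; have [k hk] := shift_zero e0 e1; have {tw} := tower_shift_u tw k; move: (u + _) (a + _ + _) (e0 + _) (f0 + _) hk => {u a e0 f0 k} u a e0 f0 he tw.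
have [k hk] := shift_zero l0 l1; have {tw} := tower_shift_v tw k; move: (v + _) (b + _ + _) (l0 + _) (q0 + _) hk => {v b l0 q0 k} v b l0 q0 hl tw.
have [k hk] := shift_zero m0 m1; have {tw} := tower_swap hD (tower_shift_v (tower_swap hD tw) k); move: (w + _) (c + _ + _) (m0 + _) (q0 + _) hk => {w c m0 q0 k} w c m0 q0 hm tw.
have [nE nl0] := tower_norm tw.
(* If [e1 = 0] then [f1 = 0] too, by the reduction above, so [y * y] and [z * z] are scalar and nine
   coefficients are left, [a] among them. *)
have [e10|e10] := eqVneq e1 0.
  exists (nine a b c e0 f0 (l0 + l1) (m0 + m1) q0 q1), s, (dbl x (dbl y (dbl z (dbl u (dbl v (dbl w [:: 1])))))).
  split; [exact: tw_s tw | exact: tower_basis tw d64 |] => S hS /nineP[Sa Sb Sc [Se Sf Sl [Sm Sq0 Sq1]]].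
  have [Sl0 Sl1] := nine_split hS hl Sl; have [Sm0 Sm1] := nine_split hS hm Sm.
  by apply: (tower_sspan tw hS) => //; rewrite ?eZ ?e10 //; exact: sf0 hS.
have e00 : e0 = 0 by case: he => // e1z; rewrite e1z eqxx in e10.
exists (nine b c e1 f0 f1 (l0 + l1) (m0 + m1) q0 q1), s, (dbl x (dbl y (dbl z (dbl u (dbl v (dbl w [:: 1])))))).
split; [exact: tw_s tw | exact: tower_basis tw d64 |] => S hS /nineP[Sb Sc Se [Sf0 Sf1 Sl [Sm Sq0 Sq1]]].
have [Sl0 Sl1] := nine_split hS hl Sl; have [Sm0 Sm1] := nine_split hS hm Sm.
have Sa : S a.
  have -> : a = nrm q0 q1 (b + c) * (e1 * e1 * nrm l0 l1 b)^-1.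
    by rewrite nE /nrm e00 !mul0r !add0r [e1 * e1 * a]mulrC; field; rewrite e10 -/(nrm l0 l1 b) nl0.
  have SD := sfD hS; have SM := sfM hS.
  by apply: (SM); [|apply: (sfV hS)]; rewrite /nrm; do ?[apply: (SD) | apply: (SM)].
by apply: (tower_sspan tw hS) => //; rewrite ?e00 //; exact: sf0 hS.
Qed.

Lemma degree8_nine (s : 'End(D)) : \dim {:D} = 64%N -> symp s -> nine_parameters D.
Proof.
move=> d64 hs; have [u [v [w [x [y [z [a [b [c [e0 [e1 [f0 [f1 [m0 [m1 [l0 [l1 [q0 [q1 [t tw]]]]]]]]]]]]]]]]]]]] := ex_tower64 hD d64 hs.
exact: tower_nine d64 tw.
Qed.
End NineTower.

(** * Degrees 4, 2 and 1 *)

Section SmallDegree.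
Variables (F : fieldType) (D : falgType F) (hD : csdiv D).
Let h2 := cs2 hD.

Lemma size_dbl (p : D) X : size (dbl p X) = (2 * size X)%N.
Proof. by rewrite size_cat size_map mul2n addnn. Qed.

Lemma quadratic_as (y : D) al be : y * y = al *: 1 + be *: y -> be != 0 -> ~ scalar y -> artin_schreier (be^-1 *: y).
Proof.
move=> yy be0 yF; split=> [[k yk]|].
  by apply: yF; exists (be * k); rewrite -[y](scalerKV be0) yk scalerA.
exists (be^-1 * be^-1 * al); rewrite -scalerAl -scalerAr yy !scalerDr !scalerA.
by rewrite mulrVK ?unitfE // addrC.
Qed.

(** [d] has commutator 1 with [b]. If both have scalar squares, [b * d] satisfies an Artin-Schreier
    equation; otherwise one of them can be scaled to do so. *)
Lemma as_of_quadratic (B : {aspace D}) b c : (forall y, y \in B -> quadratic y) -> b \in B -> c \in B ->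
  b * c != c * b -> exists v, v \in B /\ artin_schreier v.
Proof.
move=> qB bB cB bc.
have bF : ~ scalar b by move=> /scalarC E; rewrite E eqxx in bc.
have [al [be bb]] := qB b bB.
have [be0|be0] := eqVneq be 0; last by exists (be^-1 *: b); split; [exact: memvZ | exact: quadratic_as bb be0 bF].
rewrite be0 scale0r addr0 in bb.
pose e := b * c + c * b; have e0 : e != 0 by apply: contraNneq bc => /(add2_eq hD) ->.
have be_ : b * e = e * b by rewrite /e; nc h2 bb.
pose d := c * e^-1; have dB : d \in B by rewrite memvM // memvV rpredD ?memvM.
have bd : b * d = d * b + 1.
  have eb := comm_inv hD e0 (esym be_); have ee : e * e^-1 = 1 by rewrite mulrV // (csU hD).
  have E : b * c = e + c * b by rewrite /e; nc h2 tt.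
  by rewrite /d mulrA E mulrDl ee -!mulrA eb addrC.
have dF : ~ scalar d.
  move=> dS; have dC := scalarC b dS; suff /eqP : (1 : D) = 0 by rewrite oner_eq0.
  by rewrite -[RHS](h2 (b * d)) {1}bd dC; nc h2 tt.
have [ga [de dd]] := qB d dB.
have [de0|de0] := eqVneq de 0; last by exists (de^-1 *: d); split; [exact: memvZ | exact: quadratic_as dd de0 dF].
rewrite de0 scale0r addr0 in dd.
exists (b * d); split; first exact: memvM.
split; last by exists (al * ga); nc h2 (bb, dd, bd).
move=> dS; have E := scalarC d dS; have : d = 0 by rewrite -[RHS](h2 (b * d * d)) {2}E; nc h2 bd.
by move=> d0; apply: dF; exists 0; rewrite d0 scale0r.
Qed.

Lemma ex_sym_in (t : 'End(D)) (V : {vspace D}) g : invol t -> (forall d, d \in V -> t d \in V) -> g \in V ->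
  g != 0 -> exists q, [/\ q \in V, q != 0 & t q = q].
Proof.
move=> [_ tt'] tV gV g0; have [E|E] := eqVneq (g + t g) 0.
  by exists g; split=> //; apply/esym/(add2_eq hD).
by exists (g + t g); split=> //; [rewrite rpredD ?tV | rewrite linearD /= tt' addrC].
Qed.

Lemma noncomm_pair (B : {aspace D}) : (1 < \dim B)%N -> (forall t, t \in B ->
  (forall c, c \in B -> t * c = c * t) -> scalar t) -> exists b c, [/\ b \in B, c \in B & b * c != c * b].
Proof.
move=> B1 ZB; have [//|h] := EM (exists b c, [/\ b \in B, c \in B & b * c != c * b]).
have : (B <= 1)%VS.
  apply/subvP => b bB; apply/line1P/(ZB _ bB) => c cB.
  by apply/eqP/negPn/negP => bc; case: h; exists b, c.
by move/dimvS; rewrite dimv1 leqNgt B1.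
Qed.

Lemma quadratic_small (y : D) : (\dim <<1; y>>%VS <= 2)%N -> quadratic y.
Proof.
have [j _ [yj ->]] := pow_basis hD y; case: j yj => [|[|[|j]]] //= yj _.
- by move: yj; rewrite span_nil memv0 expr0 oner_eq0.
- move: yj; rewrite expr0 span_seq1 expr1 => /vlineP[k ->].
  by exists (k * k), 0; rewrite -scalerAl mul1r scalerA scale0r addr0.
move: yj; rewrite expr0 expr1 expr2 span_cons span_seq1 => /memv_addP[_ /vlineP[k ->] [_ /vlineP[l ->] E]].
by exists k, l.
Qed.

Lemma free_size (X : seq D) : free X -> (size X <= \dim {:D})%N.
Proof. by move/eqnP => <-; exact/dimvS/subvf. Qed.

Lemma free_basis (X : seq D) : free X -> size X = \dim {:D} -> basis_of {:D} X.
Proof. by move=> fX sX; apply/andP; split=> //; rewrite eqEdim subvf -sX (eqnP fX) /=. Qed.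

Lemma dbl_span p (X : seq D) f : f \in <<dbl p X>>%VS -> exists g h, [/\ g \in <<X>>%VS, h \in <<X>>%VS & f = g + p * h].
Proof.
rewrite span_cat => /memv_addP[g gX [k kX ->]].
have lE : [seq p * x | x <- X] = map (amull p) X by apply: eq_map => x; rewrite lfunE.
by move: kX; rewrite lE -limg_span => /memv_imgP[h hX ->]; exists g, h; split=> //; rewrite lfunE.
Qed.

Lemma span_one (f : D) : f \in span [:: (1 : D)] -> exists k : F, f = k *: 1.
Proof. by rewrite span_seq1 => /vlineP. Qed.

Lemma anti_flips (t : 'End(D)) u d k e : antim t -> t u = u + k *: 1 -> d * u = (u + e *: 1) * d ->
  t d * u = (u + e *: 1) * t d.
Proof.
move=> [tM t1] tu du; have := congr1 t du; rewrite !tM !linearD !linearZ /= tu t1 => E.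
have {}E : t d * u = (u + k *: 1) * t d + k *: t d + e *: t d by rewrite E; nc h2 tt.
by rewrite E; nc h2 tt.
Qed.

Lemma comm_basis (X : seq D) b : free X -> size X = \dim {:D} -> (forall t, t \in X -> t * b = b * t) -> scalar b.
Proof.
move=> fX sX Xb; apply: (csC hD) => y; apply: (span_comm Xb).
by have /andP[/eqP -> _] := free_basis fX sX; exact: memvf.
Qed.

Lemma quaternion_free (u x : D) (B : {vspace D}) : x != 0 -> x * u = (u + 1) * x ->
  (forall b, b \in B -> b * u = u * b /\ b * x = x * b) -> free (dbl x (dbl u (vbasis B))).
Proof.
move=> x0 xu hB; apply: (free_dbl_flip hD x0 _ _ xu); last first.
  by apply: dbl_comm => // t /vbasis_mem /hB[].
apply: (free_dbl_flipped hD (flip_neq0 x0 xu) x0 _ _ xu); first exact: basis_free (vbasisP _).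
by move=> t /vbasis_mem /hB[].
Qed.

(** By dimension, the products of [1], [u], [x], [x * u] with a basis of [B] form a basis of [D],
    and [b] commutes with all of them. *)
Lemma centralizer_scalar (u x b : D) (B : {vspace D}) : x != 0 -> x * u = (u + 1) * x ->
  (forall c, c \in B -> c * u = u * c /\ c * x = x * c) -> (\dim {:D} <= 4 * \dim B)%N -> b \in B ->
  (forall c, c \in B -> c * b = b * c) -> scalar b.
Proof.
move=> x0 xu hB dB bB bC; have fr := quaternion_free x0 xu hB.
have sz : size (dbl x (dbl u (vbasis B))) = (4 * \dim B)%N.
  by rewrite !size_dbl size_tuple mulnA.
have [bu bx] := hB _ bB.
apply: (comm_basis fr); first by apply/eqP; rewrite eqn_leq free_size //= sz.
by apply: dbl_comm => //; apply: dbl_comm => // t /vbasis_mem /bC.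
Qed.

Lemma adjoin_sub (B : {aspace D}) y : y \in B -> (<<1; y>> <= B)%VS.
Proof.
move=> yB; apply: adjoin_ind; [exact: asp1 | move=> p q /line1P[k ->] qC; rewrite -scalerAl mul1r memvZ // |].
by move=> q; exact: memvM.
Qed.

(** [x] is chosen symmetric for a symplectic involution that shifts [u]; the twist by [x^-1] fixes
    [u] and [x]. The algebra depends on [a] and [p] only, and zeros fill the other seven places. *)
Lemma quaternion_nine (s : 'End(D)) : \dim {:D} = 4%N -> symp s -> nine_parameters D.
Proof.
move=> d4 hs.
have [b [c [_ _ bc]]] : exists b c : D, [/\ b \in {:D}%AS, c \in {:D}%AS & b * c != c * b].
  apply: noncomm_pair; first by rewrite d4.
  by move=> t _ tC; apply: (csC hD) => y; rewrite tC ?memvf.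
have quad (y : D) : quadratic y.
  apply: quadratic_small; have := dim_dvd hD <<1; y>>%AS; rewrite d4.
  have : (\dim <<1; y>>%VS != 4)%N.
    apply: contraNneq bc => dy; have E : <<1; y>>%VS = fullv by apply/eqP; rewrite eqEdim subvf dy d4.
    have yC : forall t, t * y = y * t.
      by move=> t; have /subvP h := adjoin_sub (B := 'C[y]%AS) (cent1v_id y); have /h /cent1vP : t \in <<1; y>>%VS by rewrite E memvf.
    have [k yk] : scalar y by apply: (csC hD).
    have : (<<1; y>> <= 1)%VS by apply: (adjoin_sub (B := 1%AS)); apply/line1P; exists k.
    by move/dimvS; rewrite dimv1 dy.
  by move=> n4 dv; have := dvdn_leq (isT : (0 < 4)%N) dv; move: n4 dv; case: (\dim _) => [|[|[|[|[|n]]]]].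
have [u [_ uas]] := as_of_quadratic (B := {:D}%AS) (fun y _ => quad y) (memvf b) (memvf c) bc.
have [uF [a uu]] := uas; have [x0 x0n x0u] := as_graded hD uas.
have [t1 [ht1 t1f]] : exists t : 'End(D), invol t /\ forall g, g \in [:: u] -> t g = g.
  by apply: (fix_step hD (U := [::]) hs.1 _ _ uu x0n x0u).
have [t [ht tf]] : exists t : 'End(D), symp t /\ forall p, p \in [:: (u, 1 : F)] -> t p.1 = p.1 + p.2 *: 1.
  apply: (flip_symp hD ht1 _ x0n (u0 := u)); rewrite ?inE //.
  - by move=> p; rewrite inE => /eqP ->; apply: t1f; rewrite inE.
  - by move=> p; rewrite inE => /eqP -> /=; rewrite scale1r.
  by move=> p; rewrite inE => /eqP ->.
have tu : t u = u + 1 *: 1 by apply: (tf (u, 1)); rewrite inE.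
have [x [/flipvP xfl xn tx]] : exists q, [/\ q \in flipv u, q != 0 & t q = q].
  apply: (ex_sym_in ht.1 _ _ x0n); last exact/flipvP.
  move=> d /flipvP; rewrite /flips -[1 in X in X -> _](scale1r (1 : D)) => /(anti_flips ht.1.1 tu).
  by rewrite scale1r => ?; apply/flipvP.
have xu : x * u = (u + 1) * x := xfl.
have [s1 [hs1 s1E]] : exists s1 : 'End(D), invol s1 /\ forall z, s1 z = x^-1 * t z * x^-1^-1.
  by apply: (ex_twist hD ht.1); [rewrite invr_eq0 | rewrite (anti_inv hD ht.1.1 xn) tx].
have s1u : s1 u = u.
  by rewrite s1E invrK tu scale1r -mulrA -xu mulKr // (csU hD).
have s1x : s1 x = x by rewrite s1E invrK tx mulVr ?mul1r // (csU hD).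
have fr : free (dbl x (dbl u [:: 1])).
  have o1 g : forall t : D, t \in [:: 1] -> t * g = g * t by move=> r; rewrite inE => /eqP ->; rewrite mul1r mulr1.
  apply: (free_dbl_flip hD xn _ _ xu); last by apply: dbl_comm => //; exact: o1.
  apply: (free_dbl_flipped hD (flip_neq0 xn xu) xn _ _ xu); last exact: o1.
  by rewrite seq1_free oner_neq0.
have bas : basis_of {:D} (dbl x (dbl u [:: 1])) by apply: free_basis => //; rewrite d4.
have [p xx] : exists p, x * x = p *: 1.
  have [k [l kl]] := quad x.
  have l0 : l = 0.
    have /eqP : l *: x = 0 by rewrite -[RHS](h2 (x * x * u)) {1}kl; nc h2 (xu, kl).
    by rewrite scaler_eq0 (negbTE xn) orbF => /eqP.
  by exists k; rewrite kl l0 scale0r addr0.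
exists (nine a p 0 0 0 0 0 0 0), s1, (dbl x (dbl u [:: 1])).
split=> //; first exact: hs1.1.
move=> S hS /nineP[Sa Sp _ _].
have S1 := sf1 hS.
have st1 (W : seq D) : stab S W 1 by exact: stab1.
have stS (W : seq D) k : S k -> stab S W (k *: (1 : D)) by move=> Sk; exact: stabZ.
have uu1 : stab S (dbl u [:: 1]) u.
  by apply: (stab_dbl_self hS (r0 := a *: 1) (r1 := 1)) => //; [exact: stS | rewrite mulr1].
apply: (gen_sspan (gs := [:: x; u]) hS hs1.1) => g; rewrite !inE => /orP[] /eqP -> //=.
- apply: (stab_dbl_self hS (r0 := p *: 1) (r1 := 0)); [exact: stS | by rewrite -(scale0r (1 : D)); apply: stS; exact: sf0 | by rewrite mulr0 add0r].
- by apply: (stab_dbl (q' := u + 1) hS uu1); [exact: stabD | nc h2 xu].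
Qed.

(** The centraliser [B] of [u] and of an alternating [x] supplies a second Artin-Schreier element
    [v]. With [X] and [q = X * y] symmetric for an involution that shifts [u] only, [q * q] is a
    scalar [m], and this determines how [X] and [y] commute. Seven parameters remain. *)
Lemma biquaternion_nine (s : 'End(D)) : \dim {:D} = 16%N -> symp s -> nine_parameters D.
Proof.
move=> d16 hs; have [tr htr] := ex_trace_form hD.
have qAlt (t : 'End(D)) y : symp t -> y \in Alt t -> quadratic y.
  move=> ht yA; apply: quadratic_small.
  have [_ /(_ (adjoin_Alt hD ht yA))] := Sym_bound hD htr ht.1 (K := <<1; y>>%AS) (adjoin_fixed hD ht (Alt_sym hD ht yA)).
  rewrite d16 => m4; have := dim_dvd hD <<1; y>>%AS; rewrite d16; move: m4 => /=.
  by case: (\dim _) => [|[|[|[|n]]]] //; nia.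
have [u uas] : exists u : D, artin_schreier u.
  have [y [yA y1]] : exists y, y \in Alt s /\ y \notin 1%VS.
    have [//|h] := EM (exists y, y \in Alt s /\ y \notin 1%VS).
    have : (Alt s <= 1)%VS.
      by apply/subvP => y yA; apply/negPn/negP => y1; case: h; exists y.
    by move/dimvS; rewrite dimv1; have := dim_Alt hD hs.1; rewrite d16 => /(_ isT); lia.
  have yF : ~ scalar y by move=> yk; case/negP: y1; apply/line1P.
  have [//|[j [sj jF jj]]] := as_or_insep hD yA hs yF (or_introl (qAlt _ _ hs yA)).
  apply: (insep_as hD htr _ hs _ sj jF jj); last by rewrite d16.
  by move=> t y' ht yA'; left; exact: qAlt yA'.
have [uF [a uu]] := uas; have [x0 x0n x0u] := as_graded hD uas.
have [t1 [ht1 t1f]] : exists t : 'End(D), invol t /\ forall g, g \in [:: u] -> t g = g.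
  by apply: (fix_step hD (U := [::]) hs.1 _ _ uu x0n x0u).
have [s0 [hs0 s0f]] : exists t : 'End(D), symp t /\ forall p, p \in [:: (u, 1 : F)] -> t p.1 = p.1 + p.2 *: 1.
  apply: (flip_symp hD ht1 _ x0n (u0 := u)); rewrite ?inE //.
  - by move=> p; rewrite inE => /eqP ->; apply: t1f; rewrite inE.
  - by move=> p; rewrite inE => /eqP -> /=; rewrite scale1r.
  by move=> p; rewrite inE => /eqP ->.
have s0u : s0 u = u + 1 by rewrite -(scale1r 1); apply: (s0f (u, 1)); rewrite inE.
have d4 : (4 < \dim {:D})%N by rewrite d16.
have [x [xA /flipvP xfl xn]] := ex_graded_alt hD uu uF hs0 s0u d4.
have xu : x * u = (u + 1) * x := xfl.
have [p xx] : exists p, x * x = p *: 1.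
  have [k [l kl]] := qAlt _ _ hs0 xA.
  have l0 : l = 0.
    have /eqP : l *: x = 0 by rewrite -[RHS](h2 (x * x * u)) {1}kl; nc h2 (xu, kl).
    by rewrite scaler_eq0 (negbTE xn) orbF => /eqP.
  by exists k; rewrite kl l0 scale0r addr0.
pose B := aspace_cap (algid_in hD 'C[u]%AS 'C[x]%AS).
have BP c : c \in B -> c * u = u * c /\ c * x = x * c.
  by move=> /memv_capP[/cent1vP cu /cent1vP cx].
have dB : (4 <= \dim B)%N.
  have := halve hD (K := {:D}%AS) uu (fun y _ => memvf _); rewrite /= capfv d16 => H1.
  pose L := amull x + amulr x.
  have LE d : L d = x * d + d * x by rewrite add_lfunE !lfunE.
  have kE : ('C[u] :&: lker L <= B)%VS.
    apply/subvP => y /memv_capP[yB]; rewrite memv_ker LE => /eqP /(add2_eq hD) E.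
    by apply: in_cap => //; apply/cent1vP.
  have iE : (L @: 'C[u] <= amull x @: B)%VS.
    apply/subvP => _ /memv_imgP[d /cent1vP du ->]; rewrite LE.
    apply/memv_imgP; exists (x^-1 * (x * d + d * x)); last by rewrite lfunE /= mulVKr // (csU hD).
    have xiu : x^-1 * u = (u + 1) * x^-1 := flips_inv hD xn xfl.
    have xix : x * x^-1 = 1 by rewrite mulrV // (csU hD).
    have xxi : x^-1 * x = 1 by rewrite mulVr // (csU hD).
    apply: in_cap; apply/cent1vP; first by nc h2 (xiu, du, xu).
    have E : d * x * x = p *: d by rewrite -mulrA xx; nc h2 tt.
    have -> : x^-1 * (x * d + d * x) * x = d * x + x^-1 * (d * x * x) by nc h2 xxi.
    have xp : p *: x^-1 = x by rewrite -[RHS]mulr1 -xix mulrA xx; nc h2 tt.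
    rewrite E -scalerAr scalerAl xp; nc h2 xix.
  have a1 := limg_ker_dim L 'C[u]; have a2 := dimvS kE; have a3 := dimvS iE.
  have a4 := limg_ker_dim (amull x) B.
  by move: a1 a2 a3 a4 H1; rewrite /=; lia.
have ZB c : c \in B -> (forall d, d \in B -> c * d = d * c) -> scalar c.
  move=> cB cC; apply: (centralizer_scalar xn xu BP _ cB) => [|d dB']; last by rewrite cC.
  by rewrite d16 (@leq_mul2l 4 4).
have [c [d [cB dB' cd]]] := noncomm_pair (leq_trans (isT : 1 < 4)%N dB) ZB.
have qB y : y \in B -> quadratic y.
  move=> yB; have yK := adjoin_sub yB.
  have yuK k : k \in <<1; y>>%VS -> k * u = u * k /\ k * x = x * k by move=> /(subvP yK) /BP.
  have fr := quaternion_free xn xu yuK.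
  have := dim_dvd hD <<1; y>>%AS; rewrite d16 => dv.
  have [d3|dy] := leqP (\dim <<1; y>>%VS) 3.
    by apply: quadratic_small; move: d3 dv; rewrite /=; case: (\dim _) => [|[|[|[|n]]]].
  have [k ->] : scalar y.
    apply: (centralizer_scalar xn xu yuK); [by rewrite d16 (@leq_mul2l 4 4) | exact: memv_adjoin |].
    by move=> q /(subvP (adjoin_sub (B := 'C[y]%AS) (cent1v_id y))) /cent1vP.
  by exists (k * k), 0; rewrite -scalerAl mul1r scalerA scale0r addr0.
have [v [vB vas]] := as_of_quadratic qB cB dB' cd.
have [vF [b vv]] := vas; have [vu vx] := BP _ vB.
have xv : x * v = v * x by rewrite vx.
have [y0 y0n y0v] := as_graded hD vas.
have [y1 [y1n y1u y1f]] := commute_adjust hD uu y0n xn xfl.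
have y1v : y1 * v = (v + 1) * y1.
  by have := y1f v 1 vu xv; rewrite scale1r; apply.
have [t2 [ht2 t2f]] : exists t : 'End(D), invol t /\ forall g, g \in [:: v; u] -> t g = g.
  apply: (fix_step hD ht1 t1f _ vv y1n y1v) => g; rewrite inE => /eqP -> //; exact: esym.
have [t [ht tf]] : exists t : 'End(D), symp t /\ forall p, p \in [:: (u, 1 : F); (v, 0)] -> t p.1 = p.1 + p.2 *: 1.
  apply: (flip_symp hD ht2 _ xn (u0 := u)); rewrite ?inE ?eqxx //.
  - by move=> r; rewrite !inE => /orP[] /eqP ->; apply: t2f; rewrite !inE eqxx ?orbT.
  - by move=> r; rewrite !inE => /orP[] /eqP -> /=; rewrite ?scale1r ?scale0r ?addr0.
  by move=> r; rewrite !inE => /orP[] /eqP ->.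
have tu : t u = u + 1 *: 1 by apply: (tf (u, 1)); rewrite inE eqxx.
have tv : t v = v + 0 *: 1 by apply: (tf (v, 0)); rewrite !inE eqxx orbT.
pose V (e : F) : {vspace D} := (lker (amulr u - amull (u + 1%:A))%R :&: lker (amulr v - amull (v + e%:A))%R)%VS.
have VP e g : g \in V e <-> g * u = (u + 1%:A) * g /\ g * v = (v + e%:A) * g.
  split=> [/memv_capP[]|[gu gv]].
    by rewrite !memv_ker !add_lfunE !opp_lfunE !lfunE /= !subr_eq0 => /eqP ? /eqP.
  by apply: in_cap; rewrite !memv_ker !add_lfunE !opp_lfunE !lfunE /= ?gu ?gv subrr.
have tV e g : g \in V e -> t g \in V e.
  by move=> /VP[gu gv]; apply/VP; split; [exact: anti_flips ht.1.1 tu gu | exact: anti_flips ht.1.1 tv gv].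
have xV : x \in V 0 by apply/VP; rewrite xu xv scale1r scale0r addr0.
have xyV : x * y1 \in V 1 by apply/VP; rewrite scale1r; split; [nc h2 (xu, y1u) | nc h2 (xv, y1v)].
have [X [/VP[Xu Xv] Xn tX]] := ex_sym_in ht.1 (tV 0) xV xn.
have [q [/VP[qu qv] qn tq]] := ex_sym_in ht.1 (tV 1) xyV (cs_mul_neq0 hD xn y1n).
rewrite scale1r in Xu qu; rewrite scale0r addr0 in Xv; rewrite scale1r in qv.
have XU := csU hD Xn; have Xin : X^-1 != 0 by rewrite invr_eq0.
pose y := X^-1 * q; have yn : y != 0 by exact: cs_mul_neq0.
have Xiu : X^-1 * u = (u + 1) * X^-1 := flips_inv hD Xn Xu.
have Xiv : X^-1 * v = v * X^-1 := comm_inv hD Xn Xv.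
have yu : y * u = u * y by rewrite /y; nc h2 (Xiu, qu).
have yv : y * v = (v + 1) * y by rewrite /y; nc h2 (Xiv, qv).
have Xy : X * y = q by rewrite /y mulVKr.
have [s1 [hs1 s1E]] : exists s1 : 'End(D), invol s1 /\ forall z, s1 z = X^-1 * t z * X^-1^-1.
  by apply: (ex_twist hD ht.1) => //; rewrite (anti_inv hD ht.1.1 Xn) tX.
have s1u : s1 u = u by rewrite s1E invrK tu scale1r -mulrA -Xu mulKr.
have s1v : s1 v = v by rewrite s1E invrK tv scale0r addr0 Xiv mulrVK.
have s1X : s1 X = X by rewrite s1E invrK tX mulVr ?mul1r.
have s1y : s1 y = y.
  by rewrite s1E invrK /y ht.1.1.1 (anti_inv hD ht.1.1 Xn) tX tq mulrA mulrVK.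
have o1 g : forall t : D, t \in [:: 1] -> t * g = g * t by move=> r; rewrite inE => /eqP ->; rewrite mul1r mulr1.
have fr2 : free (dbl u (dbl v [:: 1])).
  apply: (free_dbl_flipped hD (flip_neq0 Xn Xu) Xn _ _ Xu); last by apply: dbl_comm => //; exact: o1.
  apply: (free_dbl_flipped hD (flip_neq0 yn yv) yn _ _ yv); last exact: o1.
  by rewrite seq1_free oner_neq0.
have uv := esym vu.
have fr : free (dbl X (dbl y (dbl u (dbl v [:: 1])))).
  apply: (free_dbl_flip hD Xn _ _ Xu); last by do 3![apply: dbl_comm => //]; exact: o1.
  by apply: (free_dbl_flip hD yn fr2 _ yv); do 2![apply: dbl_comm => //]; exact: o1.
have cuv f : f * u = u * f -> f * v = v * f -> exists k0 k1 k2 k3 : F, f = k0 *: 1 + k1 *: u + k2 *: v + k3 *: (u * v).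
  move=> fu fv; pose K := aspace_cap (algid_in hD 'C[u]%AS 'C[v]%AS).
  have KP g : g \in K -> g * u = u * g /\ g * v = v * g by move=> /memv_capP[/cent1vP gu /cent1vP gv].
  have frK : free (dbl X (dbl y (vbasis K))).
    apply: (free_dbl_flip hD Xn _ _ Xu); last by apply: dbl_comm => // r /vbasis_mem /KP[].
    by apply: (free_dbl_flip hD yn (basis_free (vbasisP _)) _ yv) => r /vbasis_mem /KP[].
  have dK := free_size frK.
  have sK : (span (dbl u (dbl v [:: 1%R])) <= K)%VS.
    apply/span_subvP; apply: dbl_ind => [|r]; last by apply: memvM; apply: in_cap; apply/cent1vP.
    apply: dbl_ind => [r|r]; last by apply: memvM; apply: in_cap; apply/cent1vP.
    by rewrite inE => /eqP ->; exact: asp1.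
  have : f \in span (dbl u (dbl v [:: 1])).
    have sz : \dim (span (dbl u (dbl v [:: 1%R]))) = 4%N := eqnP fr2.
    have dK4 : (\dim K <= 4)%N by rewrite !size_dbl size_tuple d16 mulnA (@leq_pmul2l 4 _ 4) in dK.
    have /eqP -> : span (dbl u (dbl v [:: 1%R])) == K by rewrite eqEdim sK sz.
    by apply: in_cap; apply/cent1vP.
  case/dbl_span => _ [_ [/dbl_span[_ [_ [/span_one[k0 ->] /span_one[k1 ->] ->]]] /dbl_span[_ [_ [/span_one[k2 ->] /span_one[k3 ->] ->]]] ->]].
  by exists k0, k2, k1, k3; nc h2 tt.
have free_uv (g r : D) (k l : F) : g != 0 -> g * r = (r + 1) * g -> k *: 1 + l *: r = 0 -> k = 0 /\ l = 0.
  move=> g0 gt E; have l0 : l = 0.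
    have /eqP : l *: g = 0.
      have -> : l *: g = (k *: 1 + l *: r) * g + g * (k *: 1 + l *: r) by nc h2 gt.
      by rewrite E mul0r mulr0 addr0.
    by rewrite scaler_eq0 (negbTE g0) orbF => /eqP.
  move: E; rewrite l0 scale0r addr0 => /eqP; rewrite scaler_eq0 oner_eq0 orbF => /eqP.
  by [].
have [r0 [r1 XX]] : exists r0 r1 : F, X * X = r0 *: 1 + r1 *: v.
  have [||k0 [k1 [k2 [k3 E]]]] := cuv (X * X); [by nc h2 Xu | by nc h2 Xv |].
  have [] : k1 = 0 /\ k3 = 0.
    apply: (free_uv y v _ _ yn yv); apply: (cs_mulI hD Xn); rewrite mulr0.
    by rewrite -[RHS](h2 (X * X * X)) {1}E -mulrA E; nc h2 (Xu, Xv, vu).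
  by move=> k10 k30; exists k0, k2; rewrite E k10 k30 !scale0r !addr0.
have [e0 [e1 yy]] : exists e0 e1 : F, y * y = e0 *: 1 + e1 *: u.
  have [||k0 [k1 [k2 [k3 E]]]] := cuv (y * y); [by nc h2 yu | by nc h2 yv |].
  have [] : k2 = 0 /\ k3 = 0.
    apply: (free_uv X u _ _ Xn Xu); apply: (cs_mulI hD yn); rewrite mulr0.
    by rewrite -[RHS](h2 (y * y * y)) {1}E -mulrA E; nc h2 (yu, yv, vu).
  by move=> k10 k30; exists k0, k1; rewrite E k10 k30 !scale0r !addr0.
(* [q] shifts both [u] and [v], so [q * q] lies in [F + F (u + v)]; it is [t]-symmetric while [t]
   moves [u + v] by 1, so it is scalar. *)
have [m qq] : exists m : F, q * q = m *: 1.
  have [||k0 [k1 [k2 [k3 E]]]] := cuv (q * q); [by nc h2 qu | by nc h2 qv |].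
  have [] : k1 + k2 + k3 = 0 /\ k3 = 0.
    apply: (free_uv X (u + v) _ _ Xn); first by nc h2 (Xu, Xv).
    apply: (cs_mulI hD qn); rewrite mulr0.
    by rewrite -[RHS](h2 (q * q * q)) {1}E -mulrA E; nc h2 (qu, qv, vu).
  move=> k12 k30; have k1E : k1 = k2.
    by move: k12; rewrite k30 addr0 => k12; rewrite -[k1]addr0 -(csF2 hD k2) addrA k12 add0r.
  have tqq : t (q * q) = q * q by rewrite ht.1.1.1 tq.
  have k10 : k1 = 0.
    have /eqP : k1 *: (1 : D) = 0.
      rewrite -[RHS](h2 (q * q)) -{1}tqq E k30 -k1E scale0r addr0 !linearD !linearZ /= tu tv ht.1.1.2; nc h2 tt.
    by rewrite scaler_eq0 oner_eq0 orbF => /eqP.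
  by exists k0; rewrite E k30 -k1E k10 !scale0r !addr0.
pose Xc : D := r0 *: 1 + r1 *: (v + 1); pose Yc : D := e0 *: 1 + e1 *: (u + 1).
have nXn : nrm r0 r1 b != 0 := nrm_neq0 hD vv yn yv (cs_mul_neq0 hD Xn Xn) XX.
have nYn : nrm e0 e1 a != 0 := nrm_neq0 hD uu Xn Xu (cs_mul_neq0 hD yn yn) yy.
have yXE : (nrm r0 r1 b * nrm e0 e1 a) *: (y * X) = m *: (X * Xc * Yc * y).
  have E : (r0 *: 1 + r1 *: v) * (y * X) * (e0 *: 1 + e1 *: u) = m *: (X * y).
    by rewrite -XX -yy; transitivity (X * (q * q) * y); [rewrite -Xy; nc h2 tt | rewrite qq; nc h2 tt].
  transitivity (Xc * ((r0 *: 1 + r1 *: v) * (y * X) * (e0 *: 1 + e1 *: u)) * Yc).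
    by rewrite /nrm /Xc /Yc; nc h2 (uu, vv, vu, Xu, Xv, yu, yv).
  by rewrite E /Xc /Yc; nc h2 (uu, vv, vu, Xu, Xv, yu, yv).
exists (nine a b m r0 r1 e0 e1 0 0), s1, (dbl X (dbl y (dbl u (dbl v [:: 1])))).
split; [exact: hs1.1 | by apply: free_basis => //; rewrite d16 |].
move=> S hS /nineP[Sa Sb Sm [Sr0 Sr1 Se0 [Se1 _ _]]].
have S1 := sf1 hS.
have SD := sfD hS; have SM := sfM hS.
have Snr k l c0 : S k -> S l -> S c0 -> S (nrm k l c0)^-1.
  by move=> Sk Sl Sc; apply: (sfV hS); rewrite /nrm; do ?[apply: (SD) | apply: (SM)].
have st1 (W : seq D) : stab S W 1 by exact: stab1.
have stM (W : seq D) (p0 p1 : D) : stab S W p0 -> stab S W p1 -> stab S W (p0 * p1) by exact: stabM.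
have stD (W : seq D) (p0 p1 : D) : stab S W p0 -> stab S W p1 -> stab S W (p0 + p1) by exact: stabD.
have stZ (W : seq D) k (p0 : D) : S k -> stab S W p0 -> stab S W (k *: p0) by exact: stabZ.
have stS (W : seq D) k : S k -> stab S W (k *: (1 : D)) by move=> Sk; exact: stabZ.
have st0 (W : seq D) : stab S W 0 by rewrite -(scale0r (1 : D)); apply: stS; exact: sf0.
have selfAS (W : seq D) (r : D) k : r * r = r + k *: 1 -> S k -> stab S (dbl r W) r.
  by move=> rr Sk; apply: (stab_dbl_self hS (r0 := k *: 1) (r1 := 1)) => //; [exact: stS | rewrite mulr1].
have flip (W : seq D) (r g : D) : stab S W r -> g * r = (r + 1) * g -> stab S (dbl g W) r.
  move=> h E; have h1 : stab S W (r + 1) by apply: (stD).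
  by apply: (stab_dbl (q' := r + 1) hS) => //; nc h2 E.
have comm (W : seq D) (r g : D) : stab S W r -> r * g = g * r -> stab S (dbl g W) r by move=> h; exact: stab_dbl.
have vv1 : stab S (dbl v [:: 1]) v by exact: selfAS vv Sb.
have uu1 : stab S (dbl u (dbl v [:: 1])) u by exact: selfAS uu Sa.
have uv1 : stab S (dbl u (dbl v [:: 1])) v by exact: comm vu.
set W2 := dbl u _ in uu1 uv1 *.
have yu1 : stab S (dbl y W2) u by apply: (comm).
have yv1 : stab S (dbl y W2) v by apply: (flip).
have yy1 : stab S (dbl y W2) y.
  apply: (stab_dbl_self hS (r0 := e0 *: 1 + e1 *: u) (r1 := 0)) => //; last by rewrite mulr0 add0r.
  by apply: (stD); apply: (stZ).
set W3 := dbl y _ in yu1 yv1 yy1 *.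
apply: (gen_sspan (gs := [:: X; y; u; v]) hS hs1.1) => g; rewrite !inE => /or4P[] /eqP -> //=.
- apply: (stab_dbl_self hS (r0 := r0 *: 1 + r1 *: v) (r1 := 0)) => //; last by rewrite mulr0 add0r.
  by apply: (stD); apply: (stZ).
- apply: (stab_dbl (q' := ((nrm r0 r1 b)^-1 * (nrm e0 e1 a)^-1 * m) *: (Xc * Yc * y)) hS yy1).
    apply: (stZ); first by do ?[apply: (SM)] => //; exact: Snr.
    by rewrite /Xc /Yc; do ?[exact: yy1 | apply: (stZ) | apply: (stM) | apply: (stD)].
  have nn : nrm r0 r1 b * nrm e0 e1 a != 0 by rewrite mulf_neq0.
  by apply: (can_inj (scalerK nn)); rewrite yXE -scalerAr scalerA -invfM mulVKf // !mulrA.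
- by apply: (flip).
- by apply: (comm) => //; rewrite Xv.
Qed.

(** [m] is the size of the matrices over [D], so the degree of [D] is 8, 4, 2 or 1. A
    non-commutative [D] has a non-symmetric element for every involution, and this provides a
    symplectic one. *)
Lemma division_nine (th : 'End(D)) m : antim th -> (m ^ 2 * \dim {:D} = 64)%N -> nine_parameters D.
Proof.
move=> hth md; have [tr htr] := ex_trace_form hD.
have [kp hkp] := ex_tr_sq hD htr.
have [es hes] := ex_tr_dual hD htr.
have [s hs] := anti_invol hD htr hes hkp hth.
have [cD|cD] := EM (forall x y : D, x * y = y * x).
  have D1 (x : D) : exists k : F, x = k *: 1 by apply: (csC hD) => y; exact: cD.
  have [Eid Eidh] : exists t : 'End(D), forall x, t x = x by exists \1%VF => x; rewrite lfunE.
  exists (nine 0 0 0 0 0 0 0 0 0), Eid, [:: 1].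
  have d1 : \dim {:D} = 1%N.
    rewrite -[RHS](dimv1 (D : falgType F)); congr (\dim _); apply/eqP; rewrite eqEsubv subvf andbT.
    by apply/subvP => x _; apply/line1P.
  split; first by split=> [x y|]; rewrite !Eidh.
    by apply: free_basis; rewrite ?d1 // seq1_free oner_neq0.
  move=> S hS _; have S1 : sspan S [:: (1 : D)] 1 by apply: (sspan_mem hS); rewrite inE.
  by split=> // [x y|x]; rewrite !inE ?Eidh => /eqP -> // /eqP ->; rewrite mulr1.
have [x sx] : exists x, s x != x.
  have [//|h] := EM (exists x, s x != x); case: cD => x y.
  have sid z : s z = z by apply/eqP/negPn/negP => zn; case: h; exists z.
  by rewrite -[x * y]sid hs.1.1 !sid.
have [t ht] := ex_symp hD hs sx.
have [m1|] := eqVneq m 1%N; first by apply: (degree8_nine hD _ ht); rewrite -md m1 mul1n.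
have [m2 _|] := eqVneq m 2%N; first by apply: (biquaternion_nine _ ht); move: md; rewrite m2; lia.
have [m4 _ _|m4 m2 m1] := eqVneq m 4%N; first by apply: (quaternion_nine _ ht); move: md; rewrite m4; lia.
case: cD; have d1 : \dim {:D} = 1%N.
  have m8 : (m <= 8)%N by rewrite -leq_sqr -[(8 ^ 2)%N]/64%N -md leq_pmulr // lt0n dimv_eq0 -subv0; apply/negP => /subvP /(_ 1 (memvf _)); rewrite memv0 oner_eq0.
  move: m8 md m1 m2 m4; move: (\dim {:D}) => n; do 9? [case: m => [|m] //]; nia.
have D1 (y : D) : exists k : F, y = k *: 1.
  apply/line1P; have /eqP -> : (1 == {:D})%VS by rewrite eqEdim subvf d1 dimv1.
  exact: memvf.
by move=> y z; have [k ->] := D1 y; rewrite -scalerAl -scalerAr mul1r mulr1.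
Qed.
End SmallDegree.

(** * Matrix units and the division algebra *)

Section MatrixUnits.
Variables (F : fieldType) (A : falgType F) (cen : central_alg A) (full : full_ideals A).

Lemma limg_amullP (a z : A) : reflect (exists y, z = a * y) (z \in limg (amull a)).
Proof.
apply: (iffP memv_imgP) => [[y _ ->]|[y ->]]; exists y; rewrite ?lfunE ?memvf //.
Qed.

Lemma full_mul_neq0 (a : A) : a != 0 -> exists x, a * x * a != 0.
Proof.
move=> a0; have [s s1] := full a0.
have [//|h] := EM (exists x, a * x * a != 0); case/eqP: a0.
rewrite -[a]mulr1 -s1 mulr_sumr big1 // => p _; rewrite !mulrA.
have -> : a * p.1 * a = 0 by apply/eqP/negPn/negP => n0; case: h; exists p.1.
by rewrite mul0r.
Qed.

(** The last clause says that [e A] is a minimal right ideal. *)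
Definition min_idem (e : A) := [/\ e * e = e, e != 0 & forall c, c != 0 -> e * c = c -> exists y, c * y = e].

(** Take [a A] of least dimension and [a * x * a != 0]. Left multiplication by [a * x] is bijective
    on [a A], so the solution [e] of [a * x * e = a * x] in [a A] is idempotent. *)
Lemma ex_min_idem : exists e, min_idem e.
Proof.
have exP : exists n, `[<exists a : A, a != 0 /\ \dim (limg (amull a)) = n>].
  by exists (\dim (limg (amull (1 : A)))); apply/asboolP; exists 1; rewrite oner_neq0.
case: (ex_minnP exP) => n /asboolP[a [a0 an]] nmin.
have amin c : c != 0 -> (exists d, c = a * d) -> limg (amull c) = limg (amull a).
  move=> c0 [d cd]; apply/eqP; rewrite eqEdim; apply/andP; split.
    by apply/subvP => _ /limg_amullP[y ->]; apply/limg_amullP; exists (d * y); rewrite cd mulrA.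
  by rewrite an; apply: nmin; apply/asboolP; exists c.
have [x ax] := full_mul_neq0 a0.
have E1 := amin _ ax (ex_intro _ (x * a) (esym (mulrA _ _ _))).
have [y ay] : exists y, a * x = a * x * a * y.
  by apply/limg_amullP; rewrite E1; apply/limg_amullP; exists x.
pose L := amull (a * x).
have LE z : L z = a * x * z by rewrite lfunE.
have Lim : (L @: limg (amull a))%VS = limg (amull a).
  rewrite -[RHS]E1; apply/vspaceP => z; apply/memv_imgP/limg_amullP.
    by case=> _ /limg_amullP[t ->] ->; exists t; rewrite LE !mulrA.
  by case=> t ->; exists (a * t); [apply/limg_amullP; exists t | rewrite LE !mulrA].
have Linj z : (exists d, z = a * d) -> a * x * z = 0 -> z = 0.
  move=> zd z0; have := limg_ker_dim L (limg (amull a)).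
  rewrite Lim => /eqP; rewrite -[X in _ == X]add0n eqn_add2r dimv_eq0 => /eqP K0.
  apply/eqP; rewrite -memv0 -K0; apply/memv_capP; split; first exact/limg_amullP.
  by rewrite memv_ker LE z0.
pose e := a * y.
have axe : a * x * e = a * x by rewrite /e mulrA -ay.
have ee : e * e = e.
  apply/eqP; rewrite -subr_eq0; apply/eqP; apply: Linj.
    by exists (y * e - y); rewrite mulrBr [a * (y * _)]mulrA.
  by rewrite mulrBr mulrA axe axe subrr.
have e0 : e != 0.
  by apply: contraNneq ax => e0; rewrite -axe e0 mulr0 mul0r.
exists e; split=> // c c0 ec.
have E2 := amin _ c0 (ex_intro _ (y * c) (etrans (esym ec) (esym (mulrA _ _ _)))).
have : e \in limg (amull c) by rewrite E2; apply/limg_amullP; exists y.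
by case/limg_amullP => t ->; exists t.
Qed.

(** For [d] in [e A e], the product [a i * d * b j] is the matrix with the single entry [d] at
    [(i, j)]. *)
Definition munits (e : A) r (a b : 'I_r -> A) :=
  [/\ forall i, a i * e = a i, forall i, e * b i = b i, forall i j, b i * a j = (i == j)%:R *: e & \sum_i a i * b i = 1].

(* In a shortest expression [1 = \sum_i a i * b i] with [a i \in A e] and [b i \in e A], the [b i] are
   left independent over [e A e], and [b i = \sum_j (b i * a j) * b j] forces the relations. *)
Lemma ex_munits e : min_idem e -> exists r (a b : 'I_r -> A), munits e a b.
Proof.
move=> [ee e0 emin].
pose P r := exists a b : 'I_r -> A, [/\ forall i, a i * e = a i, forall i, e * b i = b i & \sum_i a i * b i = 1].
have exP : exists r, `[<P r>].
  have [s s1] := full e0; exists (size s); apply/asboolP.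
  exists (fun i => (nth (0, 0) s i).1 * e), (fun i => e * (nth (0, 0) s i).2).
  split=> [i|i|]; rewrite -?mulrA ?ee // ?mulrA ?ee //.
  rewrite -s1 (big_nth (0, 0)) big_mkord; apply: eq_bigr => i _.
  by rewrite !mulrA -[_ * e * e]mulrA ee.
case: (ex_minnP exP) => r /asboolP[a [b [ae eb ab]]] rmin.
exists r, a, b; split=> //.
have indep (d : 'I_r -> A) : (forall k, e * d k * e = d k) -> \sum_k d k * b k = 0 -> forall k, d k = 0.
  move=> de db k; apply/eqP/negPn/negP => dk0.
  have edk : e * d k = d k by rewrite -(de k) !mulrA ee.
  have [y dy] := emin _ dk0 edk.
  pose g := e * y * e.
  have gd : g * d k = e.
    have dg : d k * g = e.
      by rewrite /g !mulrA; have -> : d k * e = d k; [rewrite -(de k) -!mulrA ee | rewrite dy ee].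
    have eg : e * g = g by rewrite /g !mulrA ee.
    have g0 : g != 0 by apply: contraNneq e0 => g0; rewrite -dg g0 mulr0.
    have [z gz] := emin _ g0 eg.
    have -> : d k = e * z * e.
      transitivity (d k * (g * z) * e); last by rewrite mulrA dg.
      by rewrite gz -mulrA ee -(de k) -!mulrA ee.
    by rewrite !mulrA; have -> : g * e = g; [rewrite /g -!mulrA ee | rewrite gz ee].
  case: r a b ae eb ab rmin d de db k dk0 edk dy g gd => [|r] a b ae eb ab rmin d de db k dk0 edk dy g gd; first by case: k {dk0 edk dy gd}.
  have bk : b k = - \sum_(l < r) g * d (lift k l) * b (lift k l).
    have : g * \sum_l d l * b l = 0 by rewrite db mulr0.
    rewrite (bigD1_ord k) //= mulrDr mulrA gd eb => /eqP; rewrite addr_eq0 => /eqP ->.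
    by congr (- _); rewrite mulr_sumr; apply: eq_bigr => l _; rewrite mulrA.
  have : (r.+1 <= r)%N; last by rewrite ltnn.
  apply: rmin; apply/asboolP.
  exists (fun l => a (lift k l) - a k * g * d (lift k l)), (fun l => b (lift k l)); split=> [l|l|] //.
    by rewrite mulrBl ae; congr (_ - _); rewrite -[in LHS]de -[in RHS]de -!mulrA ee.
  rewrite -[RHS]ab (bigD1_ord k) //= bk mulrN mulr_sumr -sumrN -big_split /=; apply: eq_bigr => l _.
  by rewrite mulrBl addrC !mulrA.
move=> i j; apply/eqP; rewrite -subr_eq0; apply/eqP; move: j.
apply: (indep (fun k => b i * a k - (i == k)%:R *: e)) => [k|].
  rewrite mulrBr mulrBl -!mulrA ae mulrA eb; congr (_ - _).
  by rewrite -scalerAl -scalerAr !ee.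
transitivity (\sum_k b i * (a k * b k) - b i).
  rewrite [X in _ = _ - X](_ : b i = \sum_k (i == k)%:R *: b k).
    by rewrite -sumrB; apply: eq_bigr => k _; rewrite mulrBl mulrA -scalerAl eb.
  by rewrite (bigD1 i) //= eqxx scale1r big1 ?addr0 // => k /negbTE ki; rewrite eq_sym ki scale0r.
by rewrite -mulr_sumr ab mulr1 subrr.
Qed.
End MatrixUnits.

Lemma linear_map0 (F : fieldType) (V W : lmodType F) (g : V -> W) : linear g -> g 0 = 0.
Proof. by move=> gl; have := gl (-1) 0 0; rewrite scaler0 addr0 scaleN1r addNr. Qed.

Lemma linear_mapZ (F : fieldType) (V W : lmodType F) (g : V -> W) : linear g -> forall c x, g (c *: x) = c *: g x.
Proof. by move=> gl c x; have := gl c x 0; rewrite addr0 (linear_map0 gl) addr0. Qed.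

(** [p] and [q] are the projections and inclusions of a decomposition of [V] into copies of [W]. *)
Lemma block_dim (F : fieldType) (V W : vectType F) (T : finType) (p : T -> V -> W) (q : T -> W -> V) :
  (forall k, linear (p k)) -> (forall k, linear (q k)) ->
  (forall v, \sum_k q k (p k v) = v) -> (forall k l w, p k (q l w) = (k == l)%:R *: w) ->
  \dim {:V} = (#|T| * \dim {:W})%N.
Proof.
move=> lp lq qp pq; have -> : (#|T| * \dim {:W})%N = \dim {:{ffun T -> W}} by rewrite !dimvf.
apply/eqP; rewrite eqn_leq; apply/andP; split.
  apply: (@leq_dim_inj _ _ _ (fun v => [ffun k => p k v])) => [c x y|x y /ffunP E].
    by apply/ffunP => k; rewrite !ffunE lp.
  by rewrite -[x]qp -[y]qp; apply: eq_bigr => k _; have := E k; rewrite !ffunE => ->.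
apply: (@leq_dim_inj _ _ _ (fun w : {ffun T -> W} => \sum_k q k (w k))) => [c x y|x y E].
  by rewrite scaler_sumr -big_split; apply: eq_bigr => k _; rewrite !ffunE lq.
have pE (w : {ffun T -> W}) l : p l (\sum_k q k (w k)) = w l.
  rewrite (eq_bigr (fun k => 1 *: q k (w k))); last by move=> k _; rewrite scale1r.
  rewrite (linear_sumZ (lp l)) (bigD1 l) //= pq eqxx !scale1r big1 ?addr0 // => k kl.
  by rewrite pq eq_sym (negbTE kl) scale0r scaler0.
by apply/ffunP => l; rewrite -[LHS]pE -[RHS]pE E.
Qed.

Section Corner.
Variables (F : fieldType) (A : falgType F) (cen : central_alg A) (h2 : forall x : A, x + x = 0).
Variables (e : A) (he : min_idem e) (r : nat) (a b : 'I_r -> A) (hab : munits e a b).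

Let ee : e * e = e. Proof. by case: he. Qed.
Let e0 : e != 0. Proof. by case: he. Qed.
Let ae i : a i * e = a i. Proof. by case: hab. Qed.
Let eb i : e * b i = b i. Proof. by case: hab. Qed.
Let ba i j : b i * a j = (i == j)%:R *: e. Proof. by case: hab. Qed.
Let ab : \sum_i a i * b i = 1. Proof. by case: hab. Qed.

Definition corner_space : {vspace A} := lker ((amull e \o amulr e) - \1)%VF.

Lemma cornerP x : reflect (e * x * e = x) (x \in corner_space).
Proof.
rewrite memv_ker add_lfunE opp_lfunE comp_lfunE !lfunE /= subr_eq0 mulrA.
exact: eqP.
Qed.

Lemma corner_is_aspace : is_aspace corner_space.
Proof.
apply/andP; split.
  apply/has_algidP; exists e; split=> // [|x /cornerP xE]; first by apply/cornerP; rewrite ee.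
  by split; rewrite -xE; [rewrite !mulrA ee | rewrite -!mulrA ee].
apply/prodvP => x y /cornerP xE /cornerP yE; apply/cornerP.
by rewrite -xE -yE !mulrA ee -!mulrA ee.
Qed.

Definition corner_aspace : {aspace A} := ASpace corner_is_aspace.
Definition corner : falgType F := subvs_of corner_aspace.

Lemma corner_val (d : corner) : e * vsval d * e = vsval d.
Proof. exact/cornerP/subvsP. Qed.

Lemma corner_inj (d d' : corner) : vsval d = vsval d' -> d = d'. Proof. exact: val_inj. Qed.

Lemma corner_valM (d d' : corner) : vsval (d * d') = vsval d * vsval d'. Proof. by []. Qed.

Lemma corner_val1 : vsval (1 : corner) = e.
Proof.
rewrite -[LHS]/(algid corner_aspace).
have eK : e \in corner_space by apply/cornerP; rewrite ee.
rewrite -[RHS](algidl (A := corner_aspace) eK).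
have /cornerP <- : algid corner_aspace \in corner_space by exact: memv_algid.
by rewrite -!mulrA ee.
Qed.

Definition to_corner (x : A) : corner := vsproj corner_aspace x.

Lemma to_cornerE x : e * x * e = x -> vsval (to_corner x) = x.
Proof. by move=> xE; apply: vsprojK; exact/cornerP. Qed.

Lemma baE i j x : e * (b i * x * a j) * e = b i * x * a j.
Proof. by rewrite -!mulrA ae !mulrA eb. Qed.

Definition comp_of (k : 'I_r * 'I_r) (x : A) : corner := to_corner (b k.1 * x * a k.2).
Definition of_comp (k : 'I_r * 'I_r) (d : corner) : A := a k.1 * vsval d * b k.2.

Lemma comp_of_linear k : linear (comp_of k).
Proof. by move=> c x y; rewrite /comp_of mulrDr mulrDl -scalerAr -scalerAl /to_corner linearP. Qed.
HB.instance Definition _ k := GRing.isLinear.Build F A corner _ (comp_of k) (comp_of_linear k).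

Lemma of_comp_linear k : linear (of_comp k).
Proof. by move=> c x y; rewrite /of_comp linearP mulrDr mulrDl -scalerAr -scalerAl. Qed.
HB.instance Definition _ k := GRing.isLinear.Build F corner A _ (of_comp k) (of_comp_linear k).

Lemma val_comp_of k x : vsval (comp_of k x) = b k.1 * x * a k.2.
Proof. by rewrite to_cornerE // baE. Qed.

Lemma comp_ofK x : \sum_k of_comp k (comp_of k x) = x.
Proof.
rewrite (eq_bigr (fun k : 'I_r * 'I_r => (a k.1 * b k.1) * x * (a k.2 * b k.2))); last first.
  by move=> k _; rewrite /of_comp val_comp_of !mulrA.
rewrite -(pair_bigA _ (fun i j => a i * b i * x * (a j * b j))) /=.
rewrite (eq_bigr (fun i => a i * b i * x)); first by rewrite -mulr_suml ab mul1r.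
by move=> i _; rewrite -mulr_sumr ab mulr1.
Qed.

Lemma of_compK k l d : comp_of k (of_comp l d) = (k == l)%:R *: d.
Proof.
apply: corner_inj; rewrite linearZ /= val_comp_of /of_comp !mulrA ba -!mulrA ba.
rewrite -!scalerAl -!scalerAr !mulrA corner_val scalerA -natrM mulnb [l.2 == _]eq_sym.
by case: k l => [k1 k2] [l1 l2].
Qed.

Lemma corner_dim : (r ^ 2 * \dim {:corner})%N = \dim {:A}.
Proof.
rewrite (block_dim comp_of_linear of_comp_linear comp_ofK of_compK) card_prod card_ord.
by rewrite mulnn.
Qed.

Lemma of_compM k l d d' : of_comp k d * of_comp l d' = (k.2 == l.1)%:R *: of_comp (k.1, l.2) (d * d').
Proof.
rewrite /of_comp !mulrA -[_ * b _ * a _]mulrA ba -scalerAr -!scalerAl; congr (_ *: _).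
by rewrite /= -[a _ * _ * e]mulrA; have -> : vsval d * e = vsval d; [rewrite -corner_val -!mulrA ee |].
Qed.

Lemma corner_csdiv : csdiv corner.
Proof.
split=> [x|x x0|z zC].
- by apply: corner_inj; rewrite linearD /= h2.
- have x0' : vsval x != 0 by apply: contraNneq x0 => E; apply/eqP/corner_inj.
  have [_ _ emin] := he.
  have inv (y : corner) : y != 0 -> exists y', y * y' = 1.
    move=> y0; have y0' : vsval y != 0 by apply: contraNneq y0 => E; apply/eqP/corner_inj.
    have [t yt] : exists t, vsval y * t = e by apply: emin => //; rewrite -{1}corner_val !mulrA ee corner_val.
    have ye : vsval y * e = vsval y by rewrite -corner_val -!mulrA ee.
    exists (to_corner (e * t * e)); apply: corner_inj.
    rewrite corner_valM to_cornerE; last by rewrite !mulrA ee -!mulrA ee.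
    by rewrite corner_val1 !mulrA ye yt ee.
  have [y xy] := inv x x0.
  have y0 : y != 0 by apply: contraTneq isT => y0; move: xy; rewrite y0 mulr0 => /esym/eqP; rewrite oner_eq0.
  have [z yz] := inv y y0; have zx : z = x by rewrite -[z]mul1r -xy -mulrA yz mulr1.
  by apply/unitrP; exists y; rewrite xy -{1}zx yz.
(* A central element of the corner, repeated along the diagonal, is central in [A]. *)
have [k zk] : exists k : F, \sum_i of_comp (i, i) z = k%:A.
  apply: cen => x; rewrite -[x]comp_ofK mulr_suml mulr_sumr; apply: eq_bigr => -[i j] _.
  rewrite mulr_sumr mulr_suml (bigD1 j) //= [RHS](bigD1 i) //= !of_compM !eqxx !scale1r /= zC.
  rewrite !big1 // => l /negbTE lE; rewrite of_compM /= ?lE ?scale0r // eq_sym lE scale0r //.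
have [i _] : exists i : 'I_r, true.
  case: (r) a b hab => [a' b' [_ _ _]|n _ _ _]; last by exists ord0.
  by rewrite big_ord0 => /esym/eqP; rewrite oner_eq0.
exists k; apply: corner_inj; rewrite -[RHS]/(k *: vsval 1) corner_val1.
have : comp_of (i, i) (\sum_i of_comp (i, i) z) = z.
  rewrite linear_sum /= (bigD1 i) //= of_compK eqxx scale1r big1 ?addr0 // => j ji.
  by rewrite of_compK xpair_eqE eq_sym (negbTE ji) scale0r.
by move=> <-; rewrite zk val_comp_of /= -scalerAr -scalerAl mulr1 ba eqxx scale1r.
Qed.

(** The form consists of the matrices over the form of the corner; the anti-automorphism is the
    transpose with [s] applied to each entry. *)
Lemma corner_nine : nine_parameters corner -> nine_parameters A.
Proof.
move=> [T [s [X [[sM s1] bX hX]]]].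
pose tA (x : A) : A := \sum_k of_comp (k.2, k.1) (s (comp_of k x)).
have tlin : linear tA.
  move=> c x y; rewrite /tA scaler_sumr -big_split; apply: eq_bigr => k _ /=.
  by rewrite !linearP.
have [t tE] := ex_linfun tlin.
have tof k d : t (of_comp k d) = of_comp (k.2, k.1) (s d).
  rewrite tE /tA (bigD1 k) //= of_compK eqxx scale1r big1 ?addr0 // => l lk.
  by rewrite of_compK (negbTE lk) scale0r !linear0.
have ind (P : A -> Prop) : (forall x y, P x -> P y -> P (x + y)) -> P 0 -> (forall k d, P (of_comp k d)) -> forall x, P x.
  by move=> PD P0 Pk x; rewrite -[x]comp_ofK; elim/big_ind: _.
have e1 : 1 = \sum_i of_comp (i, i) 1.
  by rewrite -ab; apply: eq_bigr => i _; rewrite /of_comp corner_val1 ae.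
have tM x y : t (x * y) = t y * t x.
  move: x; apply: (ind) => [x x' E E'||k d]; [by rewrite mulrDl !linearD /= E E' mulrDr | by rewrite mul0r !linear0 mulr0|].
  move: y; apply: (ind) => [y y' E E'||l d']; [by rewrite mulrDr !linearD /= E E' mulrDl | by rewrite mulr0 !linear0 mul0r|].
  by rewrite of_compM linearZ /= !tof of_compM /= eq_sym sM.
pose XA := [seq of_comp k d | k <- enum [set: 'I_r * 'I_r], d <- X].
exists T, t, XA; split.
- split=> //; rewrite e1 linear_sum /=; apply: eq_bigr => i _; by rewrite tof s1.
- have fullX : <<XA>>%VS = fullv.
    apply/eqP; rewrite eqEsubv subvf /=; apply/subvP => x _; move: x; apply: (ind) => [x y||k d]; [exact: memvD | exact: mem0v |].
    have : d \in <<X>>%VS by case/andP: bX => /eqP -> _; exact: memvf.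
    have [f fE] := ex_linfun (of_comp_linear k).
    move=> dX; rewrite -fE; apply: (subvP _ _ (memv_img f dX)).
    rewrite limg_span; apply: sub_span => _ /mapP[g gX ->]; rewrite fE.
    by apply/allpairsP; exists (k, g); rewrite mem_enum inE.
  rewrite /basis_of fullX eqxx /= /free fullX -corner_dim /XA size_allpairs -cardE cardsT card_prod card_ord.
  by case/andP: bX => /eqP <- /eqnP ->; rewrite mulnn.
move=> S hS ST; have [S1 SM Ss] := hX S hS ST.
have lift k d : sspan S X d -> sspan S XA (of_comp k d).
  move: d; apply: (sspan_ind (S := S)).
  - by rewrite linear0; exact: sspan0.
  - by move=> v w; rewrite linearD; exact: sspanD.
  - by move=> c v Sc; rewrite linearZ; exact: sspanZ.
  by move=> d dX; apply: (sspan_mem hS); apply/allpairsP; exists (k, d); rewrite mem_enum inE.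
split.
- by rewrite e1; elim/big_ind: _ => [|x y|i _]; [exact: sspan0 | exact: sspanD | exact: lift].
- move=> _ _ /allpairsP[[k d] [_ dX ->]] /allpairsP[[l d'] [_ d'X ->]]; rewrite of_compM /=.
  by apply: sspanZ => //; [case: eqP => _; [exact: sf1 | exact: sf0] | apply: lift; exact: SM].
by move=> _ /allpairsP[[k d] [_ dX ->]]; rewrite tof; apply: lift; exact: Ss.
Qed.

(* [p1] and [p2] make [V] a module over the tensor square of [A]. The corner [p1 e (p2 e V)] is a line
   over the division algebra for [p1], and an anti-automorphism compares the two actions on it. *)
Section Modules.
Variables (V : vectType F) (p1 p2 : A -> V -> V).
Hypotheses (p1l : forall x, linear (p1 x)) (p1r : forall v, linear (p1^~ v)) (p1M : forall x y v, p1 (x * y) v = p1 x (p1 y v))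
  (p11 : forall v, p1 1 v = v).
Hypotheses (p2l : forall x, linear (p2 x)) (p2r : forall v, linear (p2^~ v)) (p2M : forall x y v, p2 (x * y) v = p2 x (p2 y v))
  (p21 : forall v, p2 1 v = v).
Hypotheses (p12 : forall x y v, p1 x (p2 y v) = p2 y (p1 x v)) (dV : \dim {:V} = \dim {:A}).

Lemma sum_act (p : A -> V -> V) : (forall v, linear (p^~ v)) -> (forall v, p 1 v = v) ->
  (forall x y v, p (x * y) v = p x (p y v)) -> forall v, \sum_i p (a i) (p (b i) v) = v.
Proof.
move=> pr p_1 pM v; rewrite -[RHS]p_1 -ab.
have := linear_sumZ (pr v) (index_enum _) predT (fun _ => 1) (fun i => a i * b i).
rewrite (eq_bigr (fun i => a i * b i)) => [->|i _]; last by rewrite scale1r.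
by apply: eq_bigr => i _; rewrite scale1r pM.
Qed.

Lemma corner_anti : exists th : 'End(corner), antim th.
Proof.
have [L LE] : exists L : 'Hom(V, V), forall v, L v = p1 e (p2 e v).
  by apply: ex_linfun => c x y; rewrite p2l p1l.
pose U : {vspace V} := lker (L - \1)%VF.
have UP v : reflect (p1 e (p2 e v) = v) (v \in U).
  by rewrite memv_ker add_lfunE opp_lfunE LE id_lfunE subr_eq0; exact: eqP.
pose W := subvs_of U.
have valE v : p1 e (p2 e v) = v -> vsval (vsproj U v) = v by move=> vE; apply: vsprojK; exact/UP.
have W1 (w : W) : p1 e (vsval w) = vsval w.
  by have /UP E : vsval w \in U := subvsP w; rewrite -{1}E -p1M ee E.
have W2 (w : W) : p2 e (vsval w) = vsval w.
  by have /UP E : vsval w \in U := subvsP w; rewrite -{1}E p12 -p2M ee -p12 E.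
have WP v : p1 e v = v -> p2 e v = v -> vsval (vsproj U v) = v by move=> v1 v2; apply: valE; rewrite v2 v1.
have r0 : (0 < r)%N.
  rewrite lt0n; apply: contraTneq isT => rz; have := ab.
  rewrite big1 => [/esym/eqP|i _]; first by rewrite oner_eq0.
  by have := ltn_ord i; rewrite [X in (_ < X)%N]rz.
(* Under both actions [V] splits into [r ^ 2] copies of [W], just as [A] splits into [r ^ 2] copies
   of the corner. *)
have dW : \dim {:W} = \dim {:corner}.
  have : (r ^ 2 * \dim {:W})%N = \dim {:V}.
    rewrite (@block_dim _ V W ('I_r * 'I_r)%type (fun k v => vsproj U (p1 (b k.1) (p2 (b k.2) v)))
      (fun k w => p1 (a k.1) (p2 (a k.2) (vsval w)))); first by rewrite card_prod card_ord mulnn.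
    - by move=> k c x y; rewrite p2l p1l linearP.
    - by move=> k c x y; rewrite linearP p2l p1l.
    - move=> v; rewrite (eq_bigr (fun k : 'I_r * 'I_r => p1 (a k.1) (p1 (b k.1) (p2 (a k.2) (p2 (b k.2) v))))).
        rewrite -(pair_bigA _ (fun i j => p1 (a i) (p1 (b i) (p2 (a j) (p2 (b j) v))))) /= exchange_big /=.
        by rewrite (eq_bigr (fun j => p2 (a j) (p2 (b j) v))) ?sum_act // => j _; rewrite sum_act.
      move=> k _; rewrite WP; [|by rewrite -p1M eb|by rewrite -p12 -p2M eb].
      by rewrite [p1 (b _) (p2 (a _) _)]p12.
    - move=> k l w; apply: val_inj; rewrite -[LHS]/(vsval _) -[RHS]/(_ *: vsval w).
      have E : p1 (b k.1) (p2 (b k.2) (p1 (a l.1) (p2 (a l.2) (vsval w)))) = (k == l)%:R *: vsval w.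
        rewrite -p12 -p1M -p2M !ba (linear_mapZ (p1r _)) (linear_mapZ (p2r _)) W2.
        by rewrite (linear_mapZ (p1l e)) W1 scalerA -natrM mulnb; case: k l => [k1 k2] [l1 l2].
      by rewrite E WP // ?(linear_mapZ (p1l e)) ?(linear_mapZ (p2l e)) ?W1 ?W2.
  rewrite dV -corner_dim => /eqP; rewrite eqn_pmul2l ?expn_gt0 ?r0 // => /eqP.
  by [].
have [w0 w0n] : exists w : W, w != 0.
  have [//|h] := EM (exists w : W, w != 0).
  have : \dim {:W} = 0%N.
    apply/eqP; rewrite dimv_eq0 -subv0; apply/subvP => w _; rewrite memv0.
    by apply/negPn/negP => wn; case: h; exists w.
  by rewrite dW => /eqP; rewrite dimv_eq0 => /eqP E; move: (memvf (1 : corner)); rewrite E memv0 oner_eq0.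
pose v := vsval w0; have [_ cU _] := corner_csdiv.
have dv1 (d : corner) : vsval (vsproj U (p1 (vsval d) v)) = p1 (vsval d) v.
  by apply: WP; [rewrite -p1M -corner_val !mulrA ee | rewrite -p12 W2].
have dv2 (d : corner) : vsval (vsproj U (p2 (vsval d) v)) = p2 (vsval d) v.
  by apply: WP; [rewrite p12 W1 | rewrite -p2M -corner_val !mulrA ee].
have [G GE] : exists G : 'Hom(corner, W), forall d, G d = vsproj U (p1 (vsval d) v).
  by apply: ex_linfun => c x y; rewrite linearP p1r linearP.
have [H HE] : exists H : 'Hom(corner, W), forall d, H d = vsproj U (p2 (vsval d) v).
  by apply: ex_linfun => c x y; rewrite linearP p2r linearP.
have G0 : lker G == 0%VS.
  rewrite -subv0; apply/subvP => d; rewrite memv_ker memv0 GE => /eqP Gd; apply/negPn/negP => dn.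
  have pd : p1 (vsval d) v = 0 by rewrite -dv1 Gd linear0.
  case/eqP: w0n; apply: val_inj; rewrite -[LHS]/v -[RHS]/(0 : V).
  rewrite /v -W1 -corner_val1 -(mulVr (cU d dn)) corner_valM p1M pd.
  exact: linear_map0 (p1l _).
have Gf : limg G = fullv.
  apply/eqP; rewrite eqEdim subvf /= -[X in (_ <= X)%N]/(\dim _).
  have := limg_ker_dim G fullv; rewrite (eqP G0) capv0 dimv0 add0n => ->.
  by rewrite dW.
(* [th d] is the element acting on [v] through [p1] as [d] does through [p2]; since the two actions
   commute, products are reversed. *)
pose th : 'End(corner) := (G^-1 \o H)%VF.
have thE d : p1 (vsval (th d)) v = p2 (vsval d) v.
  by rewrite -dv1 -dv2 -HE -GE comp_lfunE limg_lfunVK // Gf memvf.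
have /lker0P Ginj := G0.
have inj (x y : corner) : p1 (vsval x) v = p1 (vsval y) v -> x = y.
  by move=> E; apply: (Ginj); rewrite !GE E.
exists th; split=> [x y|]; apply: inj.
  by rewrite thE !corner_valM p2M p1M -(thE y) -p12 -(thE x).
by rewrite thE corner_val1 W1 W2.
Qed.
End Modules.
End Corner.

(** * Algebras given by structure constants *)

(* The proofs are arguments of [calg] so that the ring structure can be attached to it. *)
Definition calg (F : fieldType) (I : finType) (c : I -> I -> I -> F) (u : {ffun I -> F}) of alg_assoc c & alg_unit c u & u != 0 : Type :=
  {ffun I -> F^o}.

Section Calg.
Variables (F : fieldType) (I : finType) (c : I -> I -> I -> F) (u : {ffun I -> F}).
Hypotheses (cA : alg_assoc c) (cu : alg_unit c u) (u0 : u != 0).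
Notation R := (calg cA cu u0).

HB.instance Definition _ := Vector.copy R {ffun I -> F^o}.

Lemma amulDl x y z : amul c (x + y) z = amul c x z + amul c y z.
Proof.
apply/ffunP => l; rewrite !ffunE -big_split; apply: eq_bigr => i _ /=.
by rewrite -big_split; apply: eq_bigr => j _ /=; rewrite ffunE !mulrDl.
Qed.

Lemma amulDr x y z : amul c z (x + y) = amul c z x + amul c z y.
Proof.
apply/ffunP => l; rewrite !ffunE -big_split; apply: eq_bigr => i _ /=.
by rewrite -big_split; apply: eq_bigr => j _ /=; rewrite ffunE mulrDr !mulrDl.
Qed.

Lemma amulZl k x y : amul c (ascale k x) y = ascale k (amul c x y).
Proof.
apply/ffunP => l; rewrite !ffunE mulr_sumr; apply: eq_bigr => i _.
by rewrite mulr_sumr; apply: eq_bigr => j _; rewrite ffunE !mulrA.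
Qed.

Lemma amulZr k x y : amul c x (ascale k y) = ascale k (amul c x y).
Proof.
apply/ffunP => l; rewrite !ffunE mulr_sumr; apply: eq_bigr => i _.
rewrite mulr_sumr; apply: eq_bigr => j _; rewrite ffunE; ring.
Qed.

Definition calg_mul (x y : R) : R := amul c x y.
Lemma calg_mulA : associative calg_mul. Proof. by move=> x y z; exact/esym/cA. Qed.
Lemma calg_mul1l : left_id (u : R) calg_mul. Proof. by move=> x; case: (cu x). Qed.
Lemma calg_mul1r : right_id (u : R) calg_mul. Proof. by move=> x; case: (cu x). Qed.
Lemma calg_mulDl : left_distributive calg_mul +%R. Proof. by move=> x y z; exact: amulDl. Qed.
Lemma calg_mulDr : right_distributive calg_mul +%R. Proof. by move=> x y z; exact: amulDr. Qed.
HB.instance Definition _ := GRing.Zmodule_isNzRing.Build R calg_mulA calg_mul1l calg_mul1r calg_mulDl calg_mulDr u0.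

Lemma calg_scaleE k (x : R) : k *: x = ascale k x.
Proof. by apply/ffunP => i; rewrite !ffunE. Qed.

Lemma calg_scaleAl k (x y : R) : k *: (x * y) = (k *: x) * y.
Proof. by rewrite !calg_scaleE; exact/esym/amulZl. Qed.
HB.instance Definition _ := GRing.Lmodule_isLalgebra.Build F R calg_scaleAl.

Lemma calg_scaleAr k (x y : R) : k *: (x * y) = x * (k *: y).
Proof. by rewrite !calg_scaleE; exact/esym/amulZr. Qed.
HB.instance Definition _ := GRing.Lalgebra_isAlgebra.Build F R calg_scaleAr.
HB.instance Definition _ := Algebra_isFalgebra.Build F R.

Definition falg_of : falgType F := R.

Lemma calg_dim : \dim {:falg_of} = #|I|.
Proof. by rewrite dimvf /= /dim /= muln1. Qed.

Lemma calg_central : (forall z, (forall x, amul c z x = amul c x z) -> exists a : F, z = ascale a u) -> central_alg falg_of.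
Proof.
move=> h z zC; have [|k zk] := h z; first by move=> x; exact/esym/zC.
by exists k; rewrite zk -calg_scaleE.
Qed.

Lemma calg_full : (forall P, alg_ideal c P -> (forall x, P x -> x = 0) \/ (forall x, P x)) -> full_ideals falg_of.
Proof.
move=> h x x0; pose P (y : {ffun I -> F}) := exists s : seq (falg_of * falg_of), \sum_(p <- s) p.1 * x * p.2 = (y : falg_of).
have Pi : alg_ideal c P.
  split.
  - by exists [::]; rewrite big_nil.
  - by move=> y z [s sy] [t tz]; exists (s ++ t); rewrite big_cat /= sy tz.
  - move=> k y [s sy]; exists [seq (k *: p.1, p.2) | p <- s].
    rewrite -calg_scaleE -sy big_map scaler_sumr; apply: eq_bigr => p _ /=.
    by rewrite -!scalerAl.
  move=> y z [s sz]; split; [exists [seq ((y : falg_of) * p.1, p.2) | p <- s] | exists [seq (p.1, p.2 * (y : falg_of)) | p <- s]].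
    by rewrite big_map -[RHS]/((y : falg_of) * z) -sz mulr_sumr; apply: eq_bigr => p _ /=; rewrite !mulrA.
  by rewrite big_map -[RHS]/((z : falg_of) * y) -sz mulr_suml; apply: eq_bigr => p _ /=; rewrite !mulrA.
case: (h P Pi) => [P0|PT]; last exact: PT.
case/eqP: x0; apply: P0; exists [:: (1, 1)]; by rewrite big_seq1 mul1r mulr1.
Qed.
End Calg.

(** * The two commuting actions given by a splitting of the tensor square *)

Section Split.
Variables (F : fieldType).

Lemma matcM N (M M' : {ffun 'I_N * 'I_N -> F}) i j :
  amul (@matc F N) M M' (i, j) = \sum_k M (i, k) * M' (k, j).
Proof.
rewrite ffunE (eq_bigr (fun p : 'I_N * 'I_N => \sum_q M (p.1, p.2) * M' q * matc F (p.1, p.2) q (i, j))); last by case.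
rewrite -(pair_bigA _ (fun a k => \sum_q M (a, k) * M' q * matc F (a, k) q (i, j))) /=.
rewrite (bigD1 i) //= [X in _ + X]big1 ?addr0 => [|a ai]; last first.
  by rewrite big1 // => k _; rewrite big1 // => q _; rewrite /matc /= [i == a]eq_sym (negbTE ai) andbF mulr0.
apply: eq_bigr => k _; rewrite (bigD1 (k, j)) //= /matc /= !eqxx mulr1 big1 ?addr0 // => [[q1 q2]] qn.
rewrite /=; case: ifP => [/andP[/eqP kq /eqP jq]|_]; last by rewrite mulr0.
by case/eqP: qn; rewrite -kq -jq.
Qed.

Variables (I : finType) (c : I -> I -> I -> F) (u : {ffun I -> F}) (cu : alg_unit c u).

Definition tprod e (z : 'I_e -> {ffun I -> F}) : {ffun {ffun 'I_e -> I} -> F} := [ffun p : {ffun 'I_e -> I} => \prod_t z t (p t)].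

Lemma tprodM e (z w : 'I_e -> {ffun I -> F}) :
  amul (@tpow F I e c) (tprod z) (tprod w) = tprod (fun t => amul c (z t) (w t)).
Proof.
apply/ffunP => r; rewrite !ffunE.
under [RHS]eq_bigr do rewrite ffunE.
rewrite bigA_distr_bigA /=; apply: eq_bigr => p _.
rewrite bigA_distr_bigA /=; apply: eq_bigr => q _.
by rewrite !ffunE -!big_split.
Qed.

Lemma eq_tprod e (z w : 'I_e -> {ffun I -> F}) : z =1 w -> tprod z = tprod w.
Proof. by move=> E; apply/ffunP => p; rewrite !ffunE; apply: eq_bigr => t _; rewrite E. Qed.

Lemma unit_struct j l : \sum_i u i * c i j l = (j == l)%:R.
Proof.
have [] := cu [ffun i => (i == j)%:R : F]; move/ffunP/(_ l); rewrite !ffunE => E _.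
rewrite eq_sym -E; apply: eq_bigr => i _; rewrite (bigD1 j) //= ffunE eqxx mulr1 big1 ?addr0 // => k /negbTE kj.
by rewrite ffunE kj mulr0 mul0r.
Qed.

Lemma tprod_unit e (z : {ffun {ffun 'I_e -> I} -> F}) : amul (@tpow F I e c) (tprod (fun=> u)) z = z.
Proof.
apply/ffunP => r; rewrite ffunE exchange_big /= (bigD1 r) //= [X in _ + X]big1 ?addr0 => [|q qr].
  transitivity (z r * \sum_(p : {ffun 'I_e -> I}) \prod_t (u (p t) * c (p t) (r t) (r t))).
    by rewrite mulr_sumr; apply: eq_bigr => p _; rewrite ffunE /tpow big_split /= -mulrA mulrCA.
  rewrite -(bigA_distr_bigA (fun t i => u i * c i (r t) (r t))) big1 ?mulr1 // => t _.
  by rewrite unit_struct eqxx.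
transitivity (z q * \sum_(p : {ffun 'I_e -> I}) \prod_t (u (p t) * c (p t) (q t) (r t))).
  by rewrite mulr_sumr; apply: eq_bigr => p _; rewrite ffunE /tpow big_split /= -mulrA mulrCA.
rewrite -(bigA_distr_bigA (fun t i => u i * c i (q t) (r t))).
have [t qt] : exists t, q t != r t.
  have [//|h] := EM (exists t, q t != r t); case/eqP: qr; apply/ffunP => t.
  by apply/eqP/negPn/negP => qt; case: h; exists t.
by rewrite (bigD1 t) //= unit_struct (negbTE qt) mul0r mulr0.
Qed.

Definition slot e (s : 'I_e) (x : {ffun I -> F}) := tprod (fun t => if t == s then x else u).

Lemma slotM e (s : 'I_e) x y : amul (@tpow F I e c) (slot s x) (slot s y) = slot s (amul c x y).
Proof. by rewrite tprodM; apply: eq_tprod => t; case: ifP => // _; case: (cu u). Qed.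

Lemma slot_comm e (s s' : 'I_e) x y : s != s' ->
  amul (@tpow F I e c) (slot s x) (slot s' y) = amul (@tpow F I e c) (slot s' y) (slot s x).
Proof.
move=> ss; rewrite !tprodM; apply: eq_tprod => t.
have [->|ts] := eqVneq t s; first by rewrite (negbTE ss); case: (cu x) => -> ->.
by case: ifP => _ //; case: (cu y) => -> ->.
Qed.

Lemma slot_linear e (s : 'I_e) k x y : slot s (ascale k x + y) = ascale k (slot s x) + slot s y.
Proof.
have sE z (p : {ffun 'I_e -> I}) : slot s z p = z (p s) * \prod_(t | t != s) u (p t).
  by rewrite ffunE (bigD1 s) //= eqxx; congr (_ * _); apply: eq_bigr => t /negbTE ->.
by apply/ffunP => p; rewrite sE [RHS]ffunE [X in _ = X + _]ffunE !sE [(ascale _ _ + _) _]ffunE [ascale _ _ _]ffunE mulrDl mulrA.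
Qed.

Lemma slot_unit e (s : 'I_e) : slot s u = tprod (fun=> u).
Proof. by apply: eq_tprod => t; case: ifP. Qed.

Variables (N : nat) (f : {ffun {ffun 'I_2 -> I} -> F} -> {ffun 'I_N * 'I_N -> F}).
Hypotheses (fl : forall (a : F) x y, f (ascale a x + y) = ascale a (f x) + f y) (fb : bijective f)
  (fM : forall x y, f (amul (@tpow F I 2 c) x y) = amul (@matc F N) (f x) (f y)).

Definition mact (M : {ffun 'I_N * 'I_N -> F}) (v : {ffun 'I_N -> F^o}) : {ffun 'I_N -> F^o} :=
  [ffun i => \sum_j M (i, j) * v j].

Definition rep (s : 'I_2) (x : {ffun I -> F}) := mact (f (slot s x)).

Lemma mactM M M' v : mact (amul (@matc F N) M M') v = mact M (mact M' v).
Proof.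
apply/ffunP => i; rewrite !ffunE.
under eq_bigr => j _ do rewrite matcM mulr_suml.
rewrite exchange_big /=; apply: eq_bigr => k _; rewrite ffunE mulr_sumr.
by apply: eq_bigr => j _; rewrite mulrA.
Qed.

Lemma mact_linear M : linear (mact M).
Proof.
move=> k x y; apply/ffunP => i; rewrite !ffunE scaler_sumr -big_split; apply: eq_bigr => j _ /=.
by rewrite !ffunE mulrDr; congr (_ + _); exact: mulrCA.
Qed.

Lemma rep_linear s v k x y : rep s (ascale k x + y) v = k *: rep s x v + rep s y v.
Proof.
rewrite /rep slot_linear fl; apply/ffunP => i; rewrite !ffunE scaler_sumr -big_split; apply: eq_bigr => j _ /=.
by rewrite !ffunE mulrDl -mulrA.
Qed.

Lemma repM s x y v : rep s (amul c x y) v = rep s x (rep s y v).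
Proof. by rewrite /rep -slotM fM mactM. Qed.

(** [f] sends the unit to a left unit of the matrix algebra; multiply it by the matrix all of whose
    columns are [v]. *)
Lemma rep1 s v : rep s u v = v.
Proof.
rewrite /rep slot_unit; set E := f _.
have EM M : amul (@matc F N) E M = M.
  by case: fb => g gK Kg; rewrite -[M]Kg -fM tprod_unit.
apply/ffunP => i; rewrite ffunE.
have := EM [ffun p => v p.1]; move/ffunP/(_ (i, i)); rewrite matcM ffunE /= => <-.
by apply: eq_bigr => j _; rewrite ffunE.
Qed.

Lemma rep_comm s s' x y v : s != s' -> rep s x (rep s' y v) = rep s' y (rep s x v).
Proof. by move=> ss; rewrite /rep -!mactM -!fM slot_comm. Qed.
End Split.

Section CsaNine.
Variables (F : fieldType) (I : finType) (c : I -> I -> I -> F).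
Hypotheses (ch2 : 2 \in [pchar F]) (hA : is_csa 8 c) (hexp : exp_dvd 8 2 c).

Lemma csa_nine : exists (A : falgType F) (g : {ffun I -> F} -> A),
  [/\ [/\ linear (g : {ffun I -> F^o} -> A), bijective g & forall x y, g (amul c x y) = g x * g y], central_alg A, full_ideals A, \dim {:A} = #|I| & nine_parameters A].
Proof.
case: hA => cI cA [u [cu cC cS]].
have u0 : u != 0.
  apply/eqP => uz; have I0 : (0 < #|I|)%N by rewrite cI.
  have /card_gt0P[i _] := I0; have [] := cu [ffun=> 1]; rewrite uz => /ffunP /(_ i).
  rewrite !ffunE big1 => [/esym/eqP|j _]; first by rewrite oner_eq0.
  by rewrite big1 // => l _; rewrite ffunE !mul0r.
pose A := falg_of cA cu u0.
have h2 (x : A) : x + x = 0.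
  by rewrite -mulr2n -scaler_nat (pcharf0 ch2) scale0r.
have cenA : central_alg A by exact: calg_central.
have fullA : full_ideals A by exact: calg_full.
have dA : \dim {:A} = #|I| by exact: calg_dim.
exists A, id; split=> //; first by split=> //; exists id.
have [e he] := ex_min_idem fullA; have [r [a [b hab]]] := ex_munits fullA he.
case: hexp => f [fl fb fM].
(* The columns on which the split tensor square acts have length [8 ^ 2], which is also the
   dimension of [A], as [corner_anti] requires. *)
pose V : vectType F := {ffun 'I_(8 ^ 2) -> F^o}.
have dV : \dim {:V} = \dim {:A}.
  by rewrite dA cI dimvf /dim /= card_ord muln1.
apply: (corner_nine (he := he) hab).
have [th hth] : exists th : 'End(corner he), antim th.
  apply: (corner_anti cenA h2 he hab (V := V) (p1 := rep u f ord0) (p2 := rep u f ord_max)) => //.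
  - by move=> x; exact: mact_linear.
  - by move=> v k x y; rewrite calg_scaleE; exact: rep_linear.
  - by move=> x y v; exact: repM.
  - by move=> v; exact: rep1.
  - by move=> x; exact: mact_linear.
  - by move=> v k x y; rewrite calg_scaleE; exact: rep_linear.
  - by move=> x y v; exact: repM.
  - by move=> v; exact: rep1.
  - by move=> x y v; exact: rep_comm.
apply: (division_nine (corner_csdiv cenA h2 he hab) hth (m := r)).
by rewrite (corner_dim he hab) dA cI.
Qed.
End CsaNine.

(** * The field of definition *)

Section SubfieldType.
Variables (F : fieldType) (S : F -> Prop) (hS : subfield_pred S).

(** The proof is an argument so that the closure instance can be attached to the predicate. *)
Definition subfield_mem of subfield_pred S : pred F := fun x => `[<S x>].

Lemma subfield_divring : divring_closed (subfield_mem hS).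
Proof.
split; first by apply/asboolP; exact: sf1.
  by move=> x y /asboolP Sx /asboolP Sy; apply/asboolP; exact: sfB.
by move=> x y /asboolP Sx /asboolP Sy; apply/asboolP; apply: sfM => //; exact: sfV.
Qed.
HB.instance Definition _ := GRing.isDivringClosed.Build F (subfield_mem hS) subfield_divring.

Definition subfield := {x : F | x \in subfield_mem hS}.
HB.instance Definition _ := SubType.on subfield.
HB.instance Definition _ := Choice.on subfield.
HB.instance Definition _ := [SubChoice_isSubIntegralDomain of subfield by <:].
HB.instance Definition _ := [SubIntegralDomain_isSubField of subfield by <:].

Lemma subfieldP (x : subfield) : S (val x). Proof. exact/asboolP/(valP x). Qed.
End SubfieldType.

Section SubfieldIncl.
Variables (F : fieldType) (S : F -> Prop) (hS : subfield_pred S).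
Definition subfield_field : fieldType := subfield hS.
Definition subfield_incl : {rmorphism subfield_field -> F} := \val.
Lemma subfield_inclP x : S (subfield_incl x). Proof. exact: subfieldP. Qed.
Lemma subfield_lift x : S x -> exists y, subfield_incl y = x.
Proof. by move=> /asboolP Sx; exists (Sub x Sx : subfield hS); exact: SubK. Qed.
End SubfieldIncl.

Lemma ex_kernel (k : fieldType) (T1 T2 : finType) (c : T1 -> T2 -> k) : (#|T2| < #|T1|)%N ->
  exists w : T1 -> k, (exists i, w i != 0) /\ forall j, \sum_i w i * c i j = 0.
Proof.
move=> lt; pose C := \matrix_(i < #|T1|, j < #|T2|) c (enum_val i) (enum_val j).
have kn0 : kermx C != 0.
  rewrite -mxrank_eq0 mxrank_ker -lt0n subn_gt0.
  exact: leq_ltn_trans (rank_leq_col C) lt.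
have /rowV0Pn[w0 /sub_kermxP wC w0n] := kn0.
have /rV0Pn[i wi] := w0n.
exists (fun a => w0 0 (enum_rank a)); split; first by exists (enum_val i); rewrite enum_valK.
move=> b; have /rowP/(_ (enum_rank b)) := wC; rewrite !mxE => E; rewrite -[RHS]E.
rewrite (reindex _ (onW_bij _ (enum_val_bij T1))) /=; apply: eq_bigr => j _.
by rewrite !mxE enum_valK enum_rankK.
Qed.

(** * Transcendence degree by counting monomials *)

Section Box.
Variables (k F : fieldType) (iota : {rmorphism k -> F}) (m : nat) (T : 'I_m -> F).

Definition mon (e : 'I_m -> nat) := \prod_i T i ^+ e i.

(** Values of polynomials in the [T i] of degree less than [n] in each variable. *)
Definition box n x := exists c : {ffun 'I_m -> 'I_n} -> k, x = \sum_(al : {ffun 'I_m -> 'I_n}) iota (c al) * mon (fun i => al i).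

Lemma box0 n : box n 0.
Proof. by exists (fun=> 0); rewrite big1 // => al _; rewrite rmorph0 mul0r. Qed.

Lemma boxD n x y : box n x -> box n y -> box n (x + y).
Proof.
move=> [c ->] [d ->]; exists (fun al => c al + d al); rewrite -big_split; apply: eq_bigr => al _ /=.
by rewrite rmorphD mulrDl.
Qed.

Lemma boxZ n a x : box n x -> box n (iota a * x).
Proof.
move=> [c ->]; exists (fun al => a * c al); rewrite mulr_sumr; apply: eq_bigr => al _ /=.
by rewrite rmorphM mulrA.
Qed.

Lemma box_mon n (e : 'I_m -> nat) : (forall i, (e i < n)%N) -> box n (mon e).
Proof.
move=> en; pose b : {ffun 'I_m -> 'I_n} := [ffun i => Ordinal (en i)].
exists (fun al => (al == b)%:R); rewrite (bigD1 b) //= eqxx rmorph1 mul1r big1 ?addr0.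
  by apply: eq_bigr => i _; rewrite ffunE.
by move=> al /negbTE ->; rewrite rmorph0 mul0r.
Qed.

Lemma box_ind n (Q : F -> Prop) : Q 0 -> (forall x y, Q x -> Q y -> Q (x + y)) -> (forall a x, Q x -> Q (iota a * x)) ->
  (forall e : 'I_m -> nat, (forall i, (e i < n)%N) -> Q (mon e)) -> forall x, box n x -> Q x.
Proof. by move=> Q0 QD QZ Qm x [c ->]; elim/big_ind: _ => // al _; apply/QZ/Qm. Qed.

Lemma box_leq n n' x : (n <= n')%N -> box n x -> box n' x.
Proof.
move=> le; move: x; apply: box_ind; [exact: box0 | exact: boxD | exact: boxZ |].
by move=> e en; apply: box_mon => i; exact: leq_trans (en i) le.
Qed.

Lemma boxM n n' x y : box n x -> box n' y -> box (n + n') (x * y).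
Proof.
move=> bx by_; move: x bx; apply: box_ind.
- by rewrite mul0r; exact: box0.
- by move=> x x' h h'; rewrite mulrDl; exact: boxD.
- by move=> a x h; rewrite -mulrA; exact: boxZ.
move=> e en; move: y by_; apply: box_ind.
- by rewrite mulr0; exact: box0.
- by move=> y y' h h'; rewrite mulrDr; exact: boxD.
- by move=> a y h; rewrite mulrCA; exact: boxZ.
move=> e' en'; have -> : mon e * mon e' = mon (fun i => e i + e' i)%N.
  by rewrite -big_split; apply: eq_bigr => i _; rewrite exprD.
by apply: box_mon => i; have := en i; have := en' i; lia.
Qed.

Lemma box_iota a : box 1 (iota a).
Proof.
rewrite -[iota a]mulr1; apply: boxZ; have -> : 1 = mon (fun=> 0%N) by rewrite /mon big1.
exact: box_mon.
Qed.

Lemma box1 : box 1 1. Proof. by rewrite -(rmorph1 iota); exact: box_iota. Qed.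

Lemma box_T i : box 2 (T i).
Proof.
have -> : T i = mon (fun j => (j == i) : nat).
  rewrite /mon (bigD1 i) //= eqxx expr1 big1 ?mulr1 // => j /negbTE ->; exact: expr0.
by apply: box_mon => j; case: (j == i).
Qed.

Lemma box_prod (J : finType) (P : pred J) (n : J -> nat) (f : J -> F) : (forall j, box (n j) (f j)) ->
  box (1 + \sum_j n j) (\prod_(j | P j) f j).
Proof.
move=> h; apply: (box_leq (n := 1 + \sum_(j | P j) n j)).
  by rewrite leq_add2l [X in (_ <= X)%N](bigID P) leq_addr.
elim: (index_enum J) => [|j r IH] /=.
  by rewrite !big_nil; exact: box1.
rewrite !big_cons; case: ifP => // _; rewrite addnCA; exact: boxM.
Qed.

Lemma box_exp n d x : box d x -> box (1 + n * d) (x ^+ n).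
Proof.
move=> h; elim: n => [|n IH]; first by rewrite expr0; exact: box1.
by rewrite exprS mulSn addnCA; exact: boxM.
Qed.

(* The subfield generated by the image of [iota] and the [T i]. *)
Definition gen_field x := exists n p q, [/\ box n p, box n q, q != 0 & x = p / q].

Lemma gen_box n x : box n x -> gen_field x.
Proof.
move=> h; exists (n + 1)%N, x, 1; split; [by apply: box_leq h; exact: leq_addr | by apply: box_leq box1; exact: leq_addl | exact: oner_neq0 | by rewrite divr1].
Qed.

Lemma gen_fieldP : subfield_pred gen_field.
Proof.
split.
- exact: gen_box box1.
- move=> _ _ [n [p [q [bp bq q0 ->]]]] [n' [p' [q' [bp' bq' q0' ->]]]].
  exists (n + n')%N, (p * q' - p' * q), (q * q'); split; [|exact: boxM | by rewrite mulf_neq0 | by field; rewrite q0 q0'].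
  apply: boxD; first exact: boxM.
  by rewrite -mulN1r -(rmorph1 iota) -rmorphN; apply: boxZ; rewrite mulrC; exact: boxM.
- move=> _ _ [n [p [q [bp bq q0 ->]]]] [n' [p' [q' [bp' bq' q0' ->]]]].
  by exists (n + n')%N, (p * p'), (q * q'); split; [exact: boxM | exact: boxM | rewrite mulf_neq0 | field; rewrite q0 q0'].
move=> _ [n [p [q [bp bq q0 ->]]]]; have [p0|p0] := eqVneq p 0.
  by rewrite p0 mul0r invr0; exact: gen_box (box0 1).
by exists n, q, p; split=> //; rewrite invf_div.
Qed.

Lemma common_denom (J : finType) (t : J -> F) : (forall j, gen_field (t j)) ->
  exists d q, [/\ q != 0, box d q & forall j, box d (t j * q)].
Proof.
move=> /choice[n /choice[p /choice[q h]]].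
exists (1 + \sum_j n j)%N, (\prod_j q j); split.
- by apply/prodf_neq0 => j _; case: (h j).
- by apply: box_prod => j; case: (h j).
move=> j; have -> : t j * \prod_i q i = \prod_i (if i == j then p i else q i).
  rewrite (bigD1 j) //= [RHS](bigD1 j) //= eqxx mulrA; have [_ _ q0 ->] := h j.
  by rewrite divfK //; congr (_ * _); apply: eq_bigr => i /negbTE ->.
by apply: box_prod => i; case: ifP => _; case: (h i).
Qed.

(* Over a common denominator [q], the [M ^ m.+1] monomials in [t], times a fixed power of [q], lie in
   a space of dimension [B ^ m] with [B = O(M)]. *)
Lemma gen_field_trdeg (t : 'I_m.+1 -> F) : (forall i, gen_field (t i)) ->
  exists P : {mpoly k[m.+1]}, P != 0 /\ mmap iota t P = 0.
Proof.
move=> /common_denom[d [q [q0 bq bt]]].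
(* As [B <= M * K] and [K ^ m < M], one gets [B ^ m <= M ^ m * K ^ m < M ^ m.+1]: there are more
   monomials in [t] than coordinates to express them. *)
pose K := (1 + m.+1 * (2 + d))%N; pose M := (K ^ m).+1; pose B := (1 + m.+1 * (2 + M * d))%N.
have BM : (B ^ m < M ^ m.+1)%N.
  apply: (@leq_ltn_trans ((M * K) ^ m)%N); last by rewrite expnMn expnSr ltn_pmul2l ?expn_gt0.
  have [->|m0] := posnP m; first by rewrite !expn0.
  have BK M' : (1 <= M')%N -> (1 + m.+1 * (2 + M' * d) <= M' * (1 + m.+1 * (2 + d)))%N by clear; nia.
  by rewrite leq_exp2r //; exact: BK.
pose ev (al : {ffun 'I_m.+1 -> 'I_M}) := \prod_i t i ^+ al i.
have bev al : box B (ev al * \prod_(i < m.+1) q ^+ M).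
  rewrite -big_split /=; have -> : B = (1 + \sum_(i < m.+1) (2 + M * d))%N by rewrite sum_nat_const card_ord.
  apply: box_prod => i; have aM : (al i <= M)%N by rewrite ltnW.
  have -> : t i ^+ al i * q ^+ M = (t i * q) ^+ al i * q ^+ (M - al i).
    by rewrite exprMn -mulrA -exprD subnKC.
  apply: box_leq (boxM (box_exp (al i) (bt i)) (box_exp (M - al i) bq)).
  by rewrite addnACA -mulnDl subnKC.
have [c cE] := choice bev.
have lt : (#|{ffun 'I_m -> 'I_B}| < #|{ffun 'I_m.+1 -> 'I_M}|)%N by rewrite !card_ffun !card_ord.
have [w [[al0 wn] wE]] := ex_kernel c lt.
pose mm (al : {ffun 'I_m.+1 -> 'I_M}) : 'X_{1..m.+1} := [multinom al i : nat | i < m.+1].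
have mm_inj : injective mm.
  by move=> a b /mnmP E; apply/ffunP => i; apply: val_inj; have := E i; rewrite !mnmE.
exists (\sum_al w al *: 'X_[mm al]); split.
  apply: contraNneq wn => P0; have := congr1 (mcoeff (mm al0)) P0; rewrite mcoeff0 raddf_sum /= => <-.
  rewrite (bigD1 al0) //= mcoeffZ mcoeffX eqxx mulr1 big1 ?addr0 // => a aal.
  by rewrite mcoeffZ mcoeffX (inj_eq mm_inj) (negbTE aal) mulr0.
have qn : \prod_(i < m.+1) q ^+ M != 0 by apply/prodf_neq0 => i _; exact: expf_neq0.
apply: (mulIf qn); rewrite mul0r raddf_sum /= mulr_suml.
transitivity (\sum_al \sum_be iota (w al * c al be) * mon (fun i => be i)).
  apply: eq_bigr => al _; rewrite mmapZ mmapX /mmap1 -mulrA.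
  have -> : \prod_i t i ^+ mm al i = ev al by apply: eq_bigr => i _; rewrite mnmE.
  rewrite cE mulr_sumr; apply: eq_bigr => be _; by rewrite rmorphM mulrA.
rewrite exchange_big /= big1 // => be _; rewrite -mulr_suml -rmorph_sum wE.
by rewrite rmorph0 mul0r.
Qed.
End Box.

(** * The form over the field of definition *)

Lemma basis_index (F : fieldType) (A : falgType F) (I : finType) (X : seq A) : basis_of {:A} X -> \dim {:A} = #|I| ->
  exists xb : I -> A, [/\ forall i, xb i \in X, forall x, x \in X -> exists i, x = xb i,
    forall a, exists f : I -> F, a = \sum_i f i *: xb i & forall f : I -> F, \sum_i f i *: xb i = 0 -> forall i, f i = 0].
Proof.
move=> bX dI; have sX : size X == #|I| by rewrite -dI; case/andP: (bX) => /eqP <- /eqnP ->.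
pose Xt := Tuple sX; have bXt : basis_of {:A} Xt by [].
exists (fun i => Xt`_(enum_rank i)); split.
- by move=> i; apply: mem_nth; rewrite (eqP sX).
- move=> x xX; have xI : (index x X < #|I|)%N by rewrite -(eqP sX) index_mem.
  by exists (enum_val (Ordinal xI)); rewrite enum_valK /= nth_index.
- move=> a; exists (fun i => coord Xt (enum_rank i) a).
  rewrite {1}(coord_basis bXt (memvf a)) (reindex _ (onW_bij _ (enum_rank_bij I))) /=.
  exact: eq_bigr.
move=> f f0 i; rewrite -[i]enum_rankK.
have := free_seq (basis_free bXt) (k := fun j => f (enum_val j)); apply.
rewrite (reindex _ (onW_bij _ (enum_rank_bij I))) /= -[RHS]f0; apply: eq_bigr => j _.
by rewrite enum_rankK.
Qed.

Lemma sum_pairs (V : zmodType) (I : finType) (G : I -> I -> V) :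
  \sum_(r : {ffun 'I_2 -> I}) G (r ord0) (r ord_max) = \sum_i \sum_j G i j.
Proof.
rewrite pair_bigA /= (reindex (fun p : I * I => [ffun t : 'I_2 => if t == ord0 then p.1 else p.2])) /=.
  by apply: eq_bigr => p _; rewrite !ffunE.
exists (fun r => (r ord0, r ord_max)) => [[i j] _|r _]; first by rewrite !ffunE.
apply/ffunP => t; rewrite ffunE; case: eqP => [->//|/eqP t0] /=.
by congr (r _); apply: val_inj; case: t t0 => [[|[|t]] ht].
Qed.

Lemma anti_inj (F : fieldType) (A : falgType F) (s : 'End(A)) x : full_ideals A -> antim s -> s x = 0 -> x = 0.
Proof.
move=> full [sM s1] sx; apply/eqP/negPn/negP => /full[q E].
have /eqP : (1 : A) = 0; last by rewrite oner_eq0.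
by rewrite -s1 -E linear_sum big1 // => p _ /=; rewrite !sM sx mul0r mulr0.
Qed.

(* [sandwich] is the map sending a tensor [a (x) b] to the endomorphism [d |-> a d s(b)] of the form. It is
   injective by Artin-Whaples, hence an isomorphism onto all endomorphisms: this splits the tensor
   square of the form, and also shows that the form is simple. *)
Section Form.
Variables (E F : fieldType) (iota : {rmorphism E -> F}) (A : falgType F) (cen : central_alg A) (full : full_ideals A).
Variables (s : 'End(A)) (hs : antim s) (I : finType) (xb : I -> A).
Hypotheses (xspan : forall a, exists f : I -> F, a = \sum_i f i *: xb i)
  (xfree : forall f : I -> F, \sum_i f i *: xb i = 0 -> forall i, f i = 0).

Definition emb (x : {ffun I -> E}) : A := \sum_l iota (x l) *: xb l.

Variables (c0 : I -> I -> I -> E) (sb : I -> {ffun I -> E}) (u : {ffun I -> E}).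
Hypotheses (xM : forall i j, xb i * xb j = \sum_l iota (c0 i j l) *: xb l) (xS : forall j, emb (sb j) = s (xb j)) (x1 : emb u = 1).

Lemma emb_inj : injective emb.
Proof.
move=> x y xy; apply/ffunP => l; apply/(fmorph_inj iota)/eqP; rewrite -subr_eq0; apply/eqP.
move: l; apply: xfree; rewrite (eq_bigr (fun l => iota (x l) *: xb l - iota (y l) *: xb l)).
  by rewrite sumrB -/(emb x) -/(emb y) xy subrr.
by move=> l _; rewrite scalerBl.
Qed.

Lemma embD x y : emb (x + y) = emb x + emb y.
Proof. by rewrite -big_split; apply: eq_bigr => l _; rewrite ffunE rmorphD scalerDl. Qed.

Lemma embZ k x : emb (ascale k x) = iota k *: emb x.
Proof. by rewrite scaler_sumr; apply: eq_bigr => l _; rewrite ffunE rmorphM scalerA. Qed.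

Lemma emb0 : emb 0 = 0.
Proof. by rewrite /emb big1 // => l _; rewrite ffunE rmorph0 scale0r. Qed.

Lemma emb_sum (J : Type) (r : seq J) (f : J -> {ffun I -> E}) : emb (\sum_(j <- r) f j) = \sum_(j <- r) emb (f j).
Proof. by elim/big_rec2: _ => [|j y x _ <-]; rewrite ?emb0 ?embD. Qed.

Lemma embM x y : emb (amul c0 x y) = emb x * emb y.
Proof.
transitivity (\sum_i \sum_j (iota (x i) * iota (y j)) *: (xb i * xb j)); last first.
  rewrite mulr_suml; apply: eq_bigr => i _; rewrite mulr_sumr; apply: eq_bigr => j _.
  by rewrite -scalerAl -scalerAr scalerA.
rewrite /emb; under eq_bigr => l _ do rewrite ffunE rmorph_sum scaler_suml.
rewrite exchange_big; apply: eq_bigr => i _ /=.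
under eq_bigr => l _ do rewrite rmorph_sum scaler_suml.
rewrite exchange_big; apply: eq_bigr => j _ /=; rewrite xM scaler_sumr; apply: eq_bigr => l _.
by rewrite !rmorphM scalerA.
Qed.

Definition dlt (i : I) : {ffun I -> E} := [ffun l => (l == i)%:R].

Lemma emb_dlt i : emb (dlt i) = xb i.
Proof.
rewrite /emb (bigD1 i) //= ffunE eqxx rmorph1 scale1r big1 ?addr0 // => l /negbTE li.
by rewrite ffunE li rmorph0 scale0r.
Qed.

Definition sandwich (z : {ffun {ffun 'I_2 -> I} -> E}) (y : {ffun I -> E}) : {ffun I -> E} :=
  \sum_p ascale (z p) (amul c0 (amul c0 (dlt (p ord0)) y) (sb (p ord_max))).

Definition sandwichA (z : {ffun {ffun 'I_2 -> I} -> E}) (d : A) : A :=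
  \sum_(p : {ffun 'I_2 -> I}) iota (z p) *: (xb (p ord0) * d * s (xb (p ord_max))).

Lemma emb_sandwich z y : emb (sandwich z y) = sandwichA z (emb y).
Proof. by rewrite emb_sum; apply: eq_bigr => p _; rewrite embZ !embM emb_dlt xS. Qed.

Lemma sandwichA_lin z (J : finType) (k : J -> F) (d : J -> A) :
  sandwichA z (\sum_j k j *: d j) = \sum_j k j *: sandwichA z (d j).
Proof.
rewrite /sandwichA; under [RHS]eq_bigr => j _ do rewrite scaler_sumr.
rewrite exchange_big; apply: eq_bigr => p _ /=.
rewrite mulr_sumr mulr_suml scaler_sumr; apply: eq_bigr => j _.
by rewrite -scalerAr -scalerAl !scalerA mulrC.
Qed.

Lemma sandwichA_mul z w d : sandwichA (amul (@tpow E I 2 c0) z w) d = sandwichA z (sandwichA w d).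
Proof.
transitivity (\sum_(p : {ffun 'I_2 -> I}) \sum_(q : {ffun 'I_2 -> I}) (iota (z p) * iota (w q)) *:
    (xb (p ord0) * xb (q ord0) * d * s (xb (p ord_max) * xb (q ord_max)))); last first.
  rewrite /sandwichA; apply: eq_bigr => p _; rewrite mulr_sumr mulr_suml scaler_sumr; apply: eq_bigr => q _.
  by rewrite hs.1 -scalerAr -scalerAl scalerA !mulrA.
rewrite /sandwichA; under eq_bigr => r _ do rewrite ffunE rmorph_sum scaler_suml.
rewrite exchange_big; apply: eq_bigr => p _ /=.
under eq_bigr => r _ do rewrite rmorph_sum scaler_suml.
rewrite exchange_big; apply: eq_bigr => q _ /=.
transitivity (\sum_(r : {ffun 'I_2 -> I}) (iota (z p) * iota (w q)) *:
   ((iota (c0 (p ord0) (q ord0) (r ord0)) *: xb (r ord0)) * d * s (iota (c0 (p ord_max) (q ord_max) (r ord_max)) *: xb (r ord_max)))).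
  apply: eq_bigr => r _; rewrite linearZ /= -!scalerAl -scalerAr !scalerA !rmorphM; congr (_ *: _).
  by rewrite /tpow big_ord_recl big_ord1 rmorphM !mulrA; congr (_ * iota (c0 (p _) (q _) (r _))); apply: val_inj.
rewrite -scaler_sumr; congr (_ *: _).
rewrite (sum_pairs (fun i j => iota (c0 (p ord0) (q ord0) i) *: xb i * d * s (iota (c0 (p ord_max) (q ord_max) j) *: xb j))).
rewrite !xM linear_sum /= !mulr_suml; apply: eq_bigr => i _; by rewrite mulr_sumr.
Qed.

(** With the right-hand factors collected in [bb i], Artin-Whaples gives [bb i = 0]; injectivity of
    [s] and freeness of [xb] then kill the coefficients. *)
Lemma sandwich_inj z : (forall i, sandwich z (dlt i) = 0) -> z = 0.
Proof.
move=> z0; have zA d : sandwichA z d = 0.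
  have [f ->] := xspan d; rewrite sandwichA_lin big1 // => i _.
  by rewrite -emb_dlt -emb_sandwich z0 emb0 scaler0.
pose bb i := \sum_j iota (z [ffun t : 'I_2 => if t == ord0 then i else j]) *: s (xb j).
have bb0 i : bb i = 0.
  rewrite -[i]enum_rankK; move: (enum_rank i).
  apply: (artin_whaples cen full (a := fun k : 'I_#|I| => xb (enum_val k)) (b := fun k => bb (enum_val k))).
    move=> k ka l; rewrite -[l]enum_valK; move: (enum_val l); apply: (xfree (f := fun i => k (enum_rank i))).
    rewrite -[RHS]ka [RHS](reindex _ (onW_bij _ (enum_rank_bij I))); apply: eq_bigr => j _ /=.
    by rewrite enum_rankK.
  move=> d; rewrite (reindex _ (onW_bij _ (enum_rank_bij I))) -[RHS](zA d) /=.
  pose G i j := iota (z [ffun t : 'I_2 => if t == ord0 then i else j]) *: (xb i * d * s (xb j)).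
  transitivity (\sum_i \sum_j G i j).
    by apply: eq_bigr => j _; rewrite enum_rankK /bb mulr_sumr; apply: eq_bigr => l _; rewrite -scalerAr.
  rewrite -(sum_pairs G); apply: eq_bigr => p _; rewrite /G; congr (iota (z _) *: _).
  apply/ffunP => t; rewrite ffunE; case: eqP => [->//|/eqP t0] /=.
  by congr (p _); apply: val_inj; case: t t0 => [[|[|t]] ht].
apply/ffunP => p; rewrite ffunE; apply/(fmorph_inj iota); rewrite rmorph0.
have : \sum_j iota (z [ffun t : 'I_2 => if t == ord0 then p ord0 else j]) *: xb j = 0.
  apply: (anti_inj full hs); rewrite linear_sum /= -[RHS](bb0 (p ord0)); apply: eq_bigr => j _.
  by rewrite linearZ.
move=> /xfree /(_ (p ord_max)) <-; congr (iota (z _)).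
apply/ffunP => t; rewrite ffunE; case: eqP => [->//|/eqP t0] /=.
by congr (p _); apply: val_inj; case: t t0 => [[|[|t]] ht].
Qed.

Lemma sandwich_linear k z w y : sandwich (ascale k z + w) y = ascale k (sandwich z y) + sandwich w y.
Proof.
apply: emb_inj; rewrite embD embZ !emb_sandwich scaler_sumr -big_split; apply: eq_bigr => p _ /=.
by rewrite !ffunE rmorphD rmorphM scalerDl scalerA.
Qed.

Variables (N : nat) (NI : #|I| = N).

Definition eta (i : 'I_N) : I := enum_val (cast_ord (esym NI) i).
Definition eta_inv (i : I) : 'I_N := cast_ord NI (enum_rank i).
Lemma etaK : cancel eta eta_inv. Proof. by move=> i; rewrite /eta_inv enum_valK cast_ordKV. Qed.
Lemma eta_invK : cancel eta_inv eta. Proof. by move=> i; rewrite /eta cast_ordK enum_rankK. Qed.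
Lemma eta_bij : bijective eta. Proof. by exists eta_inv; [exact: etaK | exact: eta_invK]. Qed.

Definition sandwich_mx (z : {ffun {ffun 'I_2 -> I} -> E}) : {ffun 'I_N * 'I_N -> E} :=
  [ffun ab => sandwich z (dlt (eta ab.2)) (eta ab.1)].

Lemma sandwich_mxE z b : sandwichA z (xb b) = \sum_a iota (sandwich_mx z (a, eta_inv b)) *: xb (eta a).
Proof.
rewrite -{1}emb_dlt -emb_sandwich /emb (reindex _ (onW_bij _ eta_bij)); apply: eq_bigr => a _ /=.
by rewrite ffunE /= eta_invK.
Qed.

(** An injective linear map between spaces of the same dimension [N ^ 2]. *)
Lemma sandwich_mx_bij : bijective sandwich_mx.
Proof.
pose V : vectType E := {ffun {ffun 'I_2 -> I} -> E^o}; pose W : vectType E := {ffun 'I_N * 'I_N -> E^o}.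
have [L LE] : exists L : 'Hom(V, W), forall z, L z = sandwich_mx z.
  apply: ex_linfun => k z w; apply/ffunP => ab; rewrite !ffunE.
  have -> : k *: z + w = ascale k z + w by apply/ffunP => p; rewrite !ffunE.
  by rewrite sandwich_linear !ffunE.
have L0 : lker L == 0%VS.
  rewrite -subv0; apply/subvP => z; rewrite memv_ker memv0 LE => /eqP /ffunP z0.
  apply/eqP; apply: sandwich_inj => i; apply/ffunP => l.
  by have := z0 (eta_inv l, eta_inv i); rewrite !ffunE /= !eta_invK.
have Lf : limg L = fullv.
  apply/eqP; rewrite eqEdim subvf /=; have := limg_ker_dim L fullv; rewrite (eqP L0) capv0 dimv0 add0n => ->.
  by rewrite !dimvf /dim /= card_ffun card_prod !card_ord NI mulnn.
exists (fun w => (L^-1)%VF w) => [z|w]; first by rewrite -LE lker0_lfunK.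
by rewrite -LE limg_lfunVK // Lf memvf.
Qed.

Lemma form_split : alg_iso (@tpow E I 2 c0) (@matc E N).
Proof.
exists sandwich_mx; split.
- by move=> k x y; apply/ffunP => ab; rewrite !ffunE sandwich_linear !ffunE.
- exact: sandwich_mx_bij.
move=> z w; apply/ffunP => -[a b]; rewrite matcM.
apply/(fmorph_inj iota)/eqP; rewrite -subr_eq0; apply/eqP.
pose g i := iota (sandwich_mx (amul (tpow c0) z w) (eta_inv i, b)) - iota (\sum_k sandwich_mx z (eta_inv i, k) * sandwich_mx w (k, b)).
suff : g (eta a) = 0 by rewrite /g etaK.
apply: xfree.
have Ez : sandwichA (amul (tpow c0) z w) (xb (eta b)) = \sum_k iota (sandwich_mx w (k, b)) *: sandwichA z (xb (eta k)).
  by rewrite sandwichA_mul sandwich_mxE sandwichA_lin etaK.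
rewrite (eq_bigr (fun i => iota (sandwich_mx (amul (tpow c0) z w) (eta_inv i, b)) *: xb i - iota (\sum_k sandwich_mx z (eta_inv i, k) * sandwich_mx w (k, b)) *: xb i)); last first.
  by move=> i _; rewrite /g scalerBl.
rewrite sumrB; apply/eqP; rewrite subr_eq0; apply/eqP.
transitivity (sandwichA (amul (tpow c0) z w) (xb (eta b))).
  by rewrite sandwich_mxE (reindex _ (onW_bij _ eta_bij)) etaK; apply: eq_bigr => k _; rewrite etaK.
rewrite Ez; under [RHS]eq_bigr => i _ do rewrite rmorph_sum scaler_suml.
rewrite [RHS]exchange_big; apply: eq_bigr => k _ /=.
rewrite sandwich_mxE scaler_sumr [RHS](reindex _ (onW_bij _ eta_bij)) /=; apply: eq_bigr => i _.
by rewrite !etaK rmorphM scalerA mulrC.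
Qed.

(** For centrality, [z] is [k] times the unit over [F], and a non-zero coordinate of [u] shows that
    [k] comes from [E]. For simplicity, sandwiches realise all linear endomorphisms, so one of them
    takes a non-zero [x] of an ideal to any given [y], without leaving the ideal. *)
Lemma form_csa d : N = (d ^ 2)%N -> is_csa d c0.
Proof.
move=> Nd; split; [by rewrite NI | by move=> x y z; apply: emb_inj; rewrite !embM mulrA |].
exists u; split.
- by move=> x; split; apply: emb_inj; rewrite embM x1 ?mul1r ?mulr1.
- move=> z zC; have [|k zk] := cen (z := emb z).
    move=> a; have [f ->] := xspan a; rewrite mulr_suml mulr_sumr; apply: eq_bigr => i _.
    by rewrite -scalerAl -scalerAr -emb_dlt -!embM zC.
  have uzE l : iota (z l) = k * iota (u l).
    apply/eqP; rewrite -subr_eq0; apply/eqP; move: l; apply: xfree.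
    rewrite (eq_bigr (fun l => iota (z l) *: xb l - k *: (iota (u l) *: xb l))).
      by rewrite sumrB -scaler_sumr -/(emb z) -/(emb u) x1 zk subrr.
    by move=> l _; rewrite scalerBl scalerA.
  have [l ul] : exists l, u l != 0.
    have [//|h] := EM (exists l, u l != 0); have /eqP : (1 : A) = 0; last by rewrite oner_eq0.
    rewrite -x1 /emb big1 // => l _; have -> : u l = 0 by apply/eqP/negPn/negP => ul; case: h; exists l.
    by rewrite rmorph0 scale0r.
  exists (z l / u l); apply: emb_inj; rewrite embZ x1 zk rmorphM fmorphV uzE mulfK // fmorph_eq0.
  by [].
move=> P [P0 PD PZ PM].
have [[x [Px xn]]|h] := EM (exists x, P x /\ x != 0); last first.
  by left=> x Px; apply/eqP/negPn/negP => xn; case: h; exists x.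
right=> y; have [b xbn] : exists b, x b != 0.
  have [//|h] := EM (exists b, x b != 0); case/eqP: xn; apply/ffunP => b; rewrite ffunE.
  by apply/eqP/negPn/negP => xbn; case: h; exists b.
have [G GK KG] := sandwich_mx_bij.
pose M : {ffun 'I_N * 'I_N -> E} := [ffun ab => (ab.2 == eta_inv b)%:R * (y (eta ab.1) / x b)].
have -> : y = sandwich (G M) x.
  apply: emb_inj; rewrite emb_sandwich /emb sandwichA_lin [RHS](bigD1 b) //= [X in _ + X]big1 ?addr0.
    rewrite sandwich_mxE scaler_sumr [LHS](reindex _ (onW_bij _ eta_bij)); apply: eq_bigr => a _ /=.
    by rewrite KG ffunE /= eqxx mul1r scalerA -rmorphM mulrC divfK.
  move=> i ib; rewrite sandwich_mxE big1 ?scaler0 // => a _.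
  by rewrite KG ffunE /= (can_eq eta_invK) (negbTE ib) mul0r rmorph0 scale0r.
rewrite /sandwich; elim/big_ind: _ => // p _; apply: PZ.
by have [_ h1] := PM (sb (p ord_max)) _ (PM (dlt (p ord0)) _ Px).1.
Qed.
End Form.

Lemma form_iso (F : fieldType) (I : finType) (A : falgType F) (xb : I -> A) (c c1 : I -> I -> I -> F)
  (g : {ffun I -> F} -> A) :
  (forall a, exists f : I -> F, a = \sum_i f i *: xb i) -> (forall f : I -> F, \sum_i f i *: xb i = 0 -> forall i, f i = 0) ->
  (forall i j, xb i * xb j = \sum_l c1 i j l *: xb l) ->
  linear (g : {ffun I -> F^o} -> A) -> bijective g -> (forall x y, g (amul c x y) = g x * g y) -> alg_iso c1 c.
Proof.
move=> xspan xfree xM gl [h gK hK] gM; have ginj := can_inj gK.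
pose ph := emb idfun xb.
have phI : injective ph by exact: emb_inj xfree.
have /choice[ps psE] : forall a, exists y, ph y = a.
  move=> a; have [f fE] := xspan a; exists [ffun i => f i].
  by rewrite [RHS]fE /ph /emb; apply: eq_bigr => i _; rewrite ffunE.
exists (h \o ph); split.
- move=> a x y; apply: ginj; rewrite /= hK /ph embD embZ -/ph.
  have := gl a (h (ph x)) (h (ph y)); rewrite !hK => <-.
  by congr (g (_ + _)); apply/ffunP => i; rewrite !ffunE.
- exists (ps \o g) => x /=; first by apply: phI; rewrite psE hK.
  by rewrite psE gK.
move=> x y; apply: ginj; rewrite gM /= !hK.
exact: (embM (iota := idfun) (c0 := c1) (xb := xb)).
Qed.

Lemma lift_rmorph (k E F : fieldType) (iE : {rmorphism E -> F}) (iota : {rmorphism k -> F}) :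
  (forall x, exists y, iE y = iota x) -> exists j : {rmorphism k -> E}, forall x, iE (j x) = iota x.
Proof.
move=> /choice[j jE]; have iI := fmorph_inj iE.
have jB : zmod_morphism j by move=> x y; apply: iI; rewrite rmorphB !jE rmorphB.
have jM : monoid_morphism j.
  by split=> [|x y]; apply: iI; rewrite ?rmorph1 ?rmorphM !jE ?rmorph1 ?rmorphM.
pose m1 := GRing.isZmodMorphism.Build k E j jB.
pose m2 := GRing.isMonoidMorphism.Build k E j jM.
pose j' : {rmorphism k -> E} := HB.pack j m1 m2.
by exists j'.
Qed.

Theorem mainTheorem1 (k : fieldType) (hk : 2 \in [pchar k])
  (F : fieldType) (iota : {rmorphism k -> F})
  (I : finType) (c : I -> I -> I -> F)
  (hA : is_csa 8 c) (hexp : exp_dvd 8 2 c) :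
  exists (E : fieldType) (iE : {rmorphism E -> F}) (jE : {rmorphism k -> E}),
    [/\ (forall x : k, iE (jE x) = iota x),
        trdeg_le jE 9 &
        exists c0 : I -> I -> I -> E,
          [/\ is_csa 8 c0, exp_dvd 8 2 c0 &
              alg_iso (fun i j l => iE (c0 i j l)) c]].
Proof.
have ch2 : 2 \in [pchar F] by rewrite (fmorph_pchar iota).
have [A [g [[gl gb gM] cen full dA [T [s [X [hs bX hX]]]]]]] := csa_nine ch2 hA hexp.
have hS := gen_fieldP iota T.
have ST i : gen_field iota T (T i) by exact: gen_box (box_T iota T i).
have [X1 XM Xs] := hX _ hS ST.
pose iE := subfield_incl hS.
have [jE jEE] : exists j : {rmorphism k -> subfield_field hS}, forall x, iE (j x) = iota x.
  apply: lift_rmorph => x; apply: subfield_lift; exact: gen_box (box_iota iota T x).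
exists (subfield_field hS), iE, jE; split=> //.
  move=> t; have [P [P0 Pt]] := gen_field_trdeg (t := fun i => iE (t i)) (fun i => subfield_inclP (t i)).
  exists P; split=> //; apply: (fmorph_inj iE); rewrite rmorph0 -Pt /mmap rmorph_sum; apply: eq_bigr => m _.
  rewrite rmorphM jEE /mmap1 rmorph_prod; congr (_ * _); apply: eq_bigr => i _.
  by rewrite rmorphXn.
have [xb [xX Xx xspan xfree]] := basis_index bX dA.
have coords a : sspan (gen_field iota T) X a -> exists f : {ffun I -> subfield_field hS}, emb iE xb f = a.
  move: a; apply: sspan_ind.
  - by exists 0; rewrite emb0.
  - by move=> v w [f <-] [f' <-]; exists (f + f'); rewrite embD.
  - by move=> a v /(subfield_lift hS)[b <-] [f <-]; exists (ascale b f); rewrite embZ.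
  by move=> x /Xx[i ->]; exists (dlt _ i); rewrite emb_dlt.
have /choice[sb sbE] : forall j, exists f, emb iE xb f = s (xb j) by move=> j; apply/coords/Xs.
have [u uE] := coords _ X1.
have /choice[c1 c1E] : forall p : I * I, exists f, emb iE xb f = xb p.1 * xb p.2 by move=> p; apply/coords/XM.
pose c0 i j l := c1 (i, j) l.
have xM i j : xb i * xb j = \sum_l iE (c0 i j l) *: xb l by rewrite -(c1E (i, j)).
have cI : #|I| = (8 ^ 2)%N by case: hA.
exists c0; split.
- exact: (form_csa cen full hs xspan xfree xM sbE uE cI).
- exact: (form_split cen full hs xspan xfree xM sbE cI).
exact: (form_iso xspan xfree xM gl gb gM).
Qed.
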